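(* If $D$ is a $4$-dicritical digraph with $n(D)$ vertices and $m(D)$ arcs, then $m(D)\geq\frac{10}{3}n(D)-\frac43$. Moreover, equality holds if and only if $D$ is $4$-Ore; otherwise $m(D)\geq\frac{10}{3}n(D)-1$.
   Context: Digraphs are finite, without loops or parallel arcs, but opposite arcs are allowed. A $k$-dicolouring of $D$ is a function $\phi:V(D)\to\{1,\dots,k\}$ such that no directed cycle of $D$ is monochromatic (a pair of opposite arcs is a directed cycle of length $2$). The dichromatic number $\vec{\chi}(D)$ is the smallest $k$ such that $D$ has a $k$-dicolouring. $D$ is $k$-dicritical if $\vec{\chi}(D)=k$ and $\vec{\chi}(H)<k$ for every proper subdigraph $H$ of $D$. A digon $[u,v]$ is a pair of opposite arcs $\{uv,vu\}$. A bidirected graph is a digraph in which every pair of adjacent vertices forms a digon; $\overleftrightarrow{K_r}$ is the bidirected complete graph on $r$ vertices. Ore-composition: let $D_1,D_2$ be (vertex-disjoint) bidirected graphs, $[x,y]$ a digon of $D_1$, $z\in V(D_2)$, and $(Z_1,Z_2)$ a partition of the neighbourhood $N_{D_2}(z)$ into two non-empty sets. The digraph obtained from the union of $D_1$ and $D_2$ by removing the digon $[x,y]$ and the vertex $z$, and adding a digon between $x$ and every vertex of $Z_1$ and a digon between $y$ and every vertex of $Z_2$, is an Ore-composition of $D_1$ and $D_2$. The class of $4$-Ore digraphs is the smallest class containing $\overleftrightarrow{K_4}$ and stable under Ore-composition. *)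

(* Defs.v *)
From HB Require Import structures.
From mathcomp Require Import all_boot all_order all_algebra.
From mathcomp Require Import boolp.

Set Implicit Arguments.
Unset Strict Implicit.
Unset Printing Implicit Defensive.

Record digraph := Digraph {
  vertex :> finType;
  arc : rel vertex;
  arc_irr : irreflexive arc
}.

Definition arcs (D : digraph) : {set D * D} := [set a : D * D | arc a.1 a.2].

Definition num_vertices (D : digraph) : nat := #|D|.

Definition num_arcs (D : digraph) : nat := #|arcs D|.

Definition adjacent (D : digraph) (u v : D) : bool := arc u v || arc v u.

Definition neighbourhood (D : digraph) (u : D) : {set D} :=
  [set v | adjacent u v].

Definition digon (D : digraph) (u v : D) : bool := arc u v && arc v u.

Definition bidirected (D : digraph) : Prop :=
  forall u v : D, adjacent u v -> digon u v.

Definition diso (D1 D2 : digraph) : Prop :=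
  exists2 f : D1 -> D2, bijective f & {mono f : u v / arc u v}.

Definition directed_cycle (D : digraph) (c : seq D) : Prop :=
  1 < size c /\ ucycle (@arc D) c.

Definition monochromatic (D : digraph) (k : nat) (phi : D -> 'I_k)
    (c : seq D) : Prop :=
  {in c &, forall u v, phi u = phi v}.

Definition dicolouring (D : digraph) (k : nat) (phi : D -> 'I_k) : Prop :=
  forall c : seq D, directed_cycle c -> ~ monochromatic phi c.

Definition dicolourable (D : digraph) (k : nat) : Prop :=
  exists phi : D -> 'I_k, dicolouring phi.

Lemma ex_dicolourable (D : digraph) : exists k, `[< dicolourable D k >].
Proof.
exists #|D|; apply/asboolP; exists enum_rank => c [].
case: c => [|u [|v c]] //= _ /andP[_ /andP[+ _]] mono.
by rewrite (enum_rank_inj (mono u v _ _)) ?inE ?eqxx ?orbT.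
Qed.

Definition dichromatic_number (D : digraph) : nat := ex_minn (ex_dicolourable D).

Record subdigraph (D : digraph) := Subdigraph {
  sub_verts : {set D};
  sub_arcs : {set D * D};
  sub_arcsP : forall a, a \in sub_arcs ->
    [&& a \in arcs D, a.1 \in sub_verts & a.2 \in sub_verts]
}.

Section SubdigraphDigraph.
Variables (D : digraph) (H : subdigraph D).

Definition sub_arc : rel {v : D | v \in sub_verts H} :=
  fun u v => (val u, val v) \in sub_arcs H.

Lemma sub_arc_irr : irreflexive sub_arc.
Proof.
move=> u; apply/negP => /sub_arcsP /and3P[+ _ _].
by rewrite inE /= arc_irr.
Qed.

Definition digraph_of_sub : digraph := Digraph sub_arc_irr.
End SubdigraphDigraph.

Coercion digraph_of_sub : subdigraph >-> digraph.

Definition proper_subdigraph (D : digraph) (H : subdigraph D) : Prop :=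
  ~ (sub_verts H = [set: D] /\ sub_arcs H = arcs D).

Definition dicritical (k : nat) (D : digraph) : Prop :=
  dichromatic_number D = k /\
  forall H : subdigraph D, proper_subdigraph H -> dichromatic_number H < k.

Definition complete_arc (r : nat) : rel 'I_r := fun u v => u != v.

Lemma complete_arc_irr (r : nat) : irreflexive (@complete_arc r).
Proof. by move=> u; rewrite /complete_arc eqxx. Qed.

Definition bidirected_complete (r : nat) : digraph :=
  Digraph (@complete_arc_irr r).

Section OreComposition.
Variables (D1 D2 : digraph) (x y : D1) (z : D2) (Z1 Z2 : {set D2}).

Definition ore_cross (u : D1) (w : D2) : bool :=
  (u == x) && (w \in Z1) || (u == y) && (w \in Z2).

Definition ore_arc : rel (D1 + {w : D2 | w != z})%type := fun a b =>
  match a, b with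
  | inl u, inl v => arc u v && ((u, v) \notin [set (x, y); (y, x)])
  | inr u, inr v => arc (val u) (val v)
  | inl u, inr w => ore_cross u (val w)
  | inr w, inl u => ore_cross u (val w)
  end.

Lemma ore_arc_irr : irreflexive ore_arc.
Proof. by case=> u /=; rewrite arc_irr. Qed.

Definition ore_digraph : digraph := Digraph ore_arc_irr.
End OreComposition.

(* Vertex-disjointness of D1 and D2 is obtained by taking the disjoint sum of
   their vertex types; the result is considered up to isomorphism. *)
Definition ore_composition (D1 D2 D : digraph) : Prop :=
  [/\ bidirected D1, bidirected D2 &
      exists (x y : D1) (z : D2) (Z1 Z2 : {set D2}),
        [/\ digon x y,
            Z1 :|: Z2 = neighbourhood z, [disjoint Z1 & Z2],
            Z1 != set0 /\ Z2 != set0 &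
            diso D (ore_digraph x y z Z1 Z2)]].

Inductive four_Ore : digraph -> Prop :=
| four_Ore_K4 D : diso D (bidirected_complete 4) -> four_Ore D
| four_Ore_comp D1 D2 D :
    four_Ore D1 -> four_Ore D2 -> ore_composition D1 D2 D -> four_Ore D.

(* Main.v *)
Require Import Defs.
From mathcomp Require Import all_boot all_order all_algebra.
From mathcomp Require Import perm.
From mathcomp Require Import zify ring lra.
From mathcomp Require Import boolp.

(** The potential of a digraph with n vertices and m arcs is 10n - 3m, and a
    vertex set has the potential of the digraph it induces. The theorem says that
    4-dicritical digraphs have potential at most 4, and exactly 4 only when they
    are 4-Ore; the last bound then follows because potentials are integers. That
    4-Ore digraphs have potential 4 is a count. Everything else concerns a
    smallest 4-dicritical digraph of potential at least 4 that is not 4-Ore.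
    Digraphs are represented by arc sets on one finite type, so that parts,
    identifications and compositions of an arc set are again arc sets there and
    the induction is on the number of endpoints.

    Potentials. Colour a proper vertex set R with three colours and collapse its
    colour classes to a triangle. The result is not colourable, so it contains a
    smaller critical arc set, of potential at most 4; adding its vertices to R
    lowers the potential of R by at least 6 (collapsed_drop). Hence proper sets
    have potential at least 10 (pot10). If one has potential 10, all the estimates
    are equalities for every colouring, so its boundary is monochromatic in every
    colouring; a smallest such set has just two boundary vertices (ore_forced),
    and the digraph is an Ore composition (pot11). The same argument with a
    colouring that separates two boundary vertices gives at least 12, and at least
    13 for sets that miss two vertices (pot12, pot13, with ore_triangle).
    Conversely, few arcs added inside a proper set keep it colourable, because the
    critical set they would create has small potential.

    Degrees. All in- and out-degrees are at least 3. Let y have in-degree 3. If an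
    arc from x to y is not half of a digon, the other two in-neighbours of y have
    out-degree at least 4: delete y, let x inherit its out-arcs, and observe that
    a critical set in the resulting uncolourable digraph must span (single_in). If
    all in-arcs of y are halves of digons, so are its out-arcs (double_in), and
    two in-neighbours of y of out-degree 3 would be of the same kind; but a path of
    three such vertices does not exist (no_path). So y always has at least two
    in-neighbours of out-degree at least 4 (card_in_neighbours_out3). A vertex of
    out-degree k at least 4 can pay 1 along each out-arc from 6k - 20, whence
    3m + o >= 10n + i, where o and i count the vertices of out-degree and of
    in-degree 3 (discharge). With the same inequality for the converse digraph,
    3m >= 10n, so the potential is not positive: a contradiction. *)

Set Implicit Arguments.
Unset Strict Implicit.
Unset Printing Implicit Defensive.

(** * Arc sets and their colourings *)

(* Linear arithmetic on the cardinals in sight. Equal cardinals may be elaborated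
   differently (the type of arcs is a product), so they are first replaced by
   variables up to conversion. *)
Ltac arith :=
  repeat match goal with h : ?P |- _ =>
    match P with
    | context [@card.body] => revert h
    | context [leq] => revert h
    end end;
  clear;
  repeat match goal with |- context [@card.body ?T ?A] =>
    let n := fresh "n" in set n := (@card.body T A); clearbody n end;
  intros; lia.

Section ArcSets.

Variable T : finType.
Implicit Types (E F W Q : {set T * T}) (A B R S X : {set T}) (u v w x y : T).

(** Colour classes are certified to be acyclic by a rank that increases along
    their arcs. Ranks can be shifted, refined and glued, which is how all
    colourings below are combined. *)
Definition col3 E (phi : T -> 'I_3) (f : T -> nat) : Prop :=
  forall u v, (u, v) \in E -> phi u = phi v -> f u < f v.

Definition colourable E : Prop := exists phi f, col3 E phi f.

Definition loopless E : Prop := forall u, (u, u) \notin E.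

Definition critical E : Prop :=
  [/\ loopless E, ~ colourable E & forall a, a \in E -> colourable (E :\ a)].

Definition VE E : {set T} :=
  [set v | [exists w, ((v, w) \in E) || ((w, v) \in E)]].

Definition induced E S : {set T * T} := [set a in E | (a.1 \in S) && (a.2 \in S)].

Definition outs E x : {set T} := [set w | (x, w) \in E].
Definition ins E x : {set T} := [set w | (w, x) \in E].

Definition swap (a : T * T) : T * T := (a.2, a.1).
Definition converse E : {set T * T} := [set a | swap a \in E].

Definition symm E : Prop := forall u v, (u, v) \in E -> (v, u) \in E.

Definition digon_set u v : {set T * T} := [set a | (a == (u, v)) || (a == (v, u))].

Lemma digon_setE u v : digon_set u v = [set (u, v); (v, u)].
Proof. by apply/setP => a; rewrite !inE. Qed.

Lemma in_induced E S u v :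
  ((u, v) \in induced E S) = [&& (u, v) \in E, u \in S & v \in S].
Proof. by rewrite inE. Qed.

Lemma induced_sub E S : induced E S \subset E.
Proof. by apply/subsetP => a; rewrite inE => /andP[]. Qed.

Lemma VEP E v : reflect (exists w, (v, w) \in E \/ (w, v) \in E) (v \in VE E).
Proof.
rewrite inE; apply: (iffP existsP) => -[w].
  by move=> /orP[]; exists w; [left|right].
by move=> h; exists w; case: h => ->; rewrite ?orbT.
Qed.

Lemma VEl E u v : (u, v) \in E -> u \in VE E.
Proof. by move=> h; apply/VEP; exists v; left. Qed.

Lemma VEr E u v : (u, v) \in E -> v \in VE E.
Proof. by move=> h; apply/VEP; exists u; right. Qed.

Lemma VE_sub E S : (forall u v, (u, v) \in E -> u \in S /\ v \in S) ->
  VE E \subset S.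
Proof. by move=> h; apply/subsetP => v /VEP[w [/h[]|/h[]]]. Qed.

Lemma VES E F : E \subset F -> VE E \subset VE F.
Proof.
by move=> /subsetP h; apply: VE_sub => u v /h e; rewrite (VEl e) (VEr e).
Qed.

Lemma induced_VE E S : VE E \subset S -> induced E S = E.
Proof.
move=> /subsetP h; apply/setP => -[u v]; rewrite in_induced.
by case: (boolP (_ \in E)) => //= e; rewrite (h _ (VEl e)) (h _ (VEr e)).
Qed.

Lemma col3_sub E F phi f : E \subset F -> col3 F phi f -> col3 E phi f.
Proof. by move=> /subsetP h c u v /h; apply: c. Qed.

Lemma colourable_sub E F : E \subset F -> colourable F -> colourable E.
Proof. by move=> s [phi [f c]]; exists phi, f; apply: col3_sub s c. Qed.

Lemma critical_sub E F : critical E -> F \subset E -> F != E -> colourable F.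
Proof.
case=> _ _ h s; rewrite eqEsubset s => /subsetPn[a aE aF].
apply: colourable_sub (h a aE); apply/subsetP => b bF.
rewrite !inE (subsetP s) // andbT; apply: contraNneq aF => <- //.
Qed.

Lemma critical_eq E F : critical E -> F \subset E -> ~ colourable F -> F = E.
Proof. by move=> c s n; case: (eqVneq F E) => // /(critical_sub c s). Qed.

Lemma loopless_sub E F : E \subset F -> loopless F -> loopless E.
Proof. by move=> /subsetP s l u; apply/negP => /s; apply/negP. Qed.

Lemma critical_exists E : loopless E -> ~ colourable E ->
  exists2 F : {set T * T}, F \subset E & critical F.
Proof.
have [n] := ubnP #|E|; elim: n E => // n IH E hn l nc.
case: (pselect (exists2 a, a \in E & ~ colourable (E :\ a))) => [[a aE na]|h].
  have s : E :\ a \subset E by apply: subsetDl.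
  case: (IH (E :\ a)) => //; first by rewrite (cardsD1 a) aE in hn.
    exact: loopless_sub l.
  by move=> F sF cF; exists F => //; apply: subset_trans s.
exists E => //; split => // a aE; apply: contrapT => na; apply: h.
by exists a.
Qed.

Lemma in_converse E u v : ((u, v) \in converse E) = ((v, u) \in E).
Proof. by rewrite inE. Qed.

Lemma converseK E : converse (converse E) = E.
Proof. by apply/setP => -[u v]; rewrite !in_converse. Qed.

Lemma card_conv E : #|converse E| = #|E|.
Proof.
have -> : converse E = swap @^-1: E by apply/setP => a; rewrite !inE.
by rewrite card_preimset // => -[a b] [c d] [-> ->].
Qed.

Lemma VE_conv E : VE (converse E) = VE E.
Proof.
by apply/setP => v; rewrite !inE; apply: eq_existsb => w; rewrite !in_converse orbC.
Qed.

Lemma induced_conv E S : induced (converse E) S = converse (induced E S).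
Proof. by apply/setP => -[u v]; rewrite in_converse !in_induced in_converse (andbC (u \in S)). Qed.

Lemma outs_conv E x : outs (converse E) x = ins E x.
Proof. by apply/setP => w; rewrite !inE. Qed.

Lemma ins_conv E x : ins (converse E) x = outs E x.
Proof. by apply/setP => w; rewrite !inE. Qed.

Lemma loopless_conv E : loopless E -> loopless (converse E).
Proof. by move=> l u; rewrite in_converse. Qed.

Definition maxf (f : T -> nat) : nat := \max_v f v.

Lemma maxfP (f : T -> nat) v : f v <= maxf f.
Proof. exact: (leq_bigmax v). Qed.

(** Reversing the order of the ranks certifies the converse. *)
Lemma colourable_conv E : colourable E -> colourable (converse E).
Proof.
move=> [phi [f c]]; exists phi, (fun v => maxf f - f v) => u v.
rewrite in_converse => e h; have := c _ _ e (esym h).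
have := maxfP f u; have := maxfP f v; lia.
Qed.

Lemma critical_conv E : critical E -> critical (converse E).
Proof.
move=> [l n c]; split; first exact: loopless_conv.
  by move=> /colourable_conv; rewrite converseK.
move=> [u v]; rewrite in_converse => /c /colourable_conv; apply: colourable_sub.
by apply/subsetP => -[a b]; rewrite in_setD1 !in_converse in_setD1 !xpair_eqE (andbC (b == v)).
Qed.

(** A vertex with at most two in-neighbours can be coloured last, with a colour
    foreign to its in-neighbours and the lowest rank. *)
Lemma critical_ins E v : critical E -> v \in VE E -> 2 < #|ins E v|.
Proof.
move=> cE vE; rewrite ltnNge; apply/negP => h.
have [_ nc _] := cE; apply: nc.
have [phi [f c]] : colourable [set a in E | (a.1 != v) && (a.2 != v)].
  apply: critical_sub cE _ _; first by apply/subsetP => a; rewrite inE => /andP[].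
  apply/eqP => /setP h'; have /VEP[w [e|e]] := vE.
    by have := h' (v, w); rewrite inE e eqxx.
  by have := h' (w, v); rewrite inE e eqxx andbF.
have [i hi] : exists i : 'I_3, i \notin phi @: ins E v.
  apply/existsP; rewrite -negb_forall; apply/negP => /forallP hh.
  have : #|phi @: ins E v| = 3.
    by apply: etrans (card_ord 3); apply: eq_card => i; rewrite hh.
  by move=> hc; have := leq_trans (leq_imset_card phi (ins E v)) h; rewrite hc.
exists (fun w => if w == v then i else phi w).
exists (fun w => if w == v then 0 else (f w).+1) => a b e.
case: (eqVneq b v) => [bv|bv]; case: (eqVneq a v) => [av|av] => //.
- by subst; have [l _ _] := cE; have := l v; rewrite e.
- by move=> hp; case/negP: hi; rewrite -hp imset_f // inE -bv.
- by move=> hp; rewrite ltnS; apply: c; rewrite // inE e av bv.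
Qed.

Lemma critical_outs E v : critical E -> v \in VE E -> 2 < #|outs E v|.
Proof.
move=> /critical_conv cE; rewrite -VE_conv -ins_conv; exact: critical_ins.
Qed.

Lemma critical_neq0 E : critical E -> exists v, v \in VE E.
Proof.
case=> _ nc _; case: (set_0Vmem E) => [e0|[[u v] e]]; last by exists u; apply: VEl e.
by case: nc; exists (fun=> ord0), (fun=> 0) => u v; rewrite e0 inE.
Qed.

Lemma ins_sub E v : loopless E -> ins E v \subset VE E :\ v.
Proof.
move=> l; apply/subsetP => w; rewrite !inE => e.
have -> : w != v by apply: contraTneq e => ->.
by apply/existsP; exists v; rewrite e.
Qed.

Lemma critical_card E : critical E -> 3 < #|VE E|.
Proof.
move=> cE; have [v vE] := critical_neq0 cE; have [l _ _] := cE.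
have := subset_leq_card (ins_sub v l); have := critical_ins cE vE.
rewrite (cardsD1 v (VE E)) vE; lia.
Qed.

(** ** Counting arcs *)

Lemma card_induced_small E S : loopless E -> #|induced E S| <= #|S| * #|S|.-1.
Proof.
move=> l; have s : induced E S \subset setX S S :\: (fun x => (x, x)) @: S.
  apply/subsetP => -[u v]; rewrite in_induced => /and3P[e us vs].
  rewrite inE in_setX us vs !andbT; apply/imsetP => -[x _ [hu hv]].
  by move: e; rewrite hu hv; apply/negP.
have := subset_leq_card s; rewrite cardsD.
rewrite (setIidPr _); last by apply/subsetP => _ /imsetP[x xS ->]; rewrite in_setX xS.
rewrite cardsX card_imset; last by move=> a b [].
case: #|S| => [|m] /=; lia.
Qed.

(** Attaching a vertex by digons to the vertices of B: the step by which
    potentials of explicit small configurations are computed. *)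
Lemma induced_add_vertex E S B v : v \notin S -> B \subset S ->
  (forall w, w \in B -> (v, w) \in E /\ (w, v) \in E) ->
  #|induced E S| + 2 * #|B| <= #|induced E (v |: S)|.
Proof.
move=> vS /subsetP BS h.
set P := (fun w => (v, w)) @: B; set Q := (fun w => (w, v)) @: B.
have cP : #|P| = #|B| by rewrite card_imset // => a b [].
have cQ : #|Q| = #|B| by rewrite card_imset // => a b [].
have hPQ : [disjoint P & Q].
  apply/pred0P => -[a b] /=; apply/negP => /andP[/imsetP[w wB [-> ->]]].
  by move=> /imsetP[w' w'B [hv]]; move/BS: w'B; rewrite -hv (negPf vS).
have hI : [disjoint induced E S & P :|: Q].
  apply/pred0P => -[a b] /=; apply/negP => /andP[]; rewrite in_induced inE.
  move=> /and3P[_ aS bS] /orP[] /imsetP[w wB [ha hb]].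
    by move: vS; rewrite -ha aS.
  by move: vS; rewrite -hb bS.
have -> : 2 * #|B| = #|P :|: Q|.
  by rewrite cardsU disjoint_setI0 // cards0 cP cQ; lia.
suff s : induced E S :|: (P :|: Q) \subset induced E (v |: S).
  by have := subset_leq_card s; rewrite [X in X <= _]cardsU disjoint_setI0 // cards0 subn0.
apply/subsetP => -[a b]; rewrite in_setU in_induced => /orP[/and3P[e aS bS]|].
  by rewrite in_induced e !inE aS bS !orbT.
rewrite in_setU => /orP[] /imsetP[w wB [-> ->]]; have [e1 e2] := h _ wB.
  by rewrite in_induced e1 !inE eqxx (BS _ wB) ?orbT.
by rewrite in_induced e2 !inE eqxx (BS _ wB) ?orbT.
Qed.

Lemma card_digon_set u v : #|digon_set u v| <= 2.
Proof. by rewrite digon_setE cards2; case: (_ != _). Qed.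

Lemma inducedS E S R : S \subset R -> induced E S \subset induced E R.
Proof.
move=> /subsetP h; apply/subsetP => -[u v]; rewrite !in_induced.
by case/and3P => -> /h-> /h->.
Qed.

(** ** Proper colourings of symmetric arc sets *)

Definition proper_col E (phi : T -> 'I_3) : Prop :=
  forall u v, (u, v) \in E -> phi u != phi v.

Lemma proper_col_sub E F phi : E \subset F -> proper_col F phi -> proper_col E phi.
Proof. by move=> /subsetP h c u v /h; apply: c. Qed.

Lemma proper_col3 E phi : proper_col E phi -> col3 E phi (fun=> 0).
Proof. by move=> p u v /p /eqP. Qed.

Lemma col3_proper E phi f : symm E -> col3 E phi f -> proper_col E phi.
Proof.
move=> s c u v e; apply/eqP => h; have := c _ _ e h.
have := c _ _ (s _ _ e) (esym h); lia.
Qed.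

Lemma symm_digon_set u v : symm (digon_set u v).
Proof.
move=> a b; rewrite !inE !xpair_eqE.
by case/orP => /andP[/eqP-> /eqP->]; rewrite !eqxx ?orbT.
Qed.

Lemma symmU E F : symm E -> symm F -> symm (E :|: F).
Proof. by move=> sE sF u v; rewrite !inE => /orP[/sE|/sF] ->; rewrite ?orbT. Qed.

Lemma symmD E F : symm E -> symm F -> symm (E :\: F).
Proof.
move=> sE sF u v; rewrite !inE => /andP[n /sE->]; rewrite andbT.
by apply: contraNN n => /sF.
Qed.

End ArcSets.

Lemma in_digon_set (T : finType) (u v a b : T) : ((a, b) \in digon_set u v) =
  ((a == u) && (b == v)) || ((a == v) && (b == u)).
Proof. by rewrite !inE !xpair_eqE. Qed.

(** * Ore compositions of arc sets *)

Section OreArcs.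

Variable T : finType.
Implicit Types (E F W Q : {set T * T}) (A B S R X : {set T}) (u v w x y : T).

Definition map_arc (k : T -> T) (a : T * T) : T * T := (k a.1, k a.2).

Definition fuse x y v : T := if v == y then x else v.

Definition complete S : {set T * T} :=
  [set a | [&& a.1 \in S, a.2 \in S & a.1 != a.2]].

(** An Ore composition inside one type: F is E2 with the arcs at x shared out
    between x and y, and fuse x y undoes the sharing. Symmetry of F says that
    the two arcs of a digon go to the same vertex. *)
Record glue E1 E2 F x y : Prop := Glue {
  glue_arc : (x, y) \in E1;
  glue_VE : VE E1 :&: VE E2 = [set x];
  glue_symm : symm F;
  glue_inj : {in F &, injective (map_arc (fuse x y))};
  glue_im : map_arc (fuse x y) @: F = E2;
  glue_x : x \in VE F;
  glue_y : y \in VE F }.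

Inductive ore : {set T * T} -> Prop :=
| ore_K4 S : #|S| = 4 -> ore (complete S)
| ore_comp E1 E2 F x y : ore E1 -> ore E2 -> glue E1 E2 F x y ->
    ore ((E1 :\: digon_set x y) :|: F).

Definition ore_basic E : Prop :=
  [/\ loopless E, symm E, 10 * #|VE E| = 3 * #|E| + 4 & ~ colourable E].

Lemma completeP S u v :
  ((u, v) \in complete S) = [&& u \in S, v \in S & u != v].
Proof. by rewrite inE. Qed.

Lemma VE_complete S : 1 < #|S| -> VE (complete S) = S.
Proof.
move=> h; apply/eqP; rewrite eqEsubset; apply/andP; split.
  by apply: VE_sub => u v; rewrite completeP => /and3P[].
apply/subsetP => v vS.
have [w] : exists w, w \in S :\ v.
  by apply/set0Pn; rewrite -card_gt0; rewrite (cardsD1 v) vS in h.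
rewrite in_setD1 => /andP[wv wS]; apply: (@VEl _ _ v w).
by rewrite completeP vS wS eq_sym wv.
Qed.

Lemma card_complete S : #|complete S| = #|S| * #|S|.-1.
Proof.
have -> : complete S = setX S S :\: (fun x => (x, x)) @: S.
  apply/setP => -[u v]; rewrite completeP inE in_setX.
  case: (boolP (u \in S)) => us; rewrite ?andbF //.
  case: (boolP (v \in S)) => vs; rewrite ?andbF //= andbT; congr (~~ _).
  apply/eqP/imsetP => [->|[x _ [-> ->]] //]; by exists v.
rewrite cardsD (setIidPr _); last first.
  by apply/subsetP => _ /imsetP[x xS ->]; rewrite in_setX xS.
rewrite cardsX card_imset; last by move=> a b [].
by case: #|S| => [|m] //=; lia.
Qed.

Lemma proper_complete S phi : proper_col (complete S) phi -> #|S| <= 3.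
Proof.
move=> p; have inj : {in S &, injective phi}.
  move=> u v uS vS h; apply/eqP; apply: contraT => n.
  by have := p u v; rewrite completeP uS vS n h eqxx => /(_ isT).
by rewrite -(card_in_imset inj) -[X in _ <= X](card_ord 3) max_card.
Qed.

Lemma symm_complete S : symm (complete S).
Proof. by move=> u v; rewrite !completeP eq_sym => /and3P[-> -> ->]. Qed.

Lemma ore_basic_K4 S : #|S| = 4 -> ore_basic (complete S).
Proof.
move=> h; split.
- by move=> u; rewrite completeP eqxx !andbF.
- exact: symm_complete.
- by rewrite VE_complete ?h // card_complete h.
- by move=> [phi [f /(col3_proper (@symm_complete S)) /proper_complete]]; rewrite h.
Qed.

Lemma fuse_id x y v : v != y -> fuse x y v = v.
Proof. by rewrite /fuse => /negPf->. Qed.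

Lemma fuse_y x y : fuse x y y = x.
Proof. by rewrite /fuse eqxx. Qed.

Lemma fuse_x x y : fuse x y x = x.
Proof. by rewrite /fuse; case: eqP. Qed.

Section Glue.
Variables (E1 E2 F : {set T * T}) (x y : T).
Hypothesis (b1 : ore_basic E1) (b2 : ore_basic E2) (g : glue E1 E2 F x y).
Let H := (E1 :\: digon_set x y) :|: F.

Lemma glue_neq : x != y.
Proof.
by have [l _ _ _] := b1; apply: contraTneq (glue_arc g) => ->; apply: l.
Qed.

Lemma glue_xV1 : x \in VE E1. Proof. exact: VEl (glue_arc g). Qed.
Lemma glue_yV1 : y \in VE E1. Proof. exact: VEr (glue_arc g). Qed.

Lemma glue_xV2 : x \in VE E2.
Proof. by have := set11 x; rewrite -(glue_VE g) inE => /andP[]. Qed.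

Lemma glue_V12 v : v \in VE E1 -> v \in VE E2 -> v = x.
Proof. by move=> h1 h2; apply/set1P; rewrite -(glue_VE g) inE h1. Qed.

Lemma glue_yV2 : y \notin VE E2.
Proof.
by apply: contraNN glue_neq => h; rewrite (glue_V12 glue_yV1 h).
Qed.

Lemma glueF u v : (u, v) \in F -> (fuse x y u, fuse x y v) \in E2.
Proof. by move=> h; rewrite -(glue_im g); apply/imsetP; exists (u, v). Qed.

Lemma glueE2 u v : (u, v) \in E2 -> exists a b, [/\ (a, b) \in F,
  fuse x y a = u & fuse x y b = v].
Proof.
by rewrite -(glue_im g) => /imsetP[[a b] h [-> ->]]; exists a, b.
Qed.

Lemma fuse_VF v : (v \in VE F) = (fuse x y v \in VE E2).
Proof.
apply/idP/idP.
  by move=> /VEP[w [/glueF/VEl|/glueF/VEr]].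
case: (eqVneq v y) => [-> _|n]; first exact: glue_y g.
rewrite fuse_id // => /VEP[w [/glueE2|/glueE2]] [a [b []]] h.
- rewrite {1}/fuse; case: eqP => [_ <- _|_ <- _]; [exact: glue_x g|exact: VEl h].
- rewrite {2}/fuse; case: (b =P y) => [_ _ <-|_ _ <-]; [exact: glue_x g|exact: VEr h].
Qed.

Lemma glue_VF : VE F = y |: VE E2.
Proof.
apply/setP => v; rewrite fuse_VF in_setU1.
by case: eqVneq => [->|n]; [rewrite fuse_y glue_xV2|rewrite fuse_id].
Qed.

Lemma card_VF : #|VE F| = #|VE E2|.+1.
Proof. by rewrite glue_VF cardsU1 glue_yV2. Qed.

Lemma glue_V1F v : v \in VE E1 -> v \in VE F -> v = x \/ v = y.
Proof.
move=> h; rewrite glue_VF in_setU1 => /orP[/eqP|/(glue_V12 h)] ->; by [right|left].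
Qed.

Lemma glue_noF u v : (u, v) \in F -> u \in VE E1 -> v \in VE E1 -> False.
Proof.
move=> h hu hv; have [l _ _ _] := b2; have := glueF h.
by case: (glue_V1F hu (VEl h)) => ->; case: (glue_V1F hv (VEr h)) => ->;
  rewrite ?fuse_x ?fuse_y (negPf (l x)).
Qed.

Lemma card_glueF : #|F| = #|E2|.
Proof. by rewrite -(glue_im g) card_in_imset //; apply: glue_inj g. Qed.

Lemma digon_set_E1 : digon_set x y \subset E1.
Proof.
have [_ s _ _] := b1; apply/subsetP => -[a b]; rewrite in_digon_set.
by case/orP => /andP[/eqP-> /eqP->]; [apply: glue_arc g|apply: s; apply: glue_arc g].
Qed.

Lemma card_digon_set2 u v : u != v -> #|digon_set u v| = 2.
Proof. by move=> n; rewrite digon_setE cards2 xpair_eqE (negPf n). Qed.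

Lemma card_E1D : #|E1 :\: digon_set x y| + 2 = #|E1|.
Proof.
by rewrite -(card_digon_set2 glue_neq) -(cardsID (digon_set x y) E1) (setIidPr digon_set_E1) addnC.
Qed.

Lemma glue_disj : [disjoint E1 :\: digon_set x y & F].
Proof.
apply/pred0P => -[u v] /=; apply/negP => /andP[].
rewrite inE => /andP[_ e] f; exact: glue_noF f (VEl e) (VEr e).
Qed.

Lemma card_glue : #|H| + 2 = #|E1| + #|E2|.
Proof.
rewrite /H cardsU disjoint_setI0 ?glue_disj // cards0 card_glueF.
have := card_E1D; lia.
Qed.

Lemma glue_F_H : F \subset H. Proof. exact: subsetUr. Qed.
Lemma glue_E1_H : E1 :\: digon_set x y \subset H. Proof. exact: subsetUl. Qed.

Lemma glue_in a : (a \in H) = (a \in E1 :\: digon_set x y) || (a \in F).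
Proof. by rewrite in_setU. Qed.

Lemma glue_VH : VE H = VE E1 :|: VE E2.
Proof.
apply/setP => v; apply/idP/idP.
  move=> /VEP[w []]; rewrite glue_in => /orP[].
  - by rewrite in_setD => /andP[_ /VEl]; rewrite in_setU => ->.
  - move=> /VEl; rewrite glue_VF in_setU1 in_setU => /orP[/eqP->|->]; rewrite ?orbT //.
    by rewrite glue_yV1.
  - by rewrite in_setD => /andP[_ /VEr]; rewrite in_setU => ->.
  - move=> /VEr; rewrite glue_VF in_setU1 in_setU => /orP[/eqP->|->]; rewrite ?orbT //.
    by rewrite glue_yV1.
have hF : v \in VE F -> v \in VE H by apply: subsetP; apply: VES glue_F_H.
rewrite in_setU => /orP[|h]; last by apply: hF; rewrite glue_VF in_setU1 h orbT.
case: (eqVneq v x) => [-> _|nx]; first by apply/(subsetP (VES glue_F_H))/(glue_x g).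
case: (eqVneq v y) => [-> _|ny]; first by apply/(subsetP (VES glue_F_H))/(glue_y g).
move=> /VEP[w [e|e]].
  by apply: (@VEl _ _ v w); rewrite glue_in in_setD in_digon_set e (negPf nx) (negPf ny).
by apply: (@VEr _ _ w v); rewrite glue_in in_setD in_digon_set e (negPf nx) (negPf ny) !andbF.
Qed.

Lemma card_VH : #|VE H| + 1 = #|VE E1| + #|VE E2|.
Proof.
rewrite glue_VH cardsU (glue_VE g) cards1.
have : 0 < #|VE E1| by apply/card_gt0P; exists x; apply: glue_xV1.
lia.
Qed.

Lemma glue_V1_H : VE E1 \subset VE H.
Proof. by rewrite glue_VH subsetUl. Qed.

Lemma symm_H : symm H.
Proof.
have [_ s _ _] := b1; apply: symmU (glue_symm g).
by apply: symmD s _; apply: symm_digon_set.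
Qed.

(** A common colour of x and y would descend to a colouring of E2. *)
Lemma properF_neq phi : proper_col F phi -> phi x != phi y.
Proof.
move=> p; apply/eqP => h; have [_ _ _ nc] := b2; apply: nc.
exists phi, (fun=> 0); apply: proper_col3 => u v /glueE2[a [b [/p n <- <-]]].
have hm w : phi (fuse x y w) = phi w by rewrite /fuse; case: eqP => // ->.
by rewrite !hm.
Qed.

Lemma glue_basic : ore_basic H.
Proof.
have [l1 s1 c1 n1] := b1; have [l2 s2 c2 n2] := b2; split.
- move=> u; rewrite glue_in negb_or in_setD (negPf (l1 u)) andbF /=.
  by apply/negP => /glueF; rewrite (negPf (l2 _)).
- exact: symm_H.
- by have := card_VH; have := card_glue; lia.
- move=> [phi [f /(col3_proper symm_H) p]]; apply: n1.
  have hxy := properF_neq (proper_col_sub glue_F_H p).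
  exists phi, (fun=> 0); apply: proper_col3 => u v e.
  case: (boolP ((u, v) \in digon_set x y)) => [|n].
    by rewrite in_digon_set => /orP[] /andP[/eqP-> /eqP->] //; rewrite eq_sym.
  by apply: p; apply/(subsetP glue_E1_H); rewrite in_setD n.
Qed.

(** The deleted digon costs the union two arcs and the common vertex x is counted
    once; apart from that both sides contribute independently. *)
Lemma glue_count S1 S2 : S1 \subset VE E1 -> S2 \subset VE E2 ->
    x \in S1 -> y \in S1 -> x \in S2 ->
  #|induced E1 S1| + #|induced E2 S2| <= #|induced H (S1 :|: S2)| + 2 /\
  #|S1 :|: S2| + 1 = #|S1| + #|S2|.
Proof.
move=> /subsetP s1 /subsetP s2 x1 y1 x2; split; last first.
  have -> : #|S1 :|: S2| = #|S1| + #|S2| - 1.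
    rewrite cardsU; congr (_ - _); rewrite -(cards1 x); apply: eq_card => v.
    rewrite !inE; apply/andP/eqP => [[/s1 h1 /s2 h2]|->//].
    exact: glue_V12.
  have : 0 < #|S2| by apply/card_gt0P; exists x.
  lia.
set L := [set a in F | map_arc (fuse x y) a \in induced E2 S2].
have cL : #|L| = #|induced E2 S2|.
  have sub : L \subset F by apply/subsetP => a; rewrite inE => /andP[].
  rewrite -(card_in_imset (f := map_arc (fuse x y)) (D := L)); last first.
    by move=> a b aL bL; apply: (glue_inj g); apply: (subsetP sub).
  apply: eq_card => -[u v]; apply/imsetP/idP => [[a]|h].
    by rewrite inE => /andP[_ +] ->.
  have [a [b [ab ha hb]]] := glueE2 (subsetP (induced_sub E2 S2) _ h).
  by exists (a, b); rewrite ?inE /map_arc /= ha hb // ab /=; move: h; rewrite inE.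
have hS v : fuse x y v \in S2 -> v \in S1 :|: S2.
  by rewrite /fuse in_setU; case: eqP => [->|_ ->]; rewrite ?y1 ?orbT.
have hD : #|induced E1 S1 :\: digon_set x y| + 2 = #|induced E1 S1|.
  have sD : digon_set x y \subset induced E1 S1.
    apply/subsetP => -[a b] h; have := subsetP digon_set_E1 _ h; rewrite in_induced => ->.
    by move: h; rewrite in_digon_set => /orP[] /andP[/eqP-> /eqP->]; rewrite x1 y1.
  by rewrite -(card_digon_set2 glue_neq) -(cardsID (digon_set x y) (induced E1 S1)) (setIidPr sD)
    addnC.
suff s : (induced E1 S1 :\: digon_set x y) :|: L \subset induced H (S1 :|: S2).
  have := subset_leq_card s; rewrite cardsU disjoint_setI0 ?cards0 ?cL; first lia.
  apply: disjointWr (_ : L \subset F) _; first by apply/subsetP => a; rewrite inE => /andP[].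
  by apply: disjointWl glue_disj; apply: setSD; apply: induced_sub.
apply/subsetP => -[u v]; rewrite in_setU => /orP[].
  rewrite in_setD in_induced => /andP[n /and3P[e u1 v1]].
  by rewrite in_induced glue_in in_setD n e !in_setU u1 v1.
rewrite inE => /andP[f]; rewrite in_induced => /and3P[_ /hS h1 /hS h2].
by rewrite in_induced glue_in f orbT h1 h2.
Qed.

(** A set containing both x and y loses the two arcs of the deleted digon, hence
    gains 6 in potential. Adding the rest of the other side, which has potential
    4 in place of the 10 of the single vertex x, compensates exactly. *)
Lemma glue_lift S1 : S1 \subset VE E1 -> exists S, [/\ S \subset VE H,
  S1 \subset S, forall v, v \in S -> v \in VE E1 -> v \in S1 &
  10 * #|S| + 3 * #|induced E1 S1| <= 10 * #|S1| + 3 * #|induced H S|].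
Proof.
move=> s1; case: (boolP ((x \in S1) && (y \in S1))) => [/andP[hx hy]|n].
  exists (S1 :|: VE E2); split.
  - by rewrite subUset (subset_trans s1 glue_V1_H) glue_VH subsetUr.
  - exact: subsetUl.
  - by move=> v; rewrite in_setU => /orP[//|h2 h1]; rewrite (glue_V12 h1 h2).
  have [] := glue_count s1 (subxx _) hx hy glue_xV2.
  have [_ _ c2 _] := b2; rewrite (induced_VE (subxx (VE E2))); lia.
exists S1; split => //; first exact: subset_trans s1 glue_V1_H.
rewrite leq_add2l leq_mul2l /=; apply/subset_leq_card/subsetP => -[u v].
rewrite !in_induced glue_in in_setD => /and3P[-> hu hv]; rewrite hu hv !andbT.
apply/orP; left; apply: contraNN n.
by rewrite in_digon_set => /orP[] /andP[/eqP<- /eqP<-]; rewrite hu hv.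
Qed.

End Glue.

Lemma ore_basicP E : ore E -> ore_basic E.
Proof.
elim=> [S|{}E E2 F x y _ b1 _ b2]; first exact: ore_basic_K4.
exact: glue_basic.
Qed.

Lemma ore_card4 E : ore E -> #|VE E| = 4 -> E = complete (VE E).
Proof.
move=> o h; have [l _ c _] := ore_basicP o.
apply/eqP; rewrite eqEcard card_complete h; apply/andP; split; last lia.
apply/subsetP => -[u v] e; rewrite completeP (VEl e) (VEr e) /=.
by apply: contraTneq e => ->.
Qed.

Lemma ore_ge4 E : ore E -> 4 <= #|VE E|.
Proof.
elim=> [S h|{}E E2 F x y o1 h1 o2 h2 g]; first by rewrite VE_complete h.
have := card_VH g; lia.
Qed.

End OreArcs.

(** * Vertex sets of small potential in Ore compositions *)

Section OreDense.

Variable T : finType.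
Implicit Types (E F W Q : {set T * T}) (A B S R X : {set T}) (u v w x y : T).

Lemma glue_edge_side E1 E2 F x y : ore_basic E1 -> glue E1 E2 F x y ->
  10 * #|VE E1| <= 3 * #|induced ((E1 :\: digon_set x y) :|: F) (VE E1)| + 10.
Proof.
move=> b1 g; have [_ _ c1 _] := b1; have := card_E1D b1 g.
suff /subset_leq_card : E1 :\: digon_set x y \subset
    induced ((E1 :\: digon_set x y) :|: F) (VE E1) by arith.
apply/subsetP => -[u v] h; rewrite in_induced in_setU h /=.
by move: h; rewrite in_setD => /andP[_ e]; rewrite (VEl e) (VEr e).
Qed.

Lemma glue_E2F E1 E2 F x y u v : glue E1 E2 F x y -> (u, v) \in E2 ->
  u != x -> v != x -> (u, v) \in F.
Proof.
move=> g e nu nv; have [a [b [f ha hb]]] := glueE2 g e.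
have ea : a = u.
  by move: ha nu; rewrite /fuse; case: eqP => [_ <-|_ -> //]; rewrite eqxx.
have eb : b = v.
  by move: hb nv; rewrite /fuse; case: eqP => [_ <-|_ -> //]; rewrite eqxx.
by rewrite -ea -eb.
Qed.

(** A triangle lies inside the edge side of a composition, or misses it, or meets
    it in x or y alone: x and y are not adjacent after the composition. In the
    first two cases the edge side is the set sought. In the last one the triangle
    comes from a triangle of E2 through x; if E2 is a K4, the fourth vertex of E2
    completes the triangle to a K4 without a digon, of potential 40 - 30, and
    otherwise induction applies to E2. *)
Lemma ore_triangle W X : ore W -> #|X| = 3 -> complete X \subset W ->
    4 < #|VE W| ->
  exists S, [/\ S \proper VE W, 1 < #|S|, 10 * #|S| <= 3 * #|induced W S| + 10 &
    (X \subset S) || [disjoint X & S]].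
Proof.
move=> o; elim: o X => [S h|E1 E2 F x y o1 _ o2 IH g] X cX sX.
  by rewrite VE_complete h.
set H := (E1 :\: digon_set x y) :|: F => hc.
have b1 := ore_basicP o1; have b2 := ore_basicP o2.
have := ore_ge4 o1; have := ore_ge4 o2 => g2 g1.
have cV := card_VH g; rewrite -/H in cV.
have sX' u v : u \in X -> v \in X -> u != v -> (u, v) \in H.
  by move=> hu hv n; apply: (subsetP sX); rewrite completeP hu hv n.
have XV u : u \in X -> u \in VE H.
  move=> uX; have [v] : exists v, v \in X :\ u.
    by apply/set0Pn; rewrite -card_gt0; rewrite (cardsD1 u) uX in cX; arith.
  by rewrite in_setD1 eq_sym => /andP[n /(sX' _ _ uX)/(_ n)/VEl].
have pA := glue_edge_side b1 g; rewrite -/H in pA.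
have sA := glue_V1_H g.
have prA : VE E1 \proper VE H by rewrite properEcard sA /=; clear -cV g2; arith.
case: (boolP (X \subset VE E1)) => [XA|/subsetPn[p pX pA']].
  by exists (VE E1); split; rewrite ?XA //; clear -g1; arith.
case: (boolP [disjoint X & VE E1]) => [XA|].
  by exists (VE E1); split; rewrite ?XA ?orbT //; clear -g1; arith.
case/pred0Pn => q /= /andP[qX qA].
have FX u v : u \in X -> v \in X -> u != v -> v \notin VE E1 -> (u, v) \in F.
  move=> hu hv n /negP nv; have := sX' _ _ hu hv n.
  by rewrite glue_in in_setD => /orP[/andP[_ /VEr]|].
have xyA u : u \in X -> u \in VE E1 -> u = x \/ u = y.
  move=> uX uA; apply: (glue_V1F g uA); apply: (@VEl _ _ u p).
  by apply: FX => //; apply: contraTneq uA => ->.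
have q1 u : u \in X -> u \in VE E1 -> u = q.
  move=> uX uA; apply/eqP; apply: contraT => n.
  have := sX' _ _ uX qX n; rewrite glue_in in_setD.
  case/orP => [/andP[+ _]|/(glue_noF b2 g)/(_ uA qA)//].
  move: n; rewrite in_digon_set.
  by case: (xyA _ uX uA) => ->; case: (xyA _ qX qA) => ->; rewrite !eqxx ?orbT.
set X0 := X :\ q; have cX0 : #|X0| = 2.
  by rewrite (cardsD1 q) qX in cX; rewrite /X0; clear -cX; arith.
have X0A u : u \in X0 -> u \notin VE E1.
  by rewrite in_setD1 => /andP[n uX]; apply: contraNN n => /(q1 _ uX)/eqP.
have xA := glue_xV1 g; have yA := glue_yV1 g.
have X0x u : u \in X0 -> u != x by move=> /X0A; apply: contraNneq => ->.
have X0y u : u \in X0 -> u != y by move=> /X0A; apply: contraNneq => ->.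
have mq : fuse x y q = x.
  by case: (xyA _ qX qA) => ->; rewrite ?fuse_x ?fuse_y.
have s2 : symm E2 by case: b2.
have F0 u : u \in X0 -> (x, u) \in E2.
  move=> u0; have := X0A _ u0; move: (u0); rewrite in_setD1 => /andP[n uX] nA.
  rewrite eq_sym in n; have := glueF g (FX _ _ qX uX n nA).
  by rewrite mq fuse_id // X0y.
have X0V2 u : u \in X0 -> u \in VE E2 by move=> /F0/VEr.
have sX2 : complete (x |: X0) \subset E2.
  apply/subsetP => -[u v]; rewrite completeP !in_setU1.
  case/and3P => /orP[/eqP->|u0] /orP[/eqP->|v0]; rewrite ?eqxx // => n.
  - exact: F0.
  - by apply/s2/F0.
  have := v0; have := u0; rewrite !in_setD1 => /andP[_ uX] /andP[_ vX].
  have := glueF g (FX _ _ uX vX n (X0A _ v0)).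
  by rewrite !fuse_id ?X0y.
have cX2 : #|x |: X0| = 3.
  rewrite cardsU1 cX0; case: (boolP (x \in X0)) => // /X0x.
  by rewrite eqxx.
have hq : q = x \/ q = y by apply: xyA.
case: (leqP 5 #|VE E2|) => [h5|h4].
  have [S2 [pr2 h2 p2 alt]] := IH _ cX2 sX2 h5.
  have lt2 := proper_card pr2; have sub2 := proper_sub pr2.
  case/orP: alt => [|dj].
    rewrite subUset sub1set => /andP[xS2 X0S2].
    have [] := glue_count b1 b2 g (subxx _) sub2 xA yA xS2.
    rewrite (induced_VE (subxx _)) -/H => c1 c2; have [_ _ c3 _] := b1.
    have sub : VE E1 :|: S2 \subset VE H.
      by rewrite (glue_VH g) setUS.
    exists (VE E1 :|: S2); split; last (apply/orP; left).
    - by rewrite properEcard sub /=; clear -c2 cV lt2; arith.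
    - by clear -c2 g1 h2; arith.
    - by clear -c1 c2 c3 p2; arith.
    apply/subsetP => u uX; rewrite in_setU; case: (eqVneq u q) => [->|n].
      by rewrite qA.
    by rewrite (subsetP X0S2) ?orbT // in_setD1 n.
  have xS2 : x \notin S2.
    by rewrite (disjointFr dj) // in_setU1 eqxx.
  have nx u : u \in S2 -> u != x by move=> uS; apply: contraNneq xS2 => <-.
  exists S2; split => //.
  - rewrite properEcard; apply/andP; split; last by clear -lt2 cV g1; arith.
    by rewrite (glue_VH g) subsetU // sub2 orbT.
  - suff : induced E2 S2 \subset induced H S2 by move/subset_leq_card; clear -p2; arith.
    apply/subsetP => -[u v]; rewrite !in_induced => /and3P[e hu hv].
    by rewrite hu hv glue_in (glue_E2F g e) ?orbT //; apply: nx.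
  apply/orP; right; apply/pred0P => u /=; apply/negP => /andP[uX uS].
  case: (eqVneq u q) => [e|n].
    have yV2 := glue_yV2 b1 g.
    case: hq => hq; first by move: xS2; rewrite -hq -e uS.
    by move: yV2; rewrite -hq -e (subsetP sub2).
  by have := disjointFl dj uS; rewrite in_setU1 in_setD1 n uX orbT.
have c4 : #|VE E2| = 4 by clear -h4 g2; arith.
have [r] : exists r, r \in VE E2 :\: (x |: X0).
  apply/set0Pn; rewrite -card_gt0 cardsD.
  have := subset_leq_card (subsetIr (VE E2) (x |: X0)); clear -c4 cX2; arith.
rewrite in_setD in_setU1 negb_or => /andP[/andP[rx r0] r2].
have rX : r \notin X.
  apply: contraNN r0 => rX; rewrite in_setD1 rX andbT.
  have yV2 := glue_yV2 b1 g.
  have ry : r != y by apply: contraNneq yV2 => <-.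
  by case: hq => ->.
have ar u : u \in X0 -> (r, u) \in H /\ (u, r) \in H.
  move=> u0; suff e : (r, u) \in H by split=> //; apply: (symm_H b1 g).
  have e2 : (r, u) \in E2.
    rewrite (ore_card4 o2 c4) completeP r2 X0V2 //=.
    by apply: contraNneq r0 => ->.
  by rewrite glue_in (glue_E2F g e2) ?orbT // X0x.
have add := induced_add_vertex rX (subsetDl X [set q]) ar.
have c6 : 6 <= #|induced H X|.
  have -> : 6 = #|complete X| by rewrite card_complete cX.
  apply/subset_leq_card/subsetP.
  by move=> [u v]; rewrite completeP in_induced => /and3P[hu hv n]; rewrite hu hv sX'.
have cS : #|r |: X| = 4 by rewrite cardsU1 rX cX.
have sub : r |: X \subset VE H.
  apply/subsetP => u; rewrite in_setU1 => /orP[/eqP->|/XV//].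
  by rewrite (glue_VH g) in_setU r2 orbT.
exists (r |: X); split.
- by rewrite properEcard sub cS.
- by rewrite cS.
- by move: add; rewrite -/X0 cX0 cS; clear -c6; arith.
by rewrite subsetUr.
Qed.

End OreDense.

(** * Forced colours in Ore compositions *)

Section Forced.

Variable T : finType.
Implicit Types (E F W Q : {set T * T}) (A B S R X : {set T}) (u v w x y : T).

Lemma recolour (i j i' j' : 'I_3) : i != j -> i' != j' ->
  exists p : {perm 'I_3}, p i = i' /\ p j = j'.
Proof.
move=> n n'; exists (tperm i i' * tperm (tperm i i' j) j')%g.
rewrite !permM tpermL tpermL; split => //; apply: tpermD; last by rewrite eq_sym.
by rewrite -[X in _ != X](tpermL i i') (inj_eq perm_inj) eq_sym.
Qed.

(** Colourings of the two sides both distinguish x from y, so they agree on x and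
    y after a permutation of the colours of one side. *)
Lemma glue_combine E1 E2 F x y a b alpha beta :
    ore_basic E2 -> glue E1 E2 F x y ->
    proper_col (E1 :\: digon_set a b) alpha -> alpha x != alpha y ->
    proper_col F beta ->
  exists psi, [/\ proper_col (((E1 :\: digon_set x y) :|: F) :\: digon_set a b) psi,
    {in VE E1, psi =1 alpha} &
    exists p : {perm 'I_3}, {in VE F, forall v, psi v = p (beta v)}].
Proof.
move=> b2 g pa nxy pb.
have [p [px py]] := recolour (properF_neq b2 g pb) nxy.
pose psi v := if v \in VE E1 then alpha v else p (beta v).
have h1 : {in VE E1, psi =1 alpha} by move=> v; rewrite /psi => ->.
have h2 : {in VE F, forall v, psi v = p (beta v)}.
  move=> v vF; rewrite /psi; case: ifP => // v1.
  by case: (glue_V1F g v1 vF) => ->.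
exists psi; split=> //; last by exists p.
move=> u v; rewrite in_setD in_setU => /andP[nd /orP[]].
  rewrite in_setD => /andP[_ e]; rewrite !h1 ?(VEl e) ?(VEr e) //.
  by apply: pa; rewrite in_setD nd.
by move=> f; rewrite !h2 ?(VEl f) ?(VEr f) // (inj_eq perm_inj); apply: pb.
Qed.

Lemma loopless_digon_set u v : u != v -> loopless (digon_set u v).
Proof.
move=> n w; rewrite in_digon_set negb_or -!negb_or.
by apply/norP; split; apply: contraNN n => /andP[/eqP<- /eqP<-].
Qed.

Lemma loopless_U E F : loopless E -> loopless F -> loopless (E :|: F).
Proof. by move=> lE lF u; rewrite in_setU negb_or lE lF. Qed.

Lemma digon_set_l u v : (u, v) \in digon_set u v. Proof. by rewrite in_digon_set !eqxx. Qed.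
Lemma digon_set_r u v : (v, u) \in digon_set u v. Proof. by rewrite in_digon_set !eqxx orbT. Qed.

Lemma VE_digon_set u v S : u \in S -> v \in S -> VE (digon_set u v) \subset S.
Proof.
by move=> hu hv; apply: VE_sub => p q; rewrite in_digon_set => /orP[] /andP[/eqP-> /eqP->].
Qed.

Lemma VEU E F : VE (E :|: F) \subset VE E :|: VE F.
Proof.
apply: VE_sub => u v; rewrite !in_setU => /orP[] e; rewrite (VEl e) (VEr e);
by rewrite ?orbT.
Qed.

Lemma card_DU W F Q : W \subset F :|: Q -> #|W| <= #|W :&: F| + #|W :&: Q|.
Proof.
move=> s; have -> : W = (W :&: F) :|: (W :&: Q).
  by rewrite -setIUr; apply/esym/setIidPl.
rewrite cardsU -setIUr; have -> : W :&: (F :|: Q) = W by apply/setIidPl.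
arith.
Qed.

(** Deleting a digon ab of an Ore arc set forces a and b to have one colour. A
    third vertex c of the same forced colour means that the equality is obtained
    in two steps, and this shows in a proper vertex set of potential at most 10
    that does not contain both a and b.

    In a composition the edge side is such a set unless it contains a and b. If it
    contains c too, induction applies to E1. Otherwise the two sides can be
    coloured independently up to the names of the colours, so that the colour of c
    is tied to that of a through the colours of x and y only: both always equal
    that of x, or both that of y, or both the third one. In the first two cases
    either induction applies to E1 with x or y in the role of c, or that vertex is
    a or b and c is forced to agree with it inside F. In the third case joining a
    to x, y and c by digons asks for a fourth colour, and the critical arc set
    that results gives, together with the edge side, a set of potential at most
    2. *)
Lemma ore_forced H a b c : ore H -> (a, b) \in H -> c != a -> c != b ->
    c \in VE H ->
    (exists phi, proper_col (H :\: digon_set a b) phi) ->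
    (forall phi, proper_col (H :\: digon_set a b) phi -> phi c = phi a) ->
    (forall S, S \subset VE H -> S != set0 -> 3 * #|induced H S| + 4 <= 10 * #|S|) ->
    (forall W, critical W -> #|VE W| <= #|VE H| -> 10 * #|VE W| <= 3 * #|W| + 4) ->
  exists S, [/\ S \subset VE H, 1 < #|S|, 10 * #|S| <= 3 * #|induced H S| + 10 &
    ~~ ((a \in S) && (b \in S))].
Proof.
move=> o; elim: o a b c => {H} [K cK|E1 E2 F x y o1 IH o2 _ g] a b c.
  rewrite VE_complete ?cK // completeP => /and3P[aK bK ab] ca cb cK' [phi p].
  move=> /(_ _ p) h; have := p c a.
  rewrite in_setD completeP cK' aK ca in_digon_set (negPf ca) (negPf cb) /=.
  by rewrite h eqxx => /(_ isT).
set H := (E1 :\: digon_set x y) :|: F.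
have b1 := ore_basicP o1; have b2 := ore_basicP o2; have bH := glue_basic b1 b2 g.
move=> abH ca cb cH [psi0 p0] forced pot4 IHb.
have pA := glue_edge_side b1 g; rewrite -/H in pA.
have sA := glue_V1_H g.
have sF : F \subset H by apply: subsetUr.
have symH : symm H by case: bH.
have symF := glue_symm g.
have cV := card_VH g; rewrite -/H in cV.
have := ore_ge4 o1; have := ore_ge4 o2 => g2 g1.
case: (boolP ((a \in VE E1) && (b \in VE E1))) => [/andP[aA bA]|n]; last first.
  by exists (VE E1); split => //; arith.
have xy := glue_neq b1 g.
have abn : a != b by have [l _ _ _] := bH; apply: contraTneq abH => ->; apply: l.
have abF : (a, b) \notin F by apply/negP => /(glue_noF b2 g)/(_ aA bA).
have : (a, b) \in E1 :\: digon_set x y by move: abH; rewrite glue_in (negPf abF) orbF.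
rewrite in_setD => /andP[abxy abE1].
have baF : (b, a) \notin F by apply/negP => /symF; apply/negP.
have Fab : F \subset H :\: digon_set a b.
  apply/subsetP => -[u v] f; rewrite in_setD glue_in f orbT andbT in_digon_set.
  by apply/norP; split; apply/negP => /andP[/eqP eu /eqP ev]; subst;
     move: f; apply/negP.
have E1ab : (E1 :\: digon_set a b) :\: digon_set x y \subset H :\: digon_set a b.
  apply/subsetP => e; rewrite !in_setD glue_in in_setD.
  by case/and3P => -> -> ->.
have p0F : proper_col F psi0 by apply: proper_col_sub p0.
have p0E : proper_col (E1 :\: digon_set a b) psi0.
  move=> u v h; case: (boolP ((u, v) \in digon_set x y)) => [|n]; last first.
    by apply: p0; apply: (subsetP E1ab); rewrite in_setD n.
  have := properF_neq b2 g p0F.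
  by rewrite in_digon_set => q /orP[] /andP[/eqP-> /eqP->] //; rewrite eq_sym.
have xyE : (x, y) \in E1 :\: digon_set a b.
  rewrite in_setD (glue_arc g) andbT; apply: contraNN abxy.
  by rewrite !in_digon_set => /orP[] /andP[/eqP-> /eqP->]; rewrite !eqxx ?orbT.
have comb alpha beta : proper_col (E1 :\: digon_set a b) alpha -> proper_col F beta ->
    exists psi, [/\ psi c = psi a, {in VE E1, psi =1 alpha} &
    exists p : {perm 'I_3}, {in VE F, forall v, psi v = p (beta v)}].
  move=> pa pb; have [psi [pp h1 h2]] := glue_combine b2 g pa (pa _ _ xyE) pb.
  by exists psi; split => //; apply: forced.
have pot41 S1 : S1 \subset VE E1 -> S1 != set0 -> 3 * #|induced E1 S1| + 4 <= 10 * #|S1|.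
  move=> s1 n0; have [S [sS sub _ le]] := glue_lift b1 b2 g s1.
  have : S != set0.
    by apply: contraNneq n0 => e; rewrite -subset0 -e.
  move=> /(pot4 _ sS); rewrite -/H in le *; arith.
have IHb1 W : critical W -> #|VE W| <= #|VE E1| -> 10 * #|VE W| <= 3 * #|W| + 4.
  by move=> cW h; apply: IHb => //; apply: leq_trans h (subset_leq_card sA).
have lift q : q != a -> q != b -> q \in VE E1 ->
    (forall alpha, proper_col (E1 :\: digon_set a b) alpha -> alpha q = alpha a) ->
    exists S, [/\ S \subset VE H, 1 < #|S|, 10 * #|S| <= 3 * #|induced H S| + 10 &
      ~~ ((a \in S) && (b \in S))].
  move=> qa qb qA fq.
  have [S1 [s1 h1 pS1 nab]] := IH a b q abE1 qa qb qA (ex_intro _ _ p0E) fq pot41 IHb1.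
  have [S [sS sub back le]] := glue_lift b1 b2 g s1; rewrite -/H in le sS.
  exists S; split=> //; first by have := subset_leq_card sub; arith.
    arith.
  by apply: contraNN nab => /andP[/back-> // /back->].
case: (boolP (c \in VE E1)) => [cA|cA].
  apply: (lift c) => // alpha pa.
  have [psi [h h1 _]] := comb _ _ pa p0F.
  by rewrite -!h1.
have cF : c \in VE F.
  move: cH; rewrite (glue_VH g) in_setU (negPf cA) /= (glue_VF g) in_setU1 => ->.
  by rewrite orbT.
have xF := glue_x g; have yF := glue_y g.
have xA := glue_xV1 g; have yA := glue_yV1 g.
have p0ca : psi0 c = psi0 a by apply: forced.
have side q : q \in VE E1 -> q \in VE F -> psi0 a = psi0 q ->
    exists S, [/\ S \subset VE H, 1 < #|S|, 10 * #|S| <= 3 * #|induced H S| + 10 &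
      ~~ ((a \in S) && (b \in S))].
  move=> qA qF hq.
  have Fq beta : proper_col F beta -> beta c = beta q.
    move=> pb; have [psi [h h1 [p h2]]] := comb _ _ p0E pb.
    by apply: (@perm_inj _ p); rewrite -!h2 // h !h1.
  case: (boolP ((q == a) || (q == b))) => [qab|]; last first.
    rewrite negb_or => /andP[qa qb]; apply: (lift q) => // alpha pa.
    have [psi [h h1 [p h2]]] := comb _ _ pa p0F.
    by rewrite -!h1 // -h !h2 // (Fq _ p0F).
  have cq : c != q by apply: contraNneq cA => ->.
  have nc : ~ colourable (F :|: digon_set c q).
    move=> [phi [f cc]]; have := col3_proper (symmU symF (@symm_digon_set _ c q)) cc.
    move=> pp; have := pp c q; rewrite in_setU digon_set_l orbT => /(_ isT).
    by rewrite (Fq phi) ?eqxx //; apply: proper_col_sub pp; apply: subsetUl.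
  have lF : loopless F by apply: loopless_sub sF _; case: bH.
  have [W sW cW] := critical_exists (loopless_U lF (loopless_digon_set cq)) nc.
  have VW : VE W \subset VE F.
    apply: subset_trans (VES sW) _; apply: subset_trans (@VEU _ _) _.
    by rewrite subUset subxx VE_digon_set.
  have VWH := subset_trans VW (VES sF).
  have le4 := IHb W cW (subset_leq_card VWH).
  have g4 := critical_card cW.
  exists (VE W); split=> //; first arith.
    have := card_DU sW; have := card_digon_set c q.
    have := subset_leq_card (subsetIr W (digon_set c q)).
    suff /subset_leq_card : W :&: F \subset induced H (VE W) by arith.
    apply/subsetP => -[u v]; rewrite in_setI in_induced => /andP[e f].
    by rewrite (VEl e) (VEr e) (subsetP sF).
  apply/negP => /andP[/(subsetP VW) aF /(subsetP VW) bF].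
  move: abxy abn; rewrite in_digon_set.
  case: (glue_V1F g aA aF) => ->; case: (glue_V1F g bA bF) => ->; by rewrite ?eqxx ?orbT.
case: (eqVneq (psi0 a) (psi0 x)) => [h|ax]; first exact: (side x).
case: (eqVneq (psi0 a) (psi0 y)) => [h|ay]; first exact: (side y).
have Fc beta : proper_col F beta -> beta c != beta x /\ beta c != beta y.
  move=> pb; have [psi [h h1 [p h2]]] := comb _ _ p0E pb.
  by split; rewrite -(inj_eq (@perm_inj _ p)) -!h2 // h !h1.
have na : a \notin VE F.
  apply/negP => /(glue_V1F g aA) [] e; by move: ax ay; rewrite e ?eqxx.
(* In a proper colouring of F with D, the vertices x, y, c and a would need
   four colours. *)
pose D := digon_set a x :|: digon_set a y :|: digon_set a c.
have ax' : a != x by apply: contraNneq na => ->.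
have ay' : a != y by apply: contraNneq na => ->.
have nc : ~ colourable (F :|: D).
  move=> [phi [f cc]].
  have sD : symm D by do 2?apply: symmU; apply: symm_digon_set.
  have pp := col3_proper (symmU symF sD) cc.
  have pF : proper_col F phi by apply: proper_col_sub pp; apply: subsetUl.
  have nxy := properF_neq b2 g pF; have [cx cy] := Fc _ pF.
  have nx : phi a != phi x by apply: pp; rewrite !in_setU digon_set_l ?orbT.
  have ny : phi a != phi y by apply: pp; rewrite !in_setU digon_set_l ?orbT.
  have nc : phi a != phi c by apply: pp; rewrite !in_setU digon_set_l ?orbT.
  have : uniq [:: phi a; phi x; phi y; phi c].
    by rewrite /= !inE !negb_or nx ny nc nxy eq_sym cx eq_sym cy.
  move/card_uniqP => /= cd; have := max_card (mem [:: phi a; phi x; phi y; phi c]).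
  by rewrite card_ord cd.
have lF : loopless F by apply: loopless_sub sF _; case: bH.
have lD : loopless D.
  by do 2?apply: loopless_U; apply: loopless_digon_set; rewrite // eq_sym.
have [W sW cW] := critical_exists (loopless_U lF lD) nc.
have VW : VE W \subset a |: VE F.
  apply: subset_trans (VES sW) _; apply: subset_trans (@VEU _ _) _.
  rewrite subUset subsetUr /=; apply: VE_sub => u v; rewrite !in_setU !in_digon_set.
  by move=> /orP[/orP[]|] /orP[] /andP[/eqP-> /eqP->];
     rewrite ?in_set1 ?eqxx ?xF ?yF ?cF ?orbT.
have VWH : VE W \subset VE H.
  apply: subset_trans VW _; rewrite subUset sub1set (VES sF) (subsetP sA) //.
have le4 := IHb W cW (subset_leq_card VWH).
have aW : a \in VE W.
  apply: contraT => naW; have [_ ncW _] := cW; case: ncW.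
  exists psi0, (fun=> 0); apply: proper_col3; apply: proper_col_sub p0F.
  apply/subsetP => -[u v] e; have := subsetP sW _ e; rewrite !in_setU !in_digon_set.
  have ua : u != a by apply: contraNneq naW => <-; apply: VEl e.
  have va : v != a by apply: contraNneq naW => <-; apply: VEr e.
  by rewrite (negPf ua) (negPf va) !andbF !orbF.
have nb w : (w, a) \in W -> w \in [set x; y; c].
  move=> e; have := subsetP sW _ e; rewrite !in_setU !in_digon_set.
  case/orP => [/VEr|]; first by rewrite (negPf na).
  rewrite !inE eqxx !andbT (negPf ax') (negPf ay') (eq_sym a c) (negPf ca).
  by rewrite !andbF /= -orbA.
have sN : ins W a = [set x; y; c].
  apply/eqP; rewrite eqEcard; apply/andP; split.
    by apply/subsetP => w; rewrite inE; apply: nb.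
  rewrite (leq_trans _ (critical_ins cW aW)) //.
  rewrite -(setUC [set c]) cardsU1 cards2; by case: (_ \notin _); case: (_ != _).
have hW w : w \in [set x; y; c] -> w \in VE W.
  by rewrite -sN inE => /VEl.
have xW : x \in VE W by apply: hW; rewrite !inE eqxx.
have yW : y \in VE W by apply: hW; rewrite !inE eqxx ?orbT.
have cI : #|VE W :&: VE E1| = 3.
  have -> : VE W :&: VE E1 = [set a; x; y].
    apply/setP => v; rewrite in_setI; apply/andP/idP => [[vW vA]|].
      rewrite !inE; have := subsetP VW _ vW; rewrite in_setU1 => /orP[->//|vF].
      by case: (glue_V1F g vA vF) => ->; rewrite eqxx ?orbT.
    by move=> /setUP[/setUP[]|] /set1P->.
  by rewrite -setUA cardsU1 cards2 xy !inE negb_or ax' ay'.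
have cU : #|VE W :|: VE E1| + 3 = #|VE W| + #|VE E1|.
  by rewrite -cI cardsUI.
have n0 : VE W :|: VE E1 != set0 by apply/set0Pn; exists a; rewrite in_setU aW.
have sU : VE W :|: VE E1 \subset VE H by rewrite subUset VWH sA.
have := pot4 _ sU n0.
suff : #|E1 :\: digon_set x y| + #|W :&: F| <= #|induced H (VE W :|: VE E1)|.
  have := card_E1D b1 g; have := card_DU sW.
  have : #|W :&: D| <= 6.
    apply: leq_trans (subset_leq_card (subsetIr _ _)) _.
    have := card_digon_set a x; have := card_digon_set a y; have := card_digon_set a c.
    have := cardsU (digon_set a x :|: digon_set a y) (digon_set a c).
    have := cardsU (digon_set a x) (digon_set a y); rewrite /D; arith.
  have [_ _ c1 _] := b1; arith.
have dj : [disjoint E1 :\: digon_set x y & W :&: F].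
  by apply: disjointWr (subsetIr _ _) (glue_disj b2 g).
have -> : #|E1 :\: digon_set x y| + #|W :&: F| = #|(E1 :\: digon_set x y) :|: (W :&: F)|.
  by rewrite cardsU (disjoint_setI0 dj) cards0 subn0.
apply/subset_leq_card/subsetP => -[u v]; rewrite in_setU in_induced glue_in.
case/orP => [h|]; last first.
  by rewrite in_setI => /andP[e f]; rewrite f orbT !in_setU (VEl e) (VEr e).
by rewrite h; move: h; rewrite in_setD => /andP[_ e];
   rewrite !in_setU (VEl e) (VEr e) !orbT.
Qed.

End Forced.

(** * Collapsing a coloured vertex set *)

Section Potential.

Variable T : finType.
Implicit Types (E F W Q : {set T * T}) (A B S R X : {set T}) (u v w x y : T).

Definition collapse R (phi : T -> 'I_3) (rho : 'I_3 -> T) v : T :=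
  if v \in R then rho (phi v) else v.

Definition representatives R (phi : T -> 'I_3) (rho : 'I_3 -> T) : Prop :=
  forall v, v \in R -> rho (phi v) \in R /\ phi (rho (phi v)) = phi v.

Lemma representatives_exist R (phi : T -> 'I_3) a : a \in R ->
  exists rho, representatives R phi rho /\ rho (phi a) = a.
Proof.
move=> aR.
exists (fun i => if phi a == i then a else odflt a [pick v in R | phi v == i]).
split; last by rewrite eqxx.
move=> v vR; case: eqP => [//|_]; case: pickP => [w /andP[wR /eqP//]|/(_ v)].
by rewrite vR eqxx.
Qed.

Lemma collapse_notin R phi rho v : v \notin R -> collapse R phi rho v = v.
Proof. by rewrite /collapse => /negPf->. Qed.

(** The classes of a colouring of R are collapsed to representatives that are
    joined by digons. A colouring of the result has distinct colours on the
    representatives, so it extends to R along the classes; hence there is none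
    and a critical W remains. The arcs of W outside the triangle of
    representatives lift to arcs of E that leave or avoid R. *)
Lemma collapse_exists E R phi f rho :
    critical E -> R \subset VE E -> R != VE E -> R != set0 ->
    col3 (induced E R) phi f -> representatives R phi rho ->
  exists W, [/\ critical W, VE W \subset VE E,
    forall v, v \in VE W -> v \in R -> rho (phi v) = v,
    VE W :&: R != set0 &
    W :\: induced W R \subset
      map_arc (collapse R phi rho) @: (induced E (R :|: VE W) :\: induced E R)].
Proof.
move=> cE RV nRV R0 cR hr; set k := collapse R phi rho.
have [lE ncE _] := cE.
have kin v : (k v \in R) = (v \in R).
  by rewrite /k /collapse; case: (boolP (v \in R)) => [/hr[]|/negPf].
have kk v : k (k v) = k v.
  rewrite {1}/k /collapse kin; case: (boolP (v \in R)) => // vR.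
  by rewrite /k /collapse vR; case: (hr _ vR) => _ ->.
pose K := [set a : T * T | [&& a.1 \in R, a.2 \in R, k a.1 == a.1,
  k a.2 == a.2 & a.1 != a.2]].
pose Ek := map_arc k @: (E :\: induced E R) :|: K.
have out u v : (u, v) \in E :\: induced E R -> (u, v) \in E /\ ~~ ((u \in R) && (v \in R)).
  by rewrite in_setD in_induced => /andP[+ e]; rewrite e.
have lk : loopless Ek.
  move=> w; rewrite in_setU negb_or inE eqxx !andbF andbT.
  apply/imsetP => -[[u v] /out[e n] [h1 h2]]; have h : k u = k v by rewrite -h1 -h2.
  have hb : (u \in R) = (v \in R) by rewrite -kin h kin.
  move: n h; rewrite -hb andbb => uR; rewrite /k !collapse_notin -?hb // => uv.
  by move: e; rewrite uv; apply/negP.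
have nk : ~ colourable Ek.
  move=> [psi [g c]]; apply: ncE.
  (* Ranks are compared first in the collapsed digraph, then inside R. *)
  exists (psi \o k), (fun v => (maxf f).+1 * g (k v) + (if v \in R then f v else 0)).
  move=> u v e /= hpsi; case: (boolP ((u \in R) && (v \in R))) => [/andP[uR vR]|n].
    have kuv : k u = k v.
      apply/eqP; apply: contraT => n.
      have h1 := c (k u) (k v); have h2 := c (k v) (k u).
      have i1 : (k u, k v) \in Ek by rewrite in_setU !inE /= !kin uR vR !kk !eqxx n orbT.
      have i2 : (k v, k u) \in Ek.
        by rewrite in_setU !inE /= !kin uR vR !kk !eqxx eq_sym n orbT.
      have := h1 i1 hpsi; have := h2 i2 (esym hpsi); lia.
    have : phi u = phi v.
      have [_ <-] := hr _ uR; have [_ <-] := hr _ vR.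
      by move: kuv; rewrite /k /collapse uR vR => ->.
    rewrite uR vR kuv ltn_add2l; apply: cR.
    by rewrite in_induced e uR vR.
  have lt : g (k u) < g (k v).
    apply: c hpsi; rewrite in_setU; apply/orP; left; apply/imsetP; exists (u, v) => //.
    by rewrite in_setD in_induced e (negPf n).
  have h1 : (if u \in R then f u else 0) < (maxf f).+1.
    by case: ifP => // _; rewrite ltnS maxfP.
  have h2 : (maxf f).+1 * (g (k u)).+1 <= (maxf f).+1 * g (k v).
    by rewrite leq_mul2l lt orbT.
  by rewrite mulnS in h2; lia.
have [W sW cW] := critical_exists lk nk; exists W.
have cases u v : (u, v) \in W -> (u, v) \in K \/
    exists a b, [/\ (a, b) \in E, ~~ ((a \in R) && (b \in R)), k a = u & k b = v].
  move=> /(subsetP sW); rewrite in_setU => /orP[/imsetP[[a b] /out[e n] [-> ->]]|]; last by left.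
  by right; exists a, b.
have kV v : v \in VE E -> k v \in VE E.
  rewrite /k /collapse; case: ifP => // vR _; apply: (subsetP RV).
  by case: (hr _ vR).
split => //.
- apply: VE_sub => u v /cases[|[a [b [e _ <- <-]]]].
    by rewrite inE /= => /and5P[h1 h2 _ _ _]; split; apply: (subsetP RV).
  by split; apply: kV; [apply: VEl e|apply: VEr e].
- have fix1 v : k v = v -> v \in R -> rho (phi v) = v.
    by move=> + vR; rewrite /k /collapse vR.
  move=> v /VEP[w []] /cases[|[a [b [_ _ h1 h2]]]] vR; apply: fix1 => //.
  + by move: vR; rewrite inE /= => /and5P[_ _ /eqP].
  + by rewrite -h1 kk.
  + by move: vR; rewrite inE /= => /and5P[_ _ _ /eqP].
  + by rewrite -h2 kk.
- apply: contraNN R0 => /eqP X0.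
  have nR v : v \in VE W -> v \notin R.
    by move=> vW; apply/negP => vR; have := in_set0 v; rewrite -X0 in_setI vW vR.
  have WE : W \subset E.
    apply/subsetP => -[u v] e; have nu := nR _ (VEl e); have nv := nR _ (VEr e).
    case: (cases _ _ e) => [|[a [b [eE _ h1 h2]]]]; first by rewrite inE (negPf nu).
    move: nu nv; rewrite -h1 -h2 !kin => na nb.
    by rewrite /k !collapse_notin.
  have [_ ncW _] := cW; have eW := critical_eq cE WE ncW.
  by rewrite -X0 eW; apply/eqP/esym/setIidPr.
apply/subsetP => -[u v]; rewrite in_setD in_induced => /andP[n e]; rewrite e /= in n.
case: (cases _ _ e) => [|[a [b [eE nab h1 h2]]]].
  by rewrite inE /= => /and5P[h1 h2 _ _ _]; move: n; rewrite h1 h2.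
apply/imsetP; exists (a, b); last by rewrite /map_arc /= h1 h2.
have inS p : k p \in VE W -> p \in R :|: VE W.
  rewrite in_setU; case: (boolP (p \in R)) => //= pR.
  by rewrite /k collapse_notin.
rewrite in_setD !in_induced eE (negPf nab) /=.
by rewrite !inS // ?h1 ?h2; [apply: VEr e|apply: VEl e].
Qed.

(** If all arcs between R and its complement were at a, colourings of the two
    sides would fit together after a transposition that makes the colours of a
    agree and a shift that makes its ranks agree. *)
Lemma no_cut_vertex E R a : critical E -> R \subset VE E -> R != VE E -> 1 < #|R| ->
  exists b, [/\ b \in R, b != a &
    exists u, u \notin R /\ ((b, u) \in E \/ (u, b) \in E)].
Proof.
move=> cE RV nRV R2; apply: contrapT => none; have [lE ncE _] := cE; apply: ncE.
have only u v : (u, v) \in E -> (u \in R) != (v \in R) -> u != a -> v != a -> False.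
  move=> e n ua va; apply: none; move: n.
  case: (boolP (u \in R)) => uR; case: (boolP (v \in R)) => vR // _.
    by exists u; split => //; exists v; split => //; left.
  by exists v; split => //; exists u; split => //; right.
have [u0 u0V u0R] : exists2 u, u \in VE E & u \notin R.
  by apply/subsetPn; apply: contraNN nRV => h; rewrite eqEsubset RV.
have [phi [f c1]] : colourable (induced E R).
  apply: critical_sub cE (induced_sub _ _) _; apply: contraNneq u0R => h.
  move: u0V; rewrite -h => /VEP[w []]; rewrite in_induced; first by case/and3P.
  by case/and3P.
have [r rR ra] : exists2 r, r \in R & r != a.
  have [r] : exists r, r \in R :\ a.
    by apply/set0Pn; rewrite -card_gt0; rewrite (cardsD1 a) in R2; case: (a \in R) R2; lia.
  by rewrite in_setD1 => /andP[n h]; exists r.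
have [psi [g c2]] : colourable (E :\: induced E R).
  apply: critical_sub cE (subsetDl _ _) _; apply/eqP => h.
  have emp p q : (p, q) \in E -> ~~ ((p \in R) && (q \in R)).
    by rewrite -{1}h in_setD in_induced => /andP[+ e]; rewrite e.
  have := subsetP RV _ rR => /VEP[w [e|e]].
    have wR : w \notin R by have := emp _ _ e; rewrite rR.
    by apply: none; exists r; split => //; exists w; split => //; left.
  have wR : w \notin R by have := emp _ _ e; rewrite rR andbT.
  by apply: none; exists r; split => //; exists w; split => //; right.
pose p := tperm (psi a) (phi a).
pose G v := f v + g a; pose K v := g v + f a.
case: (boolP (a \in R)) => aR; last first.
  exists (fun v => if v \in R then phi v else psi v).
  exists (fun v => if v \in R then f v else g v) => u v e.
  case: (boolP (u \in R)) => uR; case: (boolP (v \in R)) => vR.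
  - by apply: c1; rewrite in_induced e uR vR.
  - case: (eqVneq v a) => [va|va]; last first.
      by case: (only _ _ e); rewrite ?uR ?(negPf vR) //; apply: contraNneq aR => <-.
    exfalso; apply: none; exists u; split=> //; last by exists v; split=> //; left.
    by apply: contraNneq aR => <-.
  - case: (eqVneq u a) => [ua|ua]; last first.
      by case: (only _ _ e); rewrite ?vR ?(negPf uR) //; apply: contraNneq aR => <-.
    exfalso; apply: none; exists v; split=> //; last by exists u; split=> //; right.
    by apply: contraNneq aR => <-.
  - by apply: c2; rewrite in_setD in_induced e (negPf uR).
exists (fun v => if v \in R then phi v else p (psi v)).
exists (fun v => if v \in R then G v else K v) => u v e.
case: (boolP (u \in R)) => uR; case: (boolP (v \in R)) => vR.
- move=> h; rewrite /G ltn_add2r; apply: c1 h.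
  by rewrite in_induced e uR vR.
- case: (eqVneq u a) => [ua|ua]; last first.
    by case: (only _ _ e); rewrite ?uR ?(negPf vR) //; apply: contraNneq vR => ->.
  rewrite ua => h; rewrite /G /K addnC ltn_add2r; apply: c2.
    by rewrite -ua in_setD in_induced e (negPf vR) andbF.
  by apply: (@perm_inj _ p); rewrite -h /p tpermL.
- case: (eqVneq v a) => [va|va]; last first.
    by case: (only _ _ e); rewrite ?vR ?(negPf uR) //; apply: contraNneq uR => ->.
  rewrite va => h; rewrite /G /K [X in _ < X]addnC ltn_add2r; apply: c2.
    by rewrite -va in_setD in_induced e (negPf uR).
  by apply: (@perm_inj _ p); rewrite h /p tpermL.
move=> h; rewrite /K ltn_add2r; apply: c2; last exact: perm_inj h.
by rewrite in_setD in_induced e (negPf uR).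
Qed.

End Potential.

(** * Potentials in a minimal counterexample *)

Section MinimalCounterexample.

Variable T : finType.
Implicit Types (F W Q : {set T * T}) (A B S R X : {set T}) (u v w x y : T).

Record minimal_counterexample (E : {set T * T}) : Prop := MinimalCounterexample {
  mc_crit : critical E;
  mc_pot : 3 * #|E| + 4 <= 10 * #|VE E|;
  mc_not_ore : ~ ore E;
  mc_IH : forall F, critical F -> #|VE F| < #|VE E| ->
    10 * #|VE F| <= 3 * #|F| + 4 /\ (10 * #|VE F| = 3 * #|F| + 4 -> ore F) }.

Variable E : {set T * T}.
Hypothesis M : minimal_counterexample E.
Let cE : critical E := mc_crit M.
Let potE : 3 * #|E| + 4 <= 10 * #|VE E| := mc_pot M.
Let IH := mc_IH M.

(** The outcome of a collapse of R: the critical arc set W, with the numerical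
    bounds that compare the potentials of R and of R together with VE W. The
    vertices of VE W :&: R are those of the triangle of representatives that W
    uses. *)
Record collapsed R (phi : T -> 'I_3) (rho : 'I_3 -> T) W : Prop := Collapsed {
  co_crit : critical W;
  co_VE : VE W \subset VE E;
  co_le : 10 * #|VE W| <= 3 * #|W| + 4;
  co_ore : 10 * #|VE W| = 3 * #|W| + 4 -> ore W;
  co_X1 : 0 < #|VE W :&: R|;
  co_X3 : #|VE W :&: R| <= 3;
  co_XX : #|induced W R| <= #|VE W :&: R| * #|VE W :&: R|.-1;
  co_card : #|R :|: VE W| + #|VE W :&: R| = #|R| + #|VE W|;
  co_arcs : #|W| + #|induced E R| <= #|induced E (R :|: VE W)| + #|induced W R|;
  co_lift : W :\: induced W R \subset
    map_arc (collapse R phi rho) @: (induced E (R :|: VE W) :\: induced E R) }.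

Lemma induced_VEI W R : induced W R = induced W (VE W :&: R).
Proof.
apply/setP => -[u v]; rewrite !in_induced !in_setI.
by case: (boolP (_ \in W)) => //= e; rewrite (VEl e) (VEr e).
Qed.

Lemma collapsed_exists R phi f rho :
    R \subset VE E -> R != VE E -> 3 < #|R| -> col3 (induced E R) phi f ->
    representatives R phi rho -> exists W, collapsed R phi rho W.
Proof.
move=> RV nRV R4 cR hr.
have R0 : R != set0 by rewrite -card_gt0; arith.
have [W [cW VW fixW X0 sW]] := collapse_exists cE RV nRV R0 cR hr.
exists W; set X := VE W :&: R in X0 *.
have X3 : #|X| <= 3.
  have inj : {in X &, injective phi}.
    move=> u v; rewrite !in_setI => /andP[uW uR] /andP[vW vR] h.
    by rewrite -(fixW _ uW uR) -(fixW _ vW vR) h.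
  rewrite -(card_in_imset inj); apply: leq_trans (max_card _) _.
  by rewrite card_ord.
have cU : #|R :|: VE W| + #|X| = #|R| + #|VE W|.
  by rewrite /X setIC cardsUI.
have sU : R :|: VE W \subset VE E by rewrite subUset RV.
have small : #|VE W| < #|VE E|.
  by have := subset_leq_card sU; arith.
have [le4 oW] := IH cW small.
split => //.
- by rewrite card_gt0.
- by rewrite -/X induced_VEI -/X card_induced_small //; case: cW.
have := subset_leq_card sW; have := leq_imset_card (map_arc (collapse R phi rho))
  (induced E (R :|: VE W) :\: induced E R).
have := cardsD W (induced W R); rewrite (setIidPr (induced_sub W R)).
have := cardsD (induced E (R :|: VE W)) (induced E R).
rewrite (setIidPr (inducedS E (subsetUl R (VE W)))).
have := subset_leq_card (induced_sub W R).
have := subset_leq_card (inducedS E (subsetUl R (VE W))).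
arith.
Qed.

(** The collapse costs at least 10, the least potential of a part of a triangle,
    and brings in a smaller critical arc set, of potential at most 4. *)
Lemma collapsed_drop R phi rho W : collapsed R phi rho W ->
  10 * #|R :|: VE W| + 3 * #|induced E R| + 6 <= 10 * #|R| + 3 * #|induced E (R :|: VE W)|.
Proof.
clear cE potE IH M; case=> _ _ h1 _ h2 h3 h4 h5 h6 _; move: h1 h2 h3 h4 h5 h6.
move: #|VE W :&: R| => x h1 h2 h3 h4 h5 h6.
have : [|| x == 1, x == 2 | x == 3] by move: h2 h3; clear; lia.
by case/or3P => /eqP hx; subst x; move: h1 h4 h5 h6; arith.
Qed.

Lemma proper_colourable R : R \subset VE E -> R != VE E -> colourable (induced E R).
Proof.
move=> RV nRV; apply: critical_sub cE (induced_sub _ _) _; apply: contraNneq nRV => h.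
rewrite eqEsubset RV -{1}h; apply: VE_sub => u v.
by rewrite in_induced => /and3P[_ -> ->].
Qed.

Lemma loopE : loopless E. Proof. by case: cE. Qed.

(** A proper set of potential below 10 could be enlarged by collapses, each of
    which lowers the potential by at least 6, until it is everything; but the
    whole potential is at least 4. *)
Lemma pot10 R : R \subset VE E -> R != VE E -> R != set0 ->
  3 * #|induced E R| + 10 <= 10 * #|R|.
Proof.
have [n] := ubnP (#|VE E| - #|R|); elim: n R => // n IHn R hn RV nRV R0.
case: (leqP #|R| 3) => R3.
  have := card_induced_small R loopE; move: R0; rewrite -card_gt0.
  move: (#|R|) R3 (#|induced E R|) => r r3 m r0.
  have : [|| r == 1, r == 2 | r == 3] by move: r3 r0; clear; lia.
  by case/or3P => /eqP hx; subst r; clear; lia.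
rewrite leqNgt; apply/negP => hlt.
have [phi [f cR]] := proper_colourable RV nRV.
have /set0Pn[a aR] := R0.
have [rho [hr _]] := representatives_exist phi aR.
have [W cW] := collapsed_exists RV nRV R3 cR hr.
have drop := collapsed_drop cW; have SV : R :|: VE W \subset VE E.
  by rewrite subUset RV (co_VE cW).
case: (eqVneq (R :|: VE W) (VE E)) => [eS|nS].
  by move: drop; rewrite eS (induced_VE (subxx _)); arith.
have W4 := critical_card (co_crit cW).
have := co_card cW; have := co_X3 cW => x3 cc.
have S0 : R :|: VE W != set0 by rewrite -card_gt0; arith.
have lt : #|VE E| - #|R :|: VE W| < n.
  have := subset_leq_card SV; arith.
have := IHn _ lt SV nS S0; arith.
Qed.

(** If adding the arcs Q to R destroys colourability, the critical set W that
    appears has potential at most 4 by minimality, and its vertices span a set of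
    potential at most 4 + 3|W :&: Q| in E. *)
Lemma add_arcs R Q : R \subset VE E -> R != VE E -> loopless Q -> VE Q \subset R ->
    ~ colourable (induced E R :|: Q) ->
  exists W, [/\ critical W, W \subset induced E R :|: Q, VE W \subset R,
    10 * #|VE W| <= 3 * #|W| + 4 /\ (10 * #|VE W| = 3 * #|W| + 4 -> ore W) &
    #|W| <= #|induced E (VE W)| + #|W :&: Q|].
Proof.
move=> RV nRV lQ VQ nc.
have lER : loopless (induced E R) by apply: loopless_sub (induced_sub _ _) loopE.
have [W sW cW] := critical_exists (loopless_U lER lQ) nc.
have VW : VE W \subset R.
  apply: subset_trans (VES sW) _; apply: subset_trans (@VEU _ _ _) _.
  rewrite subUset VQ andbT; apply: VE_sub => u v.
  by rewrite in_induced => /and3P[].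
exists W; split => //.
  apply: IH => //; apply: leq_ltn_trans (subset_leq_card VW) _.
  by apply: proper_card; rewrite properEneq nRV.
have := card_DU sW.
suff /subset_leq_card : W :&: induced E R \subset induced E (VE W) by arith.
apply/subsetP => -[u v]; rewrite in_setI !in_induced => /andP[e /andP[-> _]].
by rewrite (VEl e) (VEr e).
Qed.

Definition boundary (E : {set T * T}) R b : Prop :=
  b \in R /\ exists u, u \notin R /\ ((b, u) \in E \/ (u, b) \in E).

Lemma two_boundary R : R \subset VE E -> R != VE E -> 1 < #|R| ->
  exists a b, [/\ boundary E R a, boundary E R b & b != a].
Proof.
move=> RV nRV R2; have [c _] := critical_neq0 cE.
have [a [aR _ ha]] := no_cut_vertex c cE RV nRV R2.
have [b [bR nb hb]] := no_cut_vertex a cE RV nRV R2.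
by exists a, b; split => //; split.
Qed.

Lemma crossing_out R u v : (u, v) \in E -> ~~ ((u \in R) && (v \in R)) ->
  (u, v) \in E :\: induced E R.
Proof. by move=> e n; rewrite in_setD in_induced e (negPf n). Qed.

Section Tight.
Variable R : {set T}.
Hypothesis (RV : R \subset VE E) (nRV : R != VE E) (R4 : 3 < #|R|).
Hypothesis tight : 10 * #|R| <= 3 * #|induced E R| + 10.
Let N := E :\: induced E R.

(** In a set of potential 10 the estimate of a collapse is an equality
    throughout: W has potential 4, meets R in one representative, and no two
    crossing arcs are merged. *)
Lemma tight_collapse phi f rho : col3 (induced E R) phi f -> representatives R phi rho ->
  exists W x0, [/\ ore W /\ critical W, VE W :&: R = [set x0],
    R :|: VE W = VE E, {in N &, injective (map_arc (collapse R phi rho))} &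
    map_arc (collapse R phi rho) @: N = W].
Proof.
move=> cR hr; have [W cW] := collapsed_exists RV nRV R4 cR hr.
have drop := collapsed_drop cW.
have SV : R :|: VE W \subset VE E by rewrite subUset RV (co_VE cW).
have S0 : R :|: VE W != set0 by rewrite -card_gt0; have := co_card cW; have := co_X3 cW; arith.
have eS : R :|: VE W = VE E.
  apply/eqP; apply: contraT => nS; have := pot10 SV nS S0; arith.
have [_ _ h1 _ h2 h3 h4 h5 h6 h7] := cW.
rewrite eS (induced_VE (subxx _)) in h5 h6 h7.
have cX : #|VE W :&: R| = 1.
  have potE' := potE; have tight' := tight.
  move: potE' tight' h1 h2 h3 h4 h5 h6; move: #|VE W :&: R| => x.
  move=> e1 e2 e3 h2 h3; have : [|| x == 1, x == 2 | x == 3] by move: h2 h3; clear; lia.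
  by case/or3P => /eqP hx; subst x; move: e1 e2 e3; arith.
have [x0 eX] := cards1P (introT eqP cX).
have i0 : #|induced W R| = 0 by move: h4; rewrite cX; clear; lia.
have cN : #|N| + #|induced E R| = #|E|.
  by rewrite -(cardsID (induced E R) E) (setIidPr (induced_sub E R)) addnC.
rewrite (cards0_eq i0) setD0 -/N in h7; rewrite i0 cX in h5 h6.
have potE' := potE; have tight' := tight.
have lW := subset_leq_card h7.
have lN := leq_imset_card (map_arc (collapse R phi rho)) N.
exists W, x0; split => //.
- split; last exact: co_crit cW.
  by apply: (co_ore cW); clear drop; arith.
- by apply/imset_injP; rewrite eqn_leq lN; arith.
- by apply/esym/eqP; rewrite eqEcard h7; arith.
Qed.

Lemma tight_image phi rho W x0 : representatives R phi rho ->
    VE W :&: R = [set x0] -> map_arc (collapse R phi rho) @: N = W ->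
  forall c w, c \in R -> w \notin R -> (c, w) \in E \/ (w, c) \in E ->
    collapse R phi rho c = x0 /\ phi c = phi x0.
Proof.
move=> hr eX eW c w cR wR h.
have kc : collapse R phi rho c = rho (phi c) by rewrite /collapse cR.
have [kR kphi] := hr _ cR.
suff <- : collapse R phi rho c = x0 by rewrite kc kphi.
apply/set1P; rewrite -eX in_setI {2}kc kR andbT -eW.
case: h => e.
  apply: (@VEl _ _ _ (collapse R phi rho w)); apply/imsetP; exists (c, w) => //.
  by apply: crossing_out => //; rewrite (negPf wR) andbF.
apply: (@VEr _ _ (collapse R phi rho w)); apply/imsetP; exists (w, c) => //.
by apply: crossing_out => //; rewrite (negPf wR).
Qed.

Lemma tight_mono phi f a b : col3 (induced E R) phi f -> boundary E R a -> boundary E R b ->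
  phi a = phi b.
Proof.
move=> cR [aR [u [uR hu]]] [bR [v [vR hv]]].
have [rho [hr _]] := representatives_exist phi aR.
have [W [x0 [_ eX _ _ eW]]] := tight_collapse cR hr.
have [_ ->] := tight_image hr eX eW aR uR hu.
by have [_ ->] := tight_image hr eX eW bR vR hv.
Qed.

(** Suppose that u has an out-neighbour r and a different in-neighbour r' in R.
    Potentials allow R to be coloured with the extra arc from r' to r, so that no
    monochromatic path of R leads from r to r'. The collapse without the digon
    between u and x0 can be coloured as well, and as it is bidirected this digon
    is its only monochromatic part. In E the vertex u is then entered from r' and
    left to r only, so ranking it between r' and r gives a colouring. *)
Lemma tight_digon u r r' : u \notin R -> r \in R -> r' \in R ->
  (u, r) \in E -> (r', u) \in E -> r = r'.
Proof.
move=> uR rR r'R e e'; apply/eqP; apply: contraT => n.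
have lQ : loopless [set (r', r)].
  move=> w; rewrite in_set1 xpair_eqE; apply/negP => /andP[/eqP-> /eqP h].
  by move: n; rewrite h eqxx.
have VQ : VE [set (r', r)] \subset R.
  by apply: VE_sub => p q /set1P[-> ->].
have [phi [f cR]] : colourable (induced E R :|: [set (r', r)]).
  apply: contrapT => /(add_arcs RV nRV lQ VQ)[W [cW _ VW [le4 _] hW]].
  have W4 := critical_card cW.
  have W0 : VE W != set0 by rewrite -card_gt0; arith.
  have nW : VE W != VE E.
    by apply: contraNneq nRV => h; rewrite eqEsubset RV -h.
  have := pot10 (subset_trans VW RV) nW W0.
  have := subset_leq_card (subsetIr W [set (r', r)]); rewrite cards1; arith.
have cR0 := col3_sub (subsetUl (induced E R) [set (r', r)]) cR.
have [rho [hr _]] := representatives_exist phi rR.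
have [W [x0 [[oW cW] eX eS inj eW]]] := tight_collapse cR0 hr.
have im := tight_image hr eX eW.
have x0R : x0 \in R by have := set11 x0; rewrite -eX in_setI => /andP[].
have imN p q : (p, q) \in E -> ~~ ((p \in R) && (q \in R)) ->
    (collapse R phi rho p, collapse R phi rho q) \in W.
  by move=> h n'; rewrite -eW; apply/imsetP; exists (p, q) => //; apply: crossing_out.
have uN v w : v \notin R -> w \in R -> (v, w) \in E -> (v, x0) \in W.
  move=> vR wR h; have := imN _ _ h; rewrite (negPf vR) => /(_ isT).
  by rewrite collapse_notin //; have [-> _] := im _ _ wR vR (or_intror h).
have Nu v w : v \notin R -> w \in R -> (w, v) \in E -> (x0, v) \in W.
  move=> vR wR h; have := imN _ _ h; rewrite (negPf vR) andbF => /(_ isT).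
  rewrite [X in (_, X)]collapse_notin //.
  by have [-> _] := im _ _ wR vR (or_introl h).
have [lW sW _ _] := ore_basicP oW.
have [psi [g cg]] : colourable (W :\: digon_set u x0).
  apply: critical_sub cW (subsetDl _ _) _; apply/eqP => h.
  by have := uN _ _ uR rR e; rewrite -h in_setD in_digon_set !eqxx.
have pg := col3_proper (symmD sW (@symm_digon_set _ u x0)) cg.
have mono v w : (v, w) \in W -> psi v = psi w -> (v, w) \in digon_set u x0.
  move=> h1 h2; apply: contraT => h3; have := pg v w.
  by rewrite in_setD h3 h1 h2 eqxx => /(_ isT).
have [_ ncE _] := cE; case: ncE.
pose p := tperm (phi x0) (psi x0).
exists (fun v => if v \in R then p (phi v) else psi v).
exists (fun v => if v \in R then 2 * f v else if v == u then (2 * f r').+1 else 0).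
move=> v w h; have px : p (phi x0) = psi x0 by rewrite /p tpermL.
have [_ phir] := im _ _ rR uR (or_intror e).
have [_ phir'] := im _ _ r'R uR (or_introl e').
have nx v' : v' \notin R -> (v' == x0) = false.
  by move=> h'; apply/negbTE; apply: contraNneq h' => ->.
case: (boolP (v \in R)) => vR; case: (boolP (w \in R)) => wR.
- move=> /perm_inj hp; rewrite ltn_mul2l /=; apply: cR hp.
  by rewrite in_setU in_induced h vR wR.
- have [_ ->] := im _ _ vR wR (or_introl h); rewrite px => hp.
  have := mono _ _ (Nu _ _ wR vR h) hp.
  rewrite in_digon_set (nx _ wR) andbF eqxx /= => /eqP ewu.
  subst w; rewrite eqxx; have [->] : (v, u) = (r', u); last by clear; lia.
  apply: inj; rewrite ?crossing_out ?(negPf uR) ?andbF //.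
  have [hv _] := im _ _ vR wR (or_introl h).
  by have [hr' _] := im _ _ r'R wR (or_introl e'); rewrite /map_arc /= hv hr'.
- have [_ ->] := im _ _ wR vR (or_intror h); rewrite px => hp.
  have := mono _ _ (uN _ _ vR wR h) hp.
  rewrite in_digon_set (nx _ vR) eqxx andbT orbF => /eqP evu.
  subst v; rewrite eqxx; have [->] : (u, w) = (u, r).
    apply: inj; rewrite ?crossing_out ?(negPf uR) //.
    have [hw _] := im _ _ wR vR (or_intror h).
    by have [hr' _] := im _ _ rR vR (or_intror e); rewrite /map_arc /= hw hr'.
  have : f r' < f r by apply: cR; rewrite ?phir ?phir' // in_setU in_set1 eqxx orbT.
  by clear; lia.
- move=> hp; have := imN _ _ h; rewrite (negPf vR) => /(_ isT).
  by rewrite !collapse_notin // => /mono/(_ hp); rewrite in_digon_set !nx // !andbF.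
Qed.

Lemma tight_symm : symm N.
Proof.
have [phi [f cR]] := proper_colourable RV nRV.
have [a aR] : exists a, a \in R by apply/card_gt0P; arith.
have [rho [hr _]] := representatives_exist phi aR.
have [W [x0 [[oW cW] eX eS inj eW]]] := tight_collapse cR hr.
have [lW sW _ _] := ore_basicP oW.
have kin v : (collapse R phi rho v \in R) = (v \in R).
  by rewrite /collapse; case: (boolP (v \in R)) => [/hr[]|/negPf].
move=> v w h; have : (collapse R phi rho v, collapse R phi rho w) \in W.
  by rewrite -eW; apply/imsetP; exists (v, w).
move=> /sW; rewrite -eW => /imsetP[[a' b] h' [ha hb]].
have inN p q : (p, q) \in N -> (p, q) \in E /\ ~~ ((p \in R) && (q \in R)).
  by rewrite in_setD in_induced => /andP[+ e]; rewrite e.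
have [e n] := inN _ _ h; have [e' n'] := inN _ _ h'.
have same p q : collapse R phi rho p = collapse R phi rho q -> p \notin R -> q = p.
  move=> hk pR; have qR : q \notin R by rewrite -kin -hk kin.
  by move: hk; rewrite !collapse_notin.
have hR p q : collapse R phi rho p = collapse R phi rho q -> p \in R -> q \in R.
  by move=> hk; rewrite -kin hk kin.
case: (boolP (v \in R)) => vR; case: (boolP (w \in R)) => wR.
- by move: n; rewrite vR wR.
- have ea := same _ _ ha wR; have bR := hR _ _ hb vR; rewrite ea in e' h'.
  by rewrite -(tight_digon wR bR vR e' e).
- have eb := same _ _ hb vR; have a'R := hR _ _ ha wR; rewrite eb in e' h'.
  by rewrite (tight_digon vR wR a'R e e').
by rewrite -(same _ _ ha wR) -(same _ _ hb vR).
Qed.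

(** The boundary of R gets a single colour, so a digon between a and b makes R
    uncolourable, and a critical set inside is all of R because smaller sets have
    larger potential. *)
Lemma tight_add a b :
    (forall S, S \subset VE E -> S != VE E -> 1 < #|S| -> #|S| < #|R| ->
       3 * #|induced E S| + 11 <= 10 * #|S|) ->
    boundary E R a -> boundary E R b -> b != a ->
  [/\ ore (induced E R :|: digon_set a b), VE (induced E R :|: digon_set a b) = R &
      (a, b) \notin E].
Proof.
move=> small ha hb ab; have [aR _] := ha; have [bR _] := hb.
rewrite eq_sym in ab.
have nc : ~ colourable (induced E R :|: digon_set a b).
  move=> [phi [f c]].
  have := tight_mono (col3_sub (subsetUl _ _) c) ha hb => hp.
  have := c a b; have := c b a; rewrite !in_setU digon_set_l digon_set_r !orbT hp.
  by move=> /(_ isT erefl) h1 /(_ isT erefl) h2; move: h1 h2; clear; lia.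
have [W [cW sW VW [le4 oW] hW]] := add_arcs RV nRV (loopless_digon_set ab) (VE_digon_set aR bR) nc.
have W4 := critical_card cW.
have c2 := card_digon_set a b; have cI := subset_leq_card (subsetIr W (digon_set a b)).
have WV := subset_trans VW RV.
have nW : VE W != VE E.
  by apply: contraNneq nRV => h; rewrite eqEsubset RV -h.
have eR : VE W = R.
  apply/eqP; rewrite eqEcard VW leqNgt; apply/negP => lt.
  have W1 : 1 < #|VE W| by arith.
  have := small _ WV nW W1 lt; arith.
have R0 : R != set0 by rewrite -card_gt0; arith.
have p10 := pot10 RV nRV R0.
rewrite eR in le4 oW hW.
have cU := cardsUI (induced E R) (digon_set a b).
have eWU : W = induced E R :|: digon_set a b.
  by apply/eqP; rewrite eqEcard sW; arith.
have I0 : #|induced E R :&: digon_set a b| = 0 by rewrite -eWU in cU; arith.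
rewrite -eWU eR; split => //; first by apply: oW; arith.
apply/negP => e; have := cards0_eq I0 => /setP/(_ (a, b)).
by rewrite in_setI digon_set_l in_induced e aR bR in_set0.
Qed.

End Tight.

(** Let R be a smallest set of potential 10. A third boundary vertex c would have
    the colour of a in all colourings of R, and the set given by ore_forced would
    be smaller than R. Hence the boundary is {a, b}, and E is the Ore composition
    of R with the digon ab and the collapse of R. *)
Lemma pot11 R : R \subset VE E -> R != VE E -> 1 < #|R| ->
  3 * #|induced E R| + 11 <= 10 * #|R|.
Proof.
have [m] := ubnP #|R|; elim: m R => // m IHm R hm RV nRV R2.
rewrite leqNgt; apply/negP => hlt.
have tight : 10 * #|R| <= 3 * #|induced E R| + 10 by arith.
have R4 : 3 < #|R|.
  rewrite ltnNge; apply/negP => h3; have := card_induced_small R loopE.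
  move: hlt h3 R2; move: #|R| #|induced E R| => r k h1 h2 h3.
  have : (r == 2) || (r == 3) by move: h2 h3; clear; lia.
  by case/orP => /eqP hx; subst r; move: h1; clear; lia.
have small S : S \subset VE E -> S != VE E -> 1 < #|S| -> #|S| < #|R| ->
       3 * #|induced E S| + 11 <= 10 * #|S|.
  by move=> SV nSV S2 lt; apply: IHm => //; apply: leq_trans lt _.
have [a [b [ha hb ab]]] := two_boundary RV nRV R2.
have [aR _] := ha; have [bR _] := hb.
have [o1 V1 nab] := tight_add RV nRV R4 tight small ha hb ab.
set E1 := induced E R :|: digon_set a b in o1 V1.
have [l1 s1 c1 n1] := ore_basicP o1.
have abE1 : (a, b) \in E1 by rewrite in_setU digon_set_l orbT.
have ab' : a != b by rewrite eq_sym.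
have [_ _ nba] := tight_add RV nRV R4 tight small hb ha ab'.
have dE u v : (u, v) \in digon_set a b -> (u, v) \notin E.
  by rewrite in_digon_set => /orP[] /andP[/eqP-> /eqP->].
have E1D : E1 :\: digon_set a b = induced E R.
  apply/setP => -[u v]; rewrite in_setD in_setU.
  case: (boolP ((u, v) \in digon_set a b)) => [/dE n|]; last by rewrite orbF.
  by rewrite in_induced (negPf n).
have two c : boundary E R c -> c = a \/ c = b.
  move=> hc; case: (eqVneq c a) => [->|ca]; first by left.
  case: (eqVneq c b) => [->|cb]; first by right.
  have [cR _] := hc; exfalso.
  have c2 := card_digon_set a b.
  have [] := @ore_forced _ E1 a b c o1 abE1 ca cb.
  - by rewrite V1.
  - have [phi [f cc]] := proper_colourable RV nRV; exists phi.
    have sD := symmD s1 (@symm_digon_set _ a b); rewrite E1D in sD *.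
    exact: col3_proper sD cc.
  - move=> phi; rewrite E1D => p.
    exact: (tight_mono RV nRV R4 tight (proper_col3 p)).
  - rewrite V1 => S SR S0.
    have nS : S != VE E by apply: contraNneq nRV => h; rewrite eqEsubset RV -h.
    have := pot10 (subset_trans SR RV) nS S0.
    have /subset_leq_card : induced E1 S \subset induced E S :|: digon_set a b.
      apply/subsetP => -[u v]; rewrite in_setU !in_induced in_setU in_induced.
      by move=> /and3P[/orP[/andP[-> _]|->] -> ->]; rewrite ?orbT.
    have := cardsU (induced E S) (digon_set a b); arith.
  - move=> W cW le; apply: (proj1 (IH cW _)).
    apply: leq_ltn_trans le _; rewrite V1.
    by apply: proper_card; rewrite properEneq nRV.
  rewrite V1 => S [SR S2 pS nS].
  have nSV : S != VE E by apply: contraNneq nRV => h; rewrite eqEsubset RV -h.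
  have lt : #|S| < #|R|.
    apply: proper_card; rewrite properEneq SR andbT.
    by apply: contraNneq nS => ->; rewrite aR bR.
  have := small _ (subset_trans SR RV) nSV S2 lt.
  have /subset_leq_card : induced E1 S \subset induced E S.
    apply/subsetP => -[u v]; rewrite !in_induced in_setU in_induced.
    move=> /and3P[/orP[/andP[-> _]|d] uS vS]; first by rewrite uS vS.
    move: d nS; rewrite in_digon_set => /orP[] /andP[/eqP eu /eqP ev]; subst u v.
      by rewrite uS vS.
    by rewrite uS vS.
  arith.
have [phi [f cR]] := proper_colourable RV nRV.
have [rho [hr ra]] := representatives_exist phi aR.
have [W [x0 [[oW cW] eX eS inj eW]]] := tight_collapse RV nRV R4 tight cR hr.
have im := tight_image hr eX eW.
have ex0 : x0 = a.
  have [_ [u [uR hu]]] := ha; have [<- _] := im _ _ aR uR hu.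
  by rewrite /collapse aR ra.
subst x0; set N := E :\: induced E R in inj eW.
have agree v : v \in VE N -> fuse a b v = collapse R phi rho v.
  case: (boolP (v \in R)) => vR; last first.
    move=> _; rewrite collapse_notin // fuse_id //.
    by apply: contraNneq vR => ->.
  move=> /VEP[w hw].
  have [wR hE] : w \notin R /\ ((v, w) \in E \/ (w, v) \in E).
    by case: hw; rewrite in_setD in_induced vR ?andbT /= => /andP[n e];
       rewrite e /= in n; split=> //; [left|right].
  have [-> _] := im _ _ vR wR hE.
  case: (two v); first by split => //; exists w.
    by move=> ->; rewrite fuse_x.
  by move=> ->; rewrite fuse_y.
have agree2 : {in N, map_arc (fuse a b) =1 map_arc (collapse R phi rho)}.
  by move=> [u v] e; rewrite /map_arc /= !agree //; [apply: VEr e|apply: VEl e].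
have inVN c : boundary E R c -> c \in VE N.
  move=> [cR' [u [uR [e|e]]]].
    by apply: (@VEl _ _ _ u); apply: crossing_out; rewrite // (negPf uR) andbF.
  by apply: (@VEr _ _ u); apply: crossing_out; rewrite // (negPf uR).
have g : glue E1 W N a b.
  split => //.
  - by rewrite V1 setIC.
  - exact: tight_symm.
  - by move=> p q hp hq; rewrite !agree2 //; apply: inj.
  - by rewrite -[in RHS]eW; apply: eq_in_imset.
  - exact: inVN.
  - exact: inVN.
apply: (mc_not_ore M); have := ore_comp o1 oW g.
rewrite E1D; suff -> : induced E R :|: N = E by [].
by apply/setP => p; rewrite in_setU in_setD; have := subsetP (induced_sub E R) p;
   case: (p \in induced E R) => //= ->.
Qed.

End MinimalCounterexample.

(** * Sharper bounds on potentials *)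

Section Sparse.

Variable T : finType.
Implicit Types (E F W Q : {set T * T}) (A B S R X : {set T}) (u v w x y : T).

Lemma collapse_in R phi rho v : representatives R phi rho ->
  (collapse R phi rho v \in R) = (v \in R).
Proof.
by move=> hr; rewrite /collapse; case: (boolP (v \in R)) => [/hr[]|/negPf].
Qed.

Section PotentialAbove11.
Variable E : {set T * T}.
Hypothesis M : minimal_counterexample E.
Let cE : critical E := mc_crit M.
Let potE : 3 * #|E| + 4 <= 10 * #|VE E| := mc_pot M.

Lemma add_digon R a b : R \subset VE E -> R != VE E -> a \in R -> b \in R ->
  a != b -> colourable (induced E R :|: digon_set a b).
Proof.
move=> RV nRV aR bR ab; apply: contrapT.
move=> /(add_arcs M RV nRV (loopless_digon_set ab) (VE_digon_set aR bR)) [W [cW sW VW [le4 _] hW]].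
have W4 := critical_card cW.
have cI := subset_leq_card (subsetIr W (digon_set a b)); have c2 := card_digon_set a b.
have nW : VE W != VE E.
  by apply: contraNneq nRV => h; rewrite eqEsubset RV -h.
have W1 : 1 < #|VE W| by arith.
have := pot11 M (subset_trans VW RV) nW W1; arith.
Qed.

(** Two boundary vertices a and b are coloured differently by adding a digon
    between them. Then the collapse uses more than one representative, and only
    the complete triangle, of potential 12, leaves E a potential of 4. *)
Lemma triangle_collapse R : R \subset VE E -> R != VE E -> 3 < #|R| ->
    10 * #|R| <= 3 * #|induced E R| + 12 ->
  exists phi rho W, [/\ collapsed E R phi rho W, representatives R phi rho,
    R :|: VE W = VE E /\ ore W, #|VE W :&: R| = 3 /\ #|induced W R| = 6 &
    10 * #|R| = 3 * #|induced E R| + 12].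
Proof.
move=> RV nRV R4 small; have R2 : 1 < #|R| by apply: leq_trans R4.
have [a [b [ha hb ab]]] := two_boundary M RV nRV R2.
have [aR [u [uR hu]]] := ha; have [bR [v [vR hv]]] := hb.
have ab' : a != b by rewrite eq_sym.
have [phi [f c]] := add_digon RV nRV aR bR ab'.
have nphi : phi a <> phi b.
  move=> hp; have := c a b; have := c b a; rewrite !in_setU digon_set_l digon_set_r !orbT hp.
  by move=> /(_ isT erefl) h1 /(_ isT erefl) h2; move: h1 h2; clear; lia.
have [rho [hr _]] := representatives_exist phi aR.
have [W cW] := collapsed_exists M RV nRV R4 (col3_sub (subsetUl _ _) c) hr.
have drop := collapsed_drop cW.
have SV : R :|: VE W \subset VE E by rewrite subUset RV (co_VE cW).
have [_ _ h1 h0 h2 h3 h4 h5 h6 h7] := cW.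
have S0 : R :|: VE W != set0.
  by rewrite -card_gt0 lt0n; apply: contraTneq R2; rewrite -leqNgt; move: h5 h3; arith.
have eS : R :|: VE W = VE E.
  by apply/eqP; apply: contraT => nS; have := pot10 M SV nS S0; arith.
exists phi, rho, W; rewrite eS (induced_VE (subxx _)) in h5 h6 h7.
have potE' := potE.
have iW := subset_leq_card (induced_sub W R).
have : [|| #|VE W :&: R| == 1, #|VE W :&: R| == 2 | #|VE W :&: R| == 3].
  by move: h2 h3; clear; lia.
case/or3P => /eqP cX.
- exfalso; apply: nphi.
  have [x0 eX] := cards1P (introT eqP cX).
  have i0 : #|induced W R| = 0 by move: h4; rewrite cX; clear; lia.
  have cN : #|E :\: induced E R| + #|induced E R| = #|E|.
    by rewrite -(cardsID (induced E R) E) (setIidPr (induced_sub E R)) addnC.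
  rewrite (cards0_eq i0) setD0 in h7; rewrite i0 cX in h5 h6.
  have lN := leq_imset_card (map_arc (collapse R phi rho)) (E :\: induced E R).
  have eW : map_arc (collapse R phi rho) @: (E :\: induced E R) = W.
    by apply/esym/eqP; rewrite eqEcard h7; arith.
  have [_ ->] := tight_image hr eX eW aR uR hu.
  by have [_ ->] := tight_image hr eX eW bR vR hv.
- by exfalso; move: h4 h5; rewrite cX; arith.
by split => //; [split=> //; apply: h0| split => //|]; move: h4 h5; rewrite cX; arith.
Qed.

Lemma pot12 R : R \subset VE E -> R != VE E -> 1 < #|R| ->
  3 * #|induced E R| + 12 <= 10 * #|R|.
Proof.
move=> RV nRV R2; rewrite leqNgt; apply/negP => hlt.
case: (leqP #|R| 3) => R4.
  have := card_induced_small R (loopE M).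
  move: hlt R4 R2; move: #|R| #|induced E R| => r k h1 h2 h3.
  have : (r == 2) || (r == 3) by move: h2 h3; clear; lia.
  by case/orP => /eqP hx; subst r; move: h1; clear; lia.
have small : 10 * #|R| <= 3 * #|induced E R| + 12 by arith.
have [_ [_ [_ [_ _ _ _ h]]]] := triangle_collapse RV nRV R4 small; arith.
Qed.

(** In the remaining case of potential 12, the collapse is an Ore arc set with a
    triangle on the representatives. A set from ore_triangle that contains this
    triangle enlarges R to a set of potential at most 10, and one that avoids it
    is a set of potential at most 10 of E. *)
Lemma pot13 R : R \subset VE E -> 3 < #|R| -> #|R| + 2 <= #|VE E| ->
  3 * #|induced E R| + 13 <= 10 * #|R|.
Proof.
move=> RV R4 Rn; rewrite leqNgt; apply/negP => hlt.
have nRV : R != VE E by apply: contraTneq Rn => ->; rewrite -ltnNge; arith.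
have small : 10 * #|R| <= 3 * #|induced E R| + 12 by arith.
have [phi [rho [W [cW hr [eS oW] [cX cI] eR]]]] := triangle_collapse RV nRV R4 small.
set X := VE W :&: R in cX *.
have [lW sW _ _] := ore_basicP oW.
have eI : induced W R = complete X.
  apply/eqP; rewrite eqEcard card_complete cI cX andbT.
  apply/subsetP => -[u v]; rewrite in_induced completeP !in_setI => /and3P[e -> ->].
  rewrite (VEl e) (VEr e) /=; apply: contraTneq e => ->; exact: lW.
have sX : complete X \subset W by rewrite -eI induced_sub.
have cS := co_card cW; rewrite -/X eS in cS.
have W5 : 4 < #|VE W| by arith.
have [S [pS S2 dS alt]] := ore_triangle oW cX sX W5.
have SW := proper_sub pS; have ltS := proper_card pS.
have SV := subset_trans SW (co_VE cW).
have lift := co_lift cW; rewrite eS (induced_VE (subxx _)) in lift.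
case/orP: alt => [XS|dj].
  have eRS : R :&: S = X.
    apply/setP => v; rewrite !in_setI andbC; case: (boolP (v \in R)) => vR; rewrite ?andbF //=.
    rewrite !andbT; apply/idP/idP => [/(subsetP SW)//|vW].
    by apply: (subsetP XS); rewrite in_setI vW.
  have cRS := cardsUI R S; rewrite eRS cX in cRS.
  have sub : R :|: S \subset VE E by rewrite subUset RV.
  have nRS : R :|: S != VE E.
    by apply/eqP => h; rewrite h in cRS; arith.
  have RS2 : 1 < #|R :|: S| by have := subset_leq_card (subsetUl R S); arith.
  have := pot11 M sub nRS RS2.
  have s1 : induced W S :\: induced W R \subset
      map_arc (collapse R phi rho) @: (induced E (R :|: S) :\: induced E R).
    apply/subsetP => -[u v]; rewrite in_setD => /andP[n i].
    have /imsetP[[a b] h [ha hb]] : (u, v) \in map_arc (collapse R phi rho) @: (E :\: induced E R).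
      apply: (subsetP lift); rewrite in_setD n; exact: (subsetP (induced_sub W S)).
    apply/imsetP; exists (a, b); last by rewrite /map_arc /= ha hb.
    have inRS c w : collapse R phi rho c = w -> w \in S -> c \in R :|: S.
      rewrite in_setU; case: (boolP (c \in R)) => //= cR; rewrite collapse_notin //.
      by move=> ->.
    move: i h; rewrite in_induced !in_setD in_induced (in_induced E (R :|: S)).
    move=> /and3P[_ uS vS] /andP[n' e].
    by rewrite n' e (inRS _ _ (esym ha)) // (inRS _ _ (esym hb)).
  have := subset_leq_card s1; have := leq_imset_card (map_arc (collapse R phi rho))
    (induced E (R :|: S) :\: induced E R).
  have := cardsD (induced E (R :|: S)) (induced E R).
  rewrite (setIidPr (inducedS E (subsetUl R S))).
  have := subset_leq_card (inducedS E (subsetUl R S)).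
  have := cardsD (induced W S) (induced W R).
  have := subset_leq_card (subsetIr (induced W S) (induced W R)).
  arith.
have SR v : v \in S -> v \notin R.
  move=> vS; apply/negP => vR; have := disjointFl dj vS.
  by rewrite in_setI vR (subsetP SW).
have nS : S != VE E.
  apply/eqP => h; have [r rR] : exists r, r \in R by apply/card_gt0P; arith.
  by have := SR r; rewrite h (subsetP RV) // rR => /(_ isT).
have := pot11 M SV nS S2.
suff /subset_leq_card : induced W S \subset induced E S by arith.
apply/subsetP => -[u v]; rewrite !in_induced => /and3P[e uS vS].
have uR := SR _ uS; have vR := SR _ vS.
have /imsetP[[a b] h [ha hb]] : (u, v) \in map_arc (collapse R phi rho) @: (E :\: induced E R).
  by apply: (subsetP lift); rewrite in_setD in_induced e (negPf uR).
have aR : a \notin R by rewrite -(collapse_in a hr) -ha.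
have bR : b \notin R by rewrite -(collapse_in b hr) -hb.
move: h ha hb; rewrite !collapse_notin // in_setD => /andP[_ h] hu hv.
by subst u v; rewrite h uS vS.
Qed.

End PotentialAbove11.

(** * Vertices of in-degree three *)

(** This and the next property are what the study of single arcs uses; unlike
    minimality with respect to ore they pass to the converse at once. *)
Definition sparse E : Prop := forall S, S \subset VE E -> S != VE E -> 1 < #|S| ->
  3 * #|induced E S| + 12 <= 10 * #|S|.

Definition bounded_below (n : nat) : Prop := forall F, critical F -> #|VE F| < n ->
  10 * #|VE F| <= 3 * #|F| + 4.

Lemma sparse_conv E : sparse E -> sparse (converse E).
Proof. by move=> h S; rewrite VE_conv induced_conv card_conv; apply: h. Qed.

Lemma col3_rainbow E y (psi : T -> 'I_3) : #|ins E y| = 3 ->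
  (exists i, i \notin psi @: ins E y) \/ {in ins E y &, injective psi}.
Proof.
move=> c3; case: (boolP (#|psi @: ins E y| == #|ins E y|)) => [/imset_injP|h]; first by right.
left; apply/existsP; rewrite -negb_forall; apply: contraNN h => /forallP h.
rewrite c3; apply/eqP; apply: etrans (card_ord 3); apply: eq_card => i.
by rewrite h.
Qed.

(** Delete y and let x inherit its out-arcs. A colouring of the result colours
    the digraph without y; if the in-neighbours of y have three colours, y takes
    the colour of x and a rank just above x. So the result is uncolourable. A
    critical arc set W in it, with y added, has potential at most 4 + 10 - 3, the
    arc xy being new, so it is spanning. Hence z, which has lost the arc to y,
    still has three out-neighbours in W. *)
Lemma single_in E x y z : critical E -> sparse E -> bounded_below #|VE E| ->
    (x, y) \in E -> (y, x) \notin E -> #|ins E y| = 3 -> z \in ins E y -> z != x ->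
  3 < #|outs E z|.
Proof.
move=> cE spE bd xyE yxE c3 zy zx; have [lE ncE _] := cE.
have xy : x != y by apply: contraTneq xyE => ->.
have yV : y \in VE E := VEr xyE.
pose K := [set a : T * T | (a.1 == x) && ((y, a.2) \in E)].
pose D := [set a in E | (a.1 != y) && (a.2 != y)] :|: K.
have Dy u v : (u, v) \in D -> u != y /\ v != y.
  rewrite in_setU !inE /= => /orP[/and3P[_ -> ->] //|/andP[/eqP-> h]].
  by split=> //; apply: contraTneq h => ->.
have DE u v : (u, v) \in E -> u != y -> v != y -> (u, v) \in D.
  by move=> e nu nv; rewrite in_setU !inE /= e nu nv.
have lD : loopless D.
  move=> u; rewrite in_setU negb_or !inE /= (negPf (lE u)) /=.
  by apply/negP => /andP[/eqP->]; apply/negP.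
have ncD : ~ colourable D.
  move=> [psi [g c]]; apply: ncE.
  case: (col3_rainbow psi c3) => [[i hi]|inj].
    exists (fun v => if v == y then i else psi v).
    exists (fun v => if v == y then 0 else (g v).+1) => u v e.
    case: (eqVneq v y) => [hv|hv]; case: (eqVneq u y) => [hu|hu] //.
    - by subst; move: e; rewrite (negPf (lE _)).
    - by move=> h; case/negP: hi; rewrite -h imset_f // inE -hv.
    by move=> h; rewrite ltnS; apply: c => //; apply: DE.
  exists (fun v => if v == y then psi x else psi v).
  exists (fun v => if v == y then (2 * g x).+1 else 2 * g v) => u v e.
  case: (eqVneq v y) => [hv|hv]; case: (eqVneq u y) => [hu|hu].
  - by subst; move: e; rewrite (negPf (lE _)).
  - move=> h; rewrite hv in e; have -> : u = x by apply: inj => //; rewrite inE.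
    by clear; lia.
  - move=> h; have : g x < g v.
      by apply: c => //; rewrite hu in e; rewrite in_setU !inE /= eqxx e orbT.
    by clear; lia.
  by move=> h; rewrite ltn_mul2l /=; apply: c => //; apply: DE.
have [W sW cW] := critical_exists lD ncD.
have Wy u v : (u, v) \in W -> u != y /\ v != y by move=> /(subsetP sW)/Dy.
have yW : y \notin VE W by apply/negP => /VEP[w [/Wy[]|/Wy[]]]; rewrite eqxx.
have hE u v : (u, v) \in W -> (u, v) \notin E -> u = x /\ (y, v) \in E.
  move=> /(subsetP sW); rewrite in_setU !inE /= => /orP[/andP[-> //]|/andP[/eqP-> ->] _].
  by [].
have VW : VE W \subset VE E :\ y.
  apply: VE_sub => u v e; have [nu nv] := Wy _ _ e; rewrite !in_setD1 nu nv /=.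
  case: (boolP ((u, v) \in E)) => [h|/(hE _ _ e)[-> h]].
    by rewrite (VEl h) (VEr h).
  by rewrite (VEl xyE) (VEr h).
have xW : x \in VE W.
  apply: contraT => nx; case/negP: yW; suff -> : W = E by [].
  have [_ ncW _] := cW; apply: critical_eq cE _ ncW.
  apply/subsetP => -[u v] e; apply: contraT => /(hE _ _ e)[h _].
  by case/negP: nx; rewrite -h; apply: VEl e.
have sV : VE W \subset VE E by apply: subset_trans VW (subsetDl _ _).
have cV : #|VE E :\ y| + 1 = #|VE E| by rewrite [RHS](cardsD1 y) yV addnC.
have lt : #|VE W| < #|VE E| by have := subset_leq_card VW; arith.
have le4 := bd _ cW lt; have W4 := critical_card cW.
pose S := y |: VE W.
have cS : #|S| = #|VE W| + 1 by rewrite cardsU1 yW addnC.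
pose h (a : T * T) := if a \in E then a else (y, a.2).
have injh : {in W &, injective h}.
  move=> [u v] [u' v'] e e'; rewrite /h; have [nu _] := Wy _ _ e; have [nu' _] := Wy _ _ e'.
  case: (boolP (_ \in E)) => h1; case: (boolP (_ \in E)) => h2 //.
  - by move=> [hu _]; rewrite hu eqxx in nu.
  - by move=> [hu _]; rewrite -hu eqxx in nu'.
  by move=> [->]; have [-> _] := hE _ _ e h1; have [-> _] := hE _ _ e' h2.
have sub : h @: W \subset induced E S :\ (x, y).
  apply/subsetP => _ /imsetP[[u v] e ->]; rewrite /h; have [nu nv] := Wy _ _ e.
  case: (boolP (_ \in E)) => h1.
    by rewrite in_setD1 xpair_eqE (negPf nv) andbF in_induced h1 !in_setU1 (VEl e) (VEr e) !orbT.
  have [_ h2] := hE _ _ e h1.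
  by rewrite in_setD1 xpair_eqE (negPf nv) andbF in_induced h2 !in_setU1 eqxx (VEr e) !orbT.
have xyS : (x, y) \in induced E S by rewrite in_induced xyE !in_setU1 eqxx xW orbT.
have cA : #|W| + 1 <= #|induced E S|.
  have := subset_leq_card sub; rewrite card_in_imset // (cardsD1 (x, y) (induced E S)) xyS.
  arith.
have SV : S \subset VE E by rewrite subUset sub1set yV.
have eS : S = VE E.
  apply/eqP; apply: contraT => nS; have S2 : 1 < #|S| by arith.
  have := spE _ SV nS S2; arith.
have zyE : (z, y) \in E by move: zy; rewrite inE.
have zny : z != y by apply: contraTneq zyE => ->.
have zW : z \in VE W.
  by have := VEl zyE; rewrite -eS in_setU1 (negPf zny).
have so : outs W z \subset outs E z :\ y.
  apply/subsetP => w; rewrite in_setD1 !inE => e; have [_ ->] := Wy _ _ e.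
  by apply: contraT => /(hE _ _ e)[hz _]; rewrite hz eqxx in zx.
have := subset_leq_card so; have := critical_outs cW zW.
rewrite (cardsD1 y (outs E z)) inE zyE; arith.
Qed.

Lemma single_out E x y z : critical E -> sparse E -> bounded_below #|VE E| ->
    (x, y) \in E -> (y, x) \notin E -> #|outs E x| = 3 -> z \in outs E x -> z != y ->
  3 < #|ins E z|.
Proof.
move=> cE sE bd e ne c3 zx zy; rewrite -outs_conv.
apply: (@single_in (converse E) y x z) => //.
- exact: critical_conv.
- exact: sparse_conv.
- by rewrite VE_conv.
- by rewrite in_converse.
- by rewrite in_converse.
- by rewrite ins_conv.
- by rewrite ins_conv.
Qed.

(** If every arc entering y is half of a digon, y has a colour different from all
    its in-neighbours. An arc that leaves y and is not half of a digon is then in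
    no monochromatic cycle, so deleting it would not help to colour. *)
Lemma double_in E y : critical E -> ins E y \subset outs E y -> outs E y \subset ins E y.
Proof.
move=> cE /subsetP io; apply/subsetP => u; rewrite !inE => yu.
apply: contraT => uy; have [lE ncE ce] := cE; case: ncE.
have [phi [f c]] := ce _ yu.
exists phi, (fun v => if v == y then 0 else (f v).+1) => v w e hp.
case: (eqVneq w y) => [wy|wy]; last first.
  case: (eqVneq v y) => [//|vy]; rewrite ltnS; apply: c hp.
  by rewrite in_setD1 e xpair_eqE (negPf vy).
subst w; have : v \in ins E y by rewrite inE.
move=> /io; rewrite inE => yv.
have nv : v != u by apply: contraNneq uy => <-.
have vy : v != y by apply: contraTneq e => ->.
have h1 : f v < f y by apply: c => //; rewrite in_setD1 e xpair_eqE (negPf vy).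
have h2 : f y < f v.
  by apply: c => //; rewrite in_setD1 yv xpair_eqE (negPf nv) andbF.
by have := ltn_trans h1 h2; rewrite ltnn.
Qed.

Lemma double_out E x : critical E -> outs E x \subset ins E x -> ins E x \subset outs E x.
Proof.
by move=> /critical_conv/(@double_in (converse E) x); rewrite ins_conv outs_conv.
Qed.

End Sparse.

(** * Paths of vertices of degree three *)

Section Path.

Variable T : finType.
Implicit Types (F W Q : {set T * T}) (A B S R X U : {set T}).
Implicit Types (u v w x y z a b c d e : T).

Lemma third_colour (i j : 'I_3) : exists k : 'I_3, (k != i) && (k != j).
Proof.
have : #|[set i; j]| < #|'I_3| by rewrite card_ord cards2; case: (_ != _).
rewrite -cardsT => h; have : [set: 'I_3] != [set i; j] by apply: contraTneq h => ->; rewrite ltnn.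
rewrite eqEsubset subsetT andbT => /subsetPn[k _]; rewrite !inE negb_or.
by exists k.
Qed.

Section MinimalPath.
Variable E : {set T * T}.
Hypothesis M : minimal_counterexample E.
Let cE : critical E := mc_crit M.
Let potE : 3 * #|E| + 4 <= 10 * #|VE E| := mc_pot M.

Definition star x a b c : Prop := forall w,
  ((w, x) \in E) = [|| w == a, w == b | w == c] /\
  ((x, w) \in E) = [|| w == a, w == b | w == c].

Lemma star_swap12 x a b c : star x a b c -> star x b a c.
Proof. by move=> h w; have [-> ->] := h w; split; rewrite orbCA. Qed.

Lemma star_swap23 x a b c : star x a b c -> star x a c b.
Proof. by move=> h w; have [-> ->] := h w; split; rewrite (orbC (w == b)). Qed.

Lemma star_in x a b c w : star x a b c -> w \in [:: a; b; c] -> (x, w) \in E /\ (w, x) \in E.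
Proof. by move=> h; rewrite !inE; have [-> ->] := h w. Qed.

Lemma star_neq x a b c w : star x a b c -> w \in [:: a; b; c] -> w != x.
Proof.
move=> h /(star_in h)[e _]; apply: contraTneq e => ->; exact: (loopE M).
Qed.

Lemma star_V x a b c w : star x a b c -> w \in [:: x; a; b; c] -> w \in VE E.
Proof.
move=> h; rewrite in_cons => /orP[/eqP->|/(star_in h)[e _]]; last exact: VEr e.
have [e _] : (x, a) \in E /\ (a, x) \in E by apply: (star_in h); rewrite !inE eqxx.
exact: VEl e.
Qed.

Lemma star_nb x a b c w : star x a b c -> (x, w) \in E \/ (w, x) \in E ->
  w \in [:: a; b; c].
Proof. by move=> h; rewrite !inE; have [-> ->] := h w => -[]. Qed.

Lemma col_ext U phi f (phi' : T -> 'I_3) : col3 (induced E (VE E :\: U)) phi f ->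
    (forall v, v \notin U -> phi' v = phi v) ->
    (forall u, u \in U -> forall w, (u, w) \in E \/ (w, u) \in E -> phi' u != phi' w) ->
  False.
Proof.
move=> c same diff; have [_ ncE _] := cE; apply: ncE; exists phi', f => u v e.
case: (boolP (u \in U)) => uU.
  by move=> h; have := diff _ uU v (or_introl e); rewrite h eqxx.
case: (boolP (v \in U)) => vU.
  by move=> h; have := diff _ vU u (or_intror e); rewrite h eqxx.
rewrite !same //; apply: c.
by rewrite in_induced e !in_setD uU vU (VEl e) (VEr e).
Qed.

Definition digon_in u v : Prop := (u, v) \in E /\ (v, u) \in E.

Lemma digon_neq u v : digon_in u v -> u != v.
Proof. by case=> e _; apply: contraTneq e => ->; apply: (loopE M). Qed.

Lemma digon_V u v : digon_in u v -> u \in VE E /\ v \in VE E.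
Proof. by case=> e _; rewrite (VEl e) (VEr e). Qed.

Lemma digon_sym u v : digon_in u v -> digon_in v u. Proof. by case. Qed.

(** K4 without the digon rs has potential 40 - 30. *)
Lemma no_diamond p q r s t : digon_in p q -> digon_in p r -> digon_in q r ->
  digon_in p s -> digon_in q s -> r != s -> t \in VE E -> t \notin [:: p; q; r; s] ->
  False.
Proof.
move=> pq pr qr ps qs rs tV.
rewrite !inE !negb_or => /and4P[tp tq tr ts].
have npq := digon_neq pq; have npr := digon_neq pr; have nqr := digon_neq qr.
have nps := digon_neq ps; have nqs := digon_neq qs.
pose S0 := [set p; q].
have i0 : 2 <= #|induced E S0|.
  rewrite -(card_digon_set2 npq); apply/subset_leq_card/subsetP => -[u v].
  rewrite in_digon_set in_induced; case: pq => e1 e2.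
  by case/orP => /andP[/eqP-> /eqP->]; rewrite ?e1 ?e2 !inE !eqxx ?orbT.
have rS : r \notin S0 by rewrite !inE negb_or eq_sym npr eq_sym nqr.
have nbr w : w \in S0 -> (r, w) \in E /\ (w, r) \in E.
  by rewrite !inE => /orP[] /eqP->; apply: digon_sym.
have nbs w : w \in S0 -> (s, w) \in E /\ (w, s) \in E.
  by rewrite !inE => /orP[] /eqP->; apply: digon_sym.
have i1 := induced_add_vertex rS (subxx _) nbr.
have sS : s \notin r |: S0 by rewrite !inE !negb_or eq_sym rs eq_sym nps eq_sym nqs.
have i2 := induced_add_vertex sS (subsetUr _ _) nbs.
have c0 : #|S0| = 2 by rewrite cards2 npq.
have c2 : #|s |: (r |: S0)| = 4 by rewrite cardsU1 sS cardsU1 rS c0.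
have SV : s |: (r |: S0) \subset VE E.
  apply/subsetP => w; rewrite !inE => h.
  have [pV qV] := digon_V pq; have [_ rV] := digon_V pr; have [_ sV] := digon_V ps.
  by case/or4P: h => /eqP->; move: pV qV rV sV; rewrite !inE.
have nS : s |: (r |: S0) != VE E.
  apply: contraTneq tV => <-; rewrite !inE.
  by rewrite (negPf tp) (negPf tq) (negPf tr) (negPf ts).
have S2 : 1 < #|s |: (r |: S0)| by rewrite c2.
have := pot11 M SV nS S2; rewrite c2; rewrite c0 in i1 i2; arith.
Qed.

Section Three.
Variables x y z : T.
Let U := [set x; y; z].
Let R := VE E :\: U.

Lemma in_U w : (w \in U) = [|| w == x, w == y | w == z].
Proof. by rewrite !inE -orbA. Qed.

Hypothesis (xV : x \in VE E) (yV : y \in VE E) (zV : z \in VE E).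
Hypothesis (xy : x != y) (xz : x != z) (yz : y != z).

Lemma R_sub : R \subset VE E. Proof. exact: subsetDl. Qed.

Lemma R_neq : R != VE E.
Proof.
by apply: contraTneq xV => <-; rewrite in_setD in_U eqxx.
Qed.

Lemma in_R w : w \in VE E -> w != x -> w != y -> w != z -> w \in R.
Proof. by move=> h /negPf h1 /negPf h2 /negPf h3; rewrite in_setD in_U h h1 h2 h3. Qed.

Lemma xR : x \notin R. Proof. by rewrite in_setD in_U eqxx. Qed.
Lemma yR : y \notin R. Proof. by rewrite in_setD in_U eqxx orbT. Qed.
Lemma zR : z \notin R. Proof. by rewrite in_setD in_U eqxx !orbT. Qed.

Lemma card_R : #|R| + 3 = #|VE E|.
Proof.
have c3 : #|U| = 3.
  by rewrite /U -setUA cardsU1 cards2 !inE negb_or xy xz yz.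
have sU : U \subset VE E.
  by apply/subsetP => w; rewrite in_U => /or3P[] /eqP->.
by rewrite -(cardsID U (VE E)) (setIidPr sU) c3 addnC.
Qed.

Definition extend (phi : T -> 'I_3) px py pz v : 'I_3 :=
  if v == x then px else if v == y then py else if v == z then pz else phi v.

Lemma extend_x phi px py pz : extend phi px py pz x = px.
Proof. by rewrite /extend eqxx. Qed.
Lemma extend_y phi px py pz : extend phi px py pz y = py.
Proof. by rewrite /extend eq_sym (negPf xy) eqxx. Qed.
Lemma extend_z phi px py pz : extend phi px py pz z = pz.
Proof. by rewrite /extend eq_sym (negPf xz) eq_sym (negPf yz) eqxx. Qed.
Lemma extend_R phi px py pz w : w \in R -> extend phi px py pz w = phi w.
Proof.
rewrite in_setD in_U !negb_or => /andP[/and3P[/negPf h1 /negPf h2 /negPf h3] _].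
by rewrite /extend h1 h2 h3.
Qed.

Lemma extend_U phi px py pz w : w \notin U -> extend phi px py pz w = phi w.
Proof.
rewrite in_U !negb_or => /and3P[/negPf h1 /negPf h2 /negPf h3].
by rewrite /extend h1 h2 h3.
Qed.

(** When the outer neighbours b and e are coloured differently, x takes the colour
    of e, and y and z share the two other colours. *)
Lemma triangle_ext b e d : star x y z b -> star y x z e -> star z x y d ->
  b \in R -> e \in R -> d \in R -> b != e -> False.
Proof.
move=> hx hy hz bR eR dR be.
have [phi [f c]] := add_digon M R_sub R_neq bR eR be.
have nbe : phi b != phi e.
  apply/eqP => h; have h1 := c b e; have h2 := c e b.
  have := h1; have := h2; rewrite !in_setU digon_set_l digon_set_r !orbT h.
  by move=> /(_ isT erefl) h3 /(_ isT erefl) h4; move: h3 h4; clear; lia.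
have c0 := col3_sub (subsetUl _ _) c.
have [t /andP[te tb]] := third_colour (phi e) (phi b).
have [py [pz [n1 n2 n3 n4]]] : exists py pz, [/\ py != phi e, pz != phi e,
    py != pz & pz != phi d].
  case: (eqVneq (phi d) (phi b)) => [h|h].
    by exists (phi b), t; rewrite h nbe te eq_sym tb.
  by exists t, (phi b); rewrite te tb nbe eq_sym h.
apply: (@col_ext U phi f (extend phi (phi e) py pz) c0).
  by move=> v; apply: extend_U.
move=> u; rewrite in_U => /or3P[] /eqP-> w.
- move=> /(star_nb hx); rewrite !inE extend_x => /or3P[] /eqP->.
  + by rewrite extend_y eq_sym.
  + by rewrite extend_z eq_sym.
  + by rewrite extend_R // eq_sym.
- move=> /(star_nb hy); rewrite !inE extend_y => /or3P[] /eqP->.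
  + by rewrite extend_x.
  + by rewrite extend_z.
  + by rewrite extend_R.
move=> /(star_nb hz); rewrite !inE extend_z => /or3P[] /eqP->.
- by rewrite extend_x.
- by rewrite extend_y eq_sym.
- by rewrite extend_R.
Qed.

Section PathCase.
Variables a b c d e : T.
Hypothesis (hx : star x y a b) (hy : star y x z e) (hz : star z y c d).
Hypothesis (aR : a \in R) (bR : b \in R) (cR : c \in R) (dR : d \in R) (eR : e \in R).
Hypothesis (ab : a != b) (cd : c != d).

(** Colours for x, y, z can be found unless each of x and z has a single
    admissible colour, these differ, and e has the third one. Equal colours on a
    and b leave x a choice, and e differing from both lets x take the colour
    of e. *)
Lemma path_ext phi f : col3 (induced E R) phi f ->
  ~ (phi a = phi b \/ (phi e != phi a /\ phi e != phi b)).
Proof.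
move=> col h.
have [pz /andP[zc zd]] := third_colour (phi c) (phi d).
have [px [py [n1 n2 n3 [n4 n5]]]] : exists px py, [/\ px != phi a, px != phi b, py != px &
    py != pz /\ py != phi e].
  have [t0 /andP[t1 t2]] := third_colour (phi e) pz.
  case: (boolP ((phi e != phi a) && (phi e != phi b))) => [/andP[h1 h2]|n].
    by exists (phi e), t0.
  have {h} hab : phi a = phi b by case: h => // -[h1 h2]; move: n; rewrite h1 h2.
  have hea : phi e = phi a by move: n; rewrite -hab andbb negbK => /eqP.
  case: (eqVneq pz (phi a)) => [pa|pa]; last by exists pz, t0; rewrite -hab.
  have [s /andP[s1 _]] := third_colour (phi a) (phi a).
  have [t /andP[t3 t4]] := third_colour (phi e) s.
  by exists s, t; rewrite -hab s1 t4 t3 pa -hea t3.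
apply: (@col_ext U phi f (extend phi px py pz) col).
  by move=> v; apply: extend_U.
move=> u; rewrite in_U => /or3P[] /eqP-> w.
- move=> /(star_nb hx); rewrite !inE extend_x => /or3P[] /eqP->.
  + by rewrite extend_y eq_sym.
  + by rewrite extend_R.
  + by rewrite extend_R.
- move=> /(star_nb hy); rewrite !inE extend_y => /or3P[] /eqP->.
  + by rewrite extend_x.
  + by rewrite extend_z.
  + by rewrite extend_R.
move=> /(star_nb hz); rewrite !inE extend_z => /or3P[] /eqP->.
- by rewrite extend_y eq_sym.
- by rewrite extend_R.
- by rewrite extend_R.
Qed.

(** Otherwise a and b can be identified outside x, y, z: a single arc between
    them only asks to rank them one after the other. A colouring of the result
    would contradict path_ext. The critical set that appears instead, with a and b
    separated and x added, has potential at most 4 + 10 + 10 - 12 and misses y and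
    z, against pot13. *)
Lemma path_digon : (a, b) \in E /\ (b, a) \in E.
Proof.
apply: contrapT => nd.
pose k := fuse a b.
pose D := (map_arc k @: induced E R) :\ (a, a).
have [lE ncE _] := cE.
have kb v : k v != b.
  by rewrite /k /fuse; case: (eqVneq v b).
have kR v : v \in R -> k v \in R by rewrite /k /fuse; case: eqP.
have lD : loopless D.
  move=> w; rewrite in_setD1 xpair_eqE andbb; apply/negP => /andP[wa /imsetP[[u v]]].
  rewrite in_induced => /and3P[e0 _ _] [h1 h2].
  case: (eqVneq u b) => [ub|ub]; first by move: wa; rewrite h1 /k ub fuse_y eqxx.
  case: (eqVneq v b) => [vb|vb]; first by move: wa; rewrite h2 /k vb fuse_y eqxx.
  rewrite /k !fuse_id // in h1 h2.
  by move: e0; rewrite -h1 -h2; apply/negP.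
have ncD : ~ colourable D.
  move=> [psi [g col]].
  (* Doubling the ranks leaves room to put t just after the other one of a, b. *)
  pose t := if (a, b) \in E then b else a.
  apply: (@path_ext (psi \o k) (fun v => 2 * g (k v) + (v == t))); last first.
    by left; rewrite /= /k fuse_x fuse_y.
  move=> u v; rewrite in_induced => /and3P[e0 uR vR] /= hp.
  case: (eqVneq (k u) (k v)) => [kuv|nuv].
    have [ha hb] : k u = a /\ k v = a.
      case: (eqVneq u b) => [ub|ub]; first by rewrite -kuv /k ub fuse_y.
      case: (eqVneq v b) => [vb|vb]; first by rewrite kuv /k vb fuse_y.
      by move: kuv e0; rewrite /k !fuse_id // => ->; rewrite (negPf (lE v)).
    have kab w : k w = a -> w = a \/ w = b.
      by rewrite /k /fuse; case: eqP => [->|_ ->]; [right|left].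
    rewrite ha hb ltn_add2l /t.
    case: (kab _ ha) => hu; case: (kab _ hb) => hv; subst u v.
    - by move: e0; rewrite (negPf (lE a)).
    - by rewrite e0 (negPf ab) eqxx.
    - have -> : ((a, b) \in E) = false by apply/negP => h; apply: nd.
      by rewrite eqxx eq_sym (negPf ab).
    by move: e0; rewrite (negPf (lE b)).
  have : g (k u) < g (k v).
    apply: col => //; rewrite in_setD1 xpair_eqE; apply/andP; split.
      by apply: contraNN nuv => /andP[/eqP-> /eqP->].
    by apply/imsetP; exists (u, v) => //; rewrite in_induced e0 uR vR.
  by case: (u == t); case: (v == t) => /=; clear; lia.
have [W sW cW] := critical_exists lD ncD.
have lift u v : (u, v) \in W -> exists u' v', [/\ (u', v') \in induced E R, k u' = u & k v' = v].
  move=> /(subsetP sW); rewrite in_setD1 => /andP[_ /imsetP[[u' v'] h [-> ->]]].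
  by exists u', v'.
have VW : VE W \subset R :\ b.
  apply: VE_sub => u v /lift[u' [v' [+ <- <-]]]; rewrite in_induced !in_setD1 !kb.
  by case/and3P => _ /kR-> /kR->.
have sV : VE W \subset VE E.
  by apply: subset_trans VW _; apply: subset_trans R_sub; apply: subsetDl.
have aW : a \in VE W.
  apply: contraT => na; have : W \subset E.
    apply/subsetP => -[u v] h; have [u' [v' [h' hu hv]]] := lift _ _ h.
    have kid w w' : k w' = w -> w \in VE W -> w' = w.
      rewrite /k /fuse; case: eqP => // _ <- aW.
      by move: na; rewrite aW.
    move: h'; rewrite in_induced (kid _ _ hu (VEl h)) (kid _ _ hv (VEr h)).
    by case/and3P.
  have [_ ncW _] := cW; move=> /(critical_eq cE)/(_ ncW) eW.
  by have := subsetP VW x; rewrite eW in_setD1 (negPf xR) andbF => /(_ xV).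
have bW : b \notin VE W by apply/negP => /(subsetP VW); rewrite in_setD1 eqxx.
have lt : #|VE W| < #|VE E|.
  apply: proper_card; rewrite properEneq sV andbT; apply: contraNneq bW => ->.
  by apply: (subsetP R_sub).
have [le4 _] := mc_IH M cW lt.
have W4 := critical_card cW.
pose S := b |: VE W.
have SR : S \subset R.
  by rewrite subUset sub1set bR; apply: subset_trans VW (subsetDl _ _).
have cS : #|S| = #|VE W| + 1 by rewrite cardsU1 bW addnC.
have cA : #|W| <= #|induced E S|.
  apply: leq_trans (leq_imset_card (map_arc k) (induced E S)); apply: subset_leq_card.
  apply/subsetP => -[u v] h; have [u' [v' [h' hu hv]]] := lift _ _ h.
  apply/imsetP; exists (u', v'); last by rewrite /map_arc /= hu hv.
  have kS w w' : k w' = w -> w \in VE W -> w' \in S.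
    rewrite /k /fuse in_setU1; case: eqP => //= _ <- //.
  move: h'; rewrite !in_induced => /and3P[-> _ _].
  by rewrite (kS _ _ hu (VEl h)) (kS _ _ hv (VEr h)).
have xS : x \notin S by apply: contraNN xR => /(subsetP SR).
have abS : [set a; b] \subset S.
  by rewrite subUset !sub1set !in_setU1 aW eqxx orbT.
have nbx w : w \in [set a; b] -> (x, w) \in E /\ (w, x) \in E.
  rewrite !inE => h; apply: (star_in hx); rewrite !inE; case/orP: h => ->;
  by rewrite ?orbT.
have := induced_add_vertex xS abS nbx; rewrite cards2 ab.
have cxS : #|x |: S| = #|S| + 1 by rewrite cardsU1 xS addnC.
have sxS : x |: S \subset VE E.
  by rewrite subUset sub1set xV (subset_trans SR R_sub).
have cSR := subset_leq_card SR; have cR3 := card_R.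
have g4 : 3 < #|x |: S| by arith.
have g2 : #|x |: S| + 2 <= #|VE E| by arith.
have := pot13 M sxS g4 g2.
arith.
Qed.

(** Since e is neither a nor b, by no_diamond, digons from e to a and b can be
    added outside x, y, z; by path_ext the result is uncolourable. The critical
    set W in it spans everything outside x, y, z, or else adding x and y to it
    gives a set of potential at most 12 that pot13 excludes. Then W is the whole
    result and has potential 4, so it is an Ore arc set, and its last composition
    is incompatible with the positions of the triangle e, a, b and the digon cd:
    the triangle on the side of F makes the edge side a set of potential 10 of E;
    otherwise cd in F gives the side of F together with z potential 12, and cd on
    the edge side gives the edge side together with x, y, z potential 10. If W is
    a K4, then x, a, b and its fourth vertex form a K4 without a digon. *)
Lemma path_not_digons : digon_in a b -> digon_in c d -> False.
Proof.
move=> dab dcd.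
have dxa : digon_in x a by apply: (star_in hx); rewrite !inE eqxx orbT.
have dxb : digon_in x b by apply: (star_in hx); rewrite !inE eqxx !orbT.
have dxy : digon_in x y by apply: (star_in hx); rewrite !inE eqxx.
have dye : digon_in y e by apply: (star_in hy); rewrite !inE eqxx !orbT.
have dyz : digon_in y z by apply: (star_in hy); rewrite !inE eqxx !orbT.
have dzc : digon_in z c by apply: (star_in hz); rewrite !inE eqxx !orbT.
have dzd : digon_in z d by apply: (star_in hz); rewrite !inE eqxx !orbT.
have out w : w \in R -> [/\ w != x, w != y & w != z].
  rewrite in_setD in_U !negb_or => /andP[/and3P[-> -> ->] _]; by [].
have [ax ay az] := out _ aR; have [bx by' bz] := out _ bR.
have [cx cy cz] := out _ cR; have [dx dy dz] := out _ dR.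
have [ex ey ez] := out _ eR.
have ea : e != a.
  apply/eqP => h; subst a; apply: (@no_diamond x e y b z) => //.
  - exact: digon_sym.
  - by rewrite eq_sym.
  by rewrite !inE !negb_or eq_sym xz eq_sym ez eq_sym yz eq_sym bz.
have eb : e != b.
  apply/eqP => h; subst b; apply: (@no_diamond x e y a z) => //.
  - exact: digon_sym.
  - exact: digon_sym.
  - by rewrite eq_sym.
  by rewrite !inE !negb_or eq_sym xz eq_sym ez eq_sym yz eq_sym az.
pose Q := digon_set e a :|: digon_set e b.
have lQ : loopless Q by apply: loopless_U; apply: loopless_digon_set.
have VQ : VE Q \subset R.
  by apply: subset_trans (@VEU _ _ _) _; rewrite subUset !VE_digon_set.
have nc : ~ colourable (induced E R :|: Q).
  move=> [phi [f col]]; apply: (@path_ext phi f (col3_sub (subsetUl _ _) col)).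
  right; split; apply/eqP => h.
    have h1 := col e a; have h2 := col a e.
    have := h1; have := h2; rewrite !in_setU digon_set_l digon_set_r !orbT h.
    by move=> /(_ isT erefl) h3 /(_ isT erefl) h4; move: h3 h4; clear; lia.
  have h1 := col e b; have h2 := col b e.
  have := h1; have := h2; rewrite !in_setU digon_set_l digon_set_r !orbT h.
  by move=> /(_ isT erefl) h3 /(_ isT erefl) h4; move: h3 h4; clear; lia.
have [W [cW sW VW [le4 oW] hW]] := add_arcs M R_sub R_neq lQ VQ nc.
have W4 := critical_card cW.
have WV : VE W \subset VE E := subset_trans VW R_sub.
have VWR := subset_leq_card VW; have cR3 := card_R.
have nW : VE W != VE E.
  by apply: contraTneq R_neq => h; rewrite negbK eqEsubset R_sub -h.
have W1 : 1 < #|VE W| by arith.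
have p11 := pot11 M WV nW W1.
have cQ3 : 2 < #|W :&: Q| by arith.
have cea := card_digon_set e a; have ceb := card_digon_set e b.
have cQ4 : #|Q| <= 4 by have := cardsU (digon_set e a) (digon_set e b); rewrite -/Q; arith.
have cI := subset_leq_card (subsetIr W Q).
have inQ u v : (u, v) \in W :&: Q -> [/\ u \in VE W, v \in VE W &
    ((u, v) \in digon_set e a) || ((u, v) \in digon_set e b)].
  by rewrite in_setI in_setU => /andP[h ->]; rewrite (VEl h) (VEr h).
have eW : e \in VE W.
  have /card_gt0P[[u v] /inQ[uW vW]] : 0 < #|W :&: Q| by apply: leq_trans cQ3.
  by rewrite !in_digon_set => /orP[] /orP[] /andP[/eqP h1 /eqP h2]; subst.
have aW : a \in VE W.
  apply: contraT => na; have /subset_leq_card : W :&: Q \subset digon_set e b.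
    apply/subsetP => -[u v] /inQ[uW vW] /orP[|//]; rewrite in_digon_set.
    by case/orP => /andP[/eqP h1 /eqP h2]; subst; case/negP: na.
  arith.
have bW : b \in VE W.
  apply: contraT => nb; have /subset_leq_card : W :&: Q \subset digon_set e a.
    apply/subsetP => -[u v] /inQ[uW vW] /orP[//|]; rewrite in_digon_set.
    by case/orP => /andP[/eqP h1 /eqP h2]; subst; case/negP: nb.
  arith.
have subR w : w \notin R -> w \notin VE W by apply: contraNN; apply: (subsetP VW).
have nbx w : w \in [set a; b] -> (x, w) \in E /\ (w, x) \in E.
  by rewrite in_set2 => /orP[] /eqP->.
have nby w : w \in [set x; e] -> (y, w) \in E /\ (w, y) \in E.
  by rewrite in_set2 => /orP[] /eqP->; [apply: digon_sym|].
have nbz w : w \in y |: [set c; d] -> (z, w) \in E /\ (w, z) \in E.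
  by rewrite in_setU1 in_set2 => /or3P[] /eqP->; [apply: digon_sym| |].
have cab : #|[set a; b]| = 2 by rewrite cards2 ab.
have cxe : #|[set x; e]| = 2 by rewrite cards2 eq_sym ex.
have cycd : #|y |: [set c; d]| = 3.
  by rewrite cardsU1 cards2 cd in_set2 negb_or eq_sym cy eq_sym dy.
have addx S : S \subset R -> a \in S -> b \in S -> #|induced E S| + 4 <= #|induced E (x |: S)|.
  move=> SR aS bS; have := @induced_add_vertex _ E S [set a; b] x.
  rewrite cab; apply => //; last by rewrite subUset !sub1set aS.
  by apply: contraNN xR => /(subsetP SR).
have addy S : S \subset R -> e \in S ->
    #|induced E (x |: S)| + 4 <= #|induced E (y |: (x |: S))|.
  move=> SR eS; have := @induced_add_vertex _ E (x |: S) [set x; e] y.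
  rewrite cxe; apply => //; last by rewrite subUset !sub1set !in_setU1 eqxx eS orbT.
  by rewrite in_setU1 negb_or eq_sym xy /=; apply: contraNN yR => /(subsetP SR).
have addz S : S \subset R -> c \in S -> d \in S ->
    #|induced E (y |: (x |: S))| + 6 <= #|induced E (z |: (y |: (x |: S)))|.
  move=> SR cS dS; have := @induced_add_vertex _ E (y |: (x |: S)) (y |: [set c; d]) z.
  rewrite cycd; apply => //; last first.
    by rewrite !subUset !sub1set !in_setU1 eqxx cS dS !orbT.
  rewrite !in_setU1 !negb_or eq_sym yz eq_sym xz /=.
  by apply: contraNN zR => /(subsetP SR).
have cardx S : S \subset R -> #|x |: S| = #|S| + 1.
  by move=> SR; rewrite cardsU1 addnC; congr (_ + _);
     rewrite (_ : x \notin S) //; apply: contraNN xR => /(subsetP SR).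
have cardy S : S \subset R -> #|y |: (x |: S)| = #|S| + 2.
  move=> SR; rewrite cardsU1 cardx // in_setU1 negb_or eq_sym xy /=.
  rewrite (_ : y \notin S); first by rewrite addnC -addnA.
  by apply: contraNN yR => /(subsetP SR).
have cardz S : S \subset R -> #|z |: (y |: (x |: S))| = #|S| + 3.
  move=> SR; rewrite cardsU1 cardy // !in_setU1 !negb_or eq_sym yz eq_sym xz /=.
  rewrite (_ : z \notin S); first by rewrite addnC -addnA.
  by apply: contraNN zR => /(subsetP SR).
have subV S : S \subset R -> z |: (y |: (x |: S)) \subset VE E.
  by move=> SR; rewrite !subUset !sub1set xV yV zV (subset_trans SR R_sub).
have ax4 := addx _ VW aW bW; have ay4 := addy _ VW eW.
have c2 := cardy _ VW.
have eVR : VE W = R.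
  apply/eqP; rewrite eqEcard VW /= leqNgt; apply/negP => lt.
  have s2 : y |: (x |: VE W) \subset VE E.
    by apply: subset_trans (subV _ VW); apply: subsetUr.
  have g3 : 3 < #|y |: (x |: VE W)| by arith.
  have g2 : #|y |: (x |: VE W)| + 2 <= #|VE E| by arith.
  have := pot13 M s2 g3 g2; arith.
rewrite eVR in le4 oW hW ax4 ay4 c2 VWR W4.
have az6 := addz _ (subxx R) cR dR.
have cE3 := subset_leq_card (induced_sub E (z |: (y |: (x |: R)))).
have potE' := potE.
have o : ore W by apply: oW; arith.
have QW : Q \subset W.
  apply/setIidPr/eqP; rewrite eqEcard subsetIr /=; arith.
have eW' : W = induced E R :|: Q.
  by apply/eqP; rewrite eqEcard sW /=; have := cardsU (induced E R) Q; arith.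
have inW u v : u \in R -> v \in R -> digon_in u v -> (u, v) \in W.
  by move=> uR vR [e1 _]; rewrite eW' in_setU in_induced e1 uR vR.
have eaW : (e, a) \in W by rewrite eW' !in_setU digon_set_l !orbT.
have ebW : (e, b) \in W by rewrite eW' !in_setU digon_set_l !orbT.
have abW : (a, b) \in W by apply: inW.
have cdW : (c, d) \in W by apply: inW.
have notQ u v : (u, v) \in W -> (u, v) \notin Q -> (u, v) \in induced E R.
  by rewrite eW' in_setU => /orP[//|h]; rewrite h.
have sQ : symm Q by apply: symmU; apply: symm_digon_set.
have sWs : symm W by case: (ore_basicP o).
clear c2 ax4 ay4 az6.
case: {-1}_ / o (erefl W) => [K cK|E1 E2 F p q o1 o2 g] eK.
  have eKR : R = K by rewrite -eVR eK VE_complete // cK.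
  have [r] : exists r, r \in R :\: (e |: [set a; b]).
    apply/set0Pn; rewrite -card_gt0 cardsD.
    have := subset_leq_card (subsetIr R (e |: [set a; b])).
    have : #|e |: [set a; b]| <= 3 by rewrite cardsU1 cab; case: (_ \notin _).
    move: cK; rewrite -eKR; arith.
  rewrite in_setD in_setU1 in_set2 !negb_or => /andP[/and3P[re ra rb] rR].
  have dr w : w \in R -> w != e -> w != r -> digon_in w r.
    move=> wR we wr; have h : (w, r) \in W by rewrite eK completeP -eKR wR rR.
    have hE u v : (u, v) \in W -> u != e -> v != e -> (u, v) \in E.
      move=> h1 ue ve; suff /(notQ _ _ h1) : (u, v) \notin Q by rewrite in_induced => /andP[].
      by rewrite in_setU !in_digon_set (negPf ue) (negPf ve) !andbF.
    by split; apply: hE => //; apply: sWs.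
  have [rx ry rz] := out _ rR.
  apply: (@no_diamond a b r x y) => //; try exact: digon_sym.
  - by apply: dr; rewrite // eq_sym.
  - by apply: dr; rewrite // eq_sym.
  by rewrite !inE !negb_or eq_sym ay eq_sym by' eq_sym ry eq_sym xy.
have b1 := ore_basicP o1; have b2 := ore_basicP o2.
have [_ _ c1 _] := b1; have [_ _ c2 _] := b2.
have inF u v : (u, v) \in W -> ~~ ((u \in VE E1) && (v \in VE E1)) -> (u, v) \in F.
  rewrite eK in_setU in_setD => /orP[/andP[_ h]|//].
  by rewrite (VEl h) (VEr h).
have noAB u v : (u, v) \in W -> u \in VE E1 -> v \in VE E1 -> u \in VE F ->
    v \in VE F -> False.
  move=> h uA vA uF vF; have uv : u != v.
    by apply: contraTneq h => ->; have [lW _ _] := cW; apply: lW.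
  move: h; rewrite eK in_setU => /orP[|/(glue_noF b2 g)/(_ uA vA)//].
  rewrite in_setD in_digon_set => /andP[+ _]; move: uv.
  by case: (glue_V1F g uA uF) => ->; case: (glue_V1F g vA vF) => ->; rewrite !eqxx ?orbT.
have card1 := card_E1D b1 g; have cVW := card_VH g.
rewrite -eK eVR in cVW.
have A4 := ore_ge4 o1; have B4 := ore_ge4 o2.
have AR : VE E1 \subset R by rewrite -eVR eK; apply: glue_V1_H g.
have FW : F \subset W by rewrite eK subsetUr.
have BR : VE F \subset R by rewrite -eVR; apply: VES.
have symF := glue_symm g.
case: (boolP [&& e \in VE E1, a \in VE E1 & b \in VE E1]) => [/and3P[eA aA bA]|nA].
  have QF u v : (u, v) \in F -> (u, v) \notin Q.
    move=> f; apply/negP; rewrite in_setU !in_digon_set => /orP[] /orP[] /andP[/eqP h1 /eqP h2];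
    by subst u v; apply: (glue_noF b2 g f).
  case: (boolP ((c \in VE E1) && (d \in VE E1))) => [/andP[cA dA]|ncd].
    have i1 := addx _ AR aA bA; have i2 := addy _ AR eA; have i3 := addz _ AR cA dA.
    have ci := cardz _ AR; have SV := subV _ AR.
    have nS : z |: (y |: (x |: VE E1)) != VE E by apply/eqP => h; rewrite h in ci; arith.
    have S2 : 1 < #|z |: (y |: (x |: VE E1))| by arith.
    have := pot11 M SV nS S2.
    have : #|(E1 :\: digon_set p q) :\: Q| <= #|induced E (VE E1)|.
      apply/subset_leq_card/subsetP => -[u v]; rewrite in_setD => /andP[nq h].
      have : (u, v) \in W by rewrite eK in_setU h.
      move=> /notQ/(_ nq); rewrite !in_induced => /andP[-> _].
      by move: h; rewrite in_setD => /andP[_ h]; rewrite (VEl h) (VEr h).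
    have := cardsD (E1 :\: digon_set p q) Q.
    have := subset_leq_card (subsetIr (E1 :\: digon_set p q) Q).
    arith.
  have cdF := inF _ _ cdW ncd.
  have zB : z \notin VE F by apply: contraNN zR => /(subsetP BR).
  have cdB : [set c; d] \subset VE F by rewrite subUset !sub1set (VEl cdF) (VEr cdF).
  have nb w : w \in [set c; d] -> (z, w) \in E /\ (w, z) \in E.
    by rewrite in_set2 => /orP[] /eqP->.
  have i1 := induced_add_vertex zB cdB nb; rewrite cards2 cd in i1.
  have cB := card_VF b1 g.
  have czB : #|z |: VE F| = #|VE F| + 1 by rewrite cardsU1 zB addnC.
  have SV : z |: VE F \subset VE E by rewrite subUset sub1set zV (subset_trans BR R_sub).
  have lBR := subset_leq_card BR.
  have g3 : 3 < #|z |: VE F| by arith.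
  have g2 : #|z |: VE F| + 2 <= #|VE E| by arith.
  have := pot13 M SV g3 g2.
  have : #|F| <= #|induced E (VE F)|.
    apply/subset_leq_card/subsetP => -[u v] f; have := notQ _ _ (subsetP FW _ f) (QF _ _ f).
    by rewrite !in_induced (VEl f) (VEr f) => /andP[-> _].
  have := card_glueF g; arith.
have beW := sWs _ _ ebW; have aeW := sWs _ _ eaW; have baW := sWs _ _ abW.
have inFN t s : (t, s) \in W -> t \notin VE E1 -> (t, s) \in F.
  by move=> h n; apply: inF => //; rewrite negb_and n.
have other t s s' : (t, s) \in W -> (t, s') \in W -> (s, s') \in W -> t \notin VE E1 ->
    [/\ (t, s) \in F, (t, s') \in F & (s, s') \in F].
  move=> h1 h2 h3 n; have f1 := inFN _ _ h1 n; have f2 := inFN _ _ h2 n.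
  split => //; apply: inF => //; apply/negP => /andP[sA s'A].
  exact: noAB h3 sA s'A (VEr f1) (VEr f2).
have [eaF ebF] : (e, a) \in F /\ (e, b) \in F.
  move: nA; rewrite !negb_and => /or3P[] n.
  - by have [f1 f2 _] := other _ _ _ eaW ebW abW n.
  - by have [/symF f1 _ f2] := other _ _ _ aeW abW ebW n.
  - by have [/symF f1 _ f2] := other _ _ _ beW baW eaW n.
have QF : Q \subset F.
  apply/subsetP => -[u v]; rewrite in_setU !in_digon_set.
  by case/orP => /orP[] /andP[/eqP-> /eqP->] //; apply: symF.
have nAV : VE E1 != VE E.
  by apply: contraNneq xR => h; apply: (subsetP AR); rewrite h.
have A2 : 1 < #|VE E1| by arith.
have := pot11 M (subset_trans AR R_sub) nAV A2.
have : #|E1 :\: digon_set p q| <= #|induced E (VE E1)|.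
  apply/subset_leq_card/subsetP => -[u v] h.
  have nq : (u, v) \notin Q.
    apply/negP => /(subsetP QF); have := glue_disj b2 g.
    by move=> /disjointFr/(_ h) ->.
  have : (u, v) \in W by rewrite eK in_setU h.
  move=> /notQ/(_ nq); rewrite !in_induced => /andP[-> _].
  by move: h; rewrite in_setD => /andP[_ h]; rewrite (VEl h) (VEr h).
arith.
Qed.

End PathCase.
End Three.
End MinimalPath.
End Path.

(** * Discharging *)

Section Count.

Variable T : finType.
Implicit Types (E F W Q P : {set T * T}) (A B S R X U : {set T}).
Implicit Types (u v w x y z a b c d e : T).

Definition full E v : Prop := #|ins E v| = 3 /\ outs E v = ins E v.

Lemma full_star E v p : full E v -> p \in ins E v ->
  exists q r, [/\ star E v p q r, p != q, p != r & q != r].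
Proof.
move=> [c3 oi] pI; rewrite (cardsD1 p) pI in c3.
have /cards2P[q [r [qr hqr]]] : #|ins E v :\ p| == 2 by apply/eqP; move: c3; clear; lia.
have hI w : (w \in ins E v) = [|| w == p, w == q | w == r].
  have := in_setD1 w (ins E v) p; rewrite hqr in_set2.
  by case: (eqVneq w p) => [->|_ /= <-].
exists q, r; split => //.
- by move=> w; rewrite -hI; split; [rewrite inE|rewrite -oi inE].
- by have := set21 q r; rewrite -hqr in_setD1 eq_sym => /andP[].
- by have := set22 q r; rewrite -hqr in_setD1 eq_sym => /andP[].
Qed.

Lemma full_star2 E v p q : full E v -> p \in ins E v -> q \in ins E v -> p != q ->
  exists r, [/\ star E v p q r, r != p & r != q].
Proof.
move=> fv pI qI pq; have [s [t [h ps pt st]]] := full_star fv pI.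
have := proj1 (h q); rewrite inE in qI; rewrite qI eq_sym (negPf pq) /=.
case/esym/orP => /eqP e; subst q.
  by exists t; rewrite eq_sym pt eq_sym st.
by exists s; split; [apply: star_swap23|rewrite eq_sym|].
Qed.

Section NoPath.
Variable E : {set T * T}.
Hypothesis M : minimal_counterexample E.

(** If x and z are adjacent, two different outer neighbours can be coloured apart
    and the triangle extends the colouring; equal ones would form a K4. If not,
    path_digon applies at both ends of the path, against path_not_digons. *)
Lemma no_path x y z : full E x -> full E y -> full E z -> (x, y) \in E ->
  (z, y) \in E -> x != z -> False.
Proof.
move=> fx fy fz xyE zyE xz.
have xI : x \in ins E y by rewrite inE.
have zI : z \in ins E y by rewrite inE.
have [e [hy ex ez]] := full_star2 fy xI zI xz.
have [_ ox] := fx; have [_ oz] := fz.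
have yx : y \in ins E x by rewrite -ox inE.
have yz : y \in ins E z by rewrite -oz inE.
have xny : x != y by apply: contraTneq xyE => ->; apply: (loopE M).
have zny : z != y by apply: contraTneq zyE => ->; apply: (loopE M).
have ynz : y != z by rewrite eq_sym.
have ynx : y != x by rewrite eq_sym.
have zx : z != x by rewrite eq_sym.
have xV := VEl xyE; have yV := VEr xyE; have zV := VEl zyE.
have eV : e \in VE E by apply: (star_V hy); rewrite !inE eqxx !orbT.
have ey : e != y by apply: (star_neq M hy); rewrite !inE eqxx !orbT.
have hy' := star_swap12 hy.
case: (boolP ((x, z) \in E)) => [xzE|nxz].
  have zIx : z \in ins E x by rewrite -ox inE.
  have xIz : x \in ins E z by rewrite inE.
  have [b [hx by' bz]] := full_star2 fx yx zIx ynz.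
  have [d [hz dx dy]] := full_star2 fz xIz yz xny.
  have bV : b \in VE E by apply: (star_V hx); rewrite !inE eqxx !orbT.
  have dV : d \in VE E by apply: (star_V hz); rewrite !inE eqxx !orbT.
  have bx : b != x by apply: (star_neq M hx); rewrite !inE eqxx !orbT.
  have dz : d != z by apply: (star_neq M hz); rewrite !inE eqxx !orbT.
  case: (eqVneq b e) => [be|be]; last first.
    by apply: (triangle_ext M xV xny xz ynz hx hy hz) => //; apply: in_R.
  case: (eqVneq d e) => [de|de]; last first.
    apply: (triangle_ext M zV zny zx ynx (star_swap12 hz) hy' (star_swap12 hx)) => //;
    by apply: in_R.
  subst b d; pose K := [set x; y; z; e].
  have cK : #|K| = 4.
    by rewrite /K -!setUA !cardsU1 cards1 !inE !negb_or xny xz ynz !(eq_sym _ e) ex ey ez.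
  have KE : complete K \subset E.
    have hx' w := @star_in _ E _ _ _ _ w hx; have hy2 w := @star_in _ E _ _ _ _ w hy.
    have hz' w := @star_in _ E _ _ _ _ w hz.
    apply/subsetP => -[u v]; rewrite completeP !inE -!orbA => /and3P[].
    case/or4P => /eqP->; case/or4P => /eqP->; rewrite ?eqxx // => _;
    by [apply: (proj1 (hx' _ _)); rewrite !inE eqxx ?orbT
       |apply: (proj1 (hy2 _ _)); rewrite !inE eqxx ?orbT
       |apply: (proj1 (hz' _ _)); rewrite !inE eqxx ?orbT
       |apply: (proj2 (hx' _ _)); rewrite !inE eqxx ?orbT
       |apply: (proj2 (hy2 _ _)); rewrite !inE eqxx ?orbT
       |apply: (proj2 (hz' _ _)); rewrite !inE eqxx ?orbT].
  have oK := ore_K4 cK; have [_ _ _ nK] := ore_basicP oK.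
  by apply: (mc_not_ore M); rewrite -(critical_eq (mc_crit M) KE nK).
have [a [b [hx ya yb ab]]] := full_star fx yx.
have [c [d [hz yc yd cd]]] := full_star fz yz.
have nzx : (z, x) \notin E.
  apply: contraNN nxz => h; suff : z \in outs E x by rewrite inE.
  by rewrite ox inE.
have far w p q : star E x y p q -> w \in [:: p; q] -> w != z.
  move=> h wpq; apply: contraNneq nxz => <-.
  have [] // := @star_in _ E x y p q w h.
  by rewrite in_cons wpq orbT.
have far' w p q : star E z y p q -> w \in [:: p; q] -> w != x.
  move=> h wpq; apply: contraNneq nzx => <-.
  have [] // := @star_in _ E z y p q w h.
  by rewrite in_cons wpq orbT.
have az : a != z by apply: (far _ _ _ hx); rewrite !inE eqxx.
have bz : b != z by apply: (far _ _ _ hx); rewrite !inE eqxx orbT.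
have cx : c != x by apply: (far' _ _ _ hz); rewrite !inE eqxx.
have dx : d != x by apply: (far' _ _ _ hz); rewrite !inE eqxx orbT.
have ax : a != x by apply: (star_neq M hx); rewrite !inE eqxx !orbT.
have bx : b != x by apply: (star_neq M hx); rewrite !inE eqxx !orbT.
have cz : c != z by apply: (star_neq M hz); rewrite !inE eqxx !orbT.
have dz : d != z by apply: (star_neq M hz); rewrite !inE eqxx !orbT.
have aV : a \in VE E by apply: (star_V hx); rewrite !inE eqxx !orbT.
have bV : b \in VE E by apply: (star_V hx); rewrite !inE eqxx !orbT.
have cV : c \in VE E by apply: (star_V hz); rewrite !inE eqxx !orbT.
have dV : d \in VE E by apply: (star_V hz); rewrite !inE eqxx !orbT.
rewrite eq_sym in ya; rewrite eq_sym in yb; rewrite eq_sym in yc; rewrite eq_sym in yd.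
have dab : digon_in E a b.
  by apply: (path_digon M xV yV zV xny xz ynz hx hy hz); try exact: in_R.
have dcd : digon_in E c d.
  by apply: (path_digon M zV yV xV zny zx ynx hz hy' hx); try exact: in_R.
by apply: (path_not_digons M xV yV zV xny xz ynz hx hy hz) => //; apply: in_R.
Qed.

End NoPath.

Definition no_full_path E : Prop := forall x y z, full E x -> full E y -> full E z ->
  (x, y) \in E -> (z, y) \in E -> x != z -> False.

Lemma full_conv E v : full (converse E) v -> full E v.
Proof. by rewrite /full ins_conv outs_conv => -[h1 h2]; rewrite h2. Qed.

Lemma no_full_path_conv E : no_full_path E -> no_full_path (converse E).
Proof.
move=> h x y z /full_conv fx /full_conv fy /full_conv fz; rewrite !in_converse => e1 e2.
have [_ oy] := fy.
have flip w : (y, w) \in E -> (w, y) \in E.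
  by move=> e; have : w \in outs E y; [rewrite inE|rewrite oy inE].
by apply: (h x y z) => //; apply: flip.
Qed.

(** Two in-neighbours of out-degree 3 exclude, by single_in, that y has an in-arc
    outside digons, so y is full. By the converse statement neither of the two has
    an out-arc outside digons either, and the three vertices form a path of full
    vertices. *)
Lemma card_in_neighbours_out3 E y : critical E -> sparse E -> bounded_below T #|VE E| ->
    no_full_path E -> #|ins E y| = 3 ->
  #|[set x in ins E y | #|outs E x| == 3]| <= 1.
Proof.
move=> cE sE bd np c3; rewrite leqNgt; apply/negP => /card_gt1P[x1 [x2 []]].
rewrite !in_set => /andP[e1 /eqP o1] /andP[e2 /eqP o2] n12.
have double w : (w, y) \in E -> (y, w) \in E.
  move=> e; apply: contraT => ne.
  have eqw x : (x, y) \in E -> #|outs E x| = 3 -> x = w.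
    move=> ex o; apply/eqP; apply: contraT => nxw.
    have xI : x \in ins E y by rewrite inE.
    by have := single_in cE sE bd e ne c3 xI nxw; rewrite o.
  by move: n12; rewrite (eqw _ e1 o1) (eqw _ e2 o2) eqxx.
have fy : full E y.
  split => //; apply/eqP; rewrite eqEsubset.
  have io : ins E y \subset outs E y by apply/subsetP => w; rewrite !inE; apply: double.
  by rewrite io double_in.
have fx x : (x, y) \in E -> #|outs E x| = 3 -> full E x.
  move=> ex o; have yx := double _ ex.
  have oi : outs E x \subset ins E x.
    apply/subsetP => w; rewrite !inE => xw; apply: contraT => wx.
    have yO : y \in outs E x by rewrite inE.
    have yw : y != w by apply: contraNneq wx => <-.
    by have := single_out cE sE bd xw wx o yO yw; rewrite c3.
  have e : outs E x = ins E x by apply/eqP; rewrite eqEsubset oi double_out.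
  by split; rewrite -?e.
by apply: (np x1 y x2) => //; apply: fx.
Qed.

Lemma card_fst P : #|P| = \sum_x #|[set y | (x, y) \in P]|.
Proof.
rewrite (eq_bigr (fun x => \sum_(y | (x, y) \in P) 1)); last first.
  by move=> x _; rewrite -sum1_card; apply: eq_bigl => y; rewrite inE.
by rewrite pair_big_dep -sum1_card; apply: eq_bigl => -[x y].
Qed.

Lemma card_snd P : #|P| = \sum_y #|[set x | (x, y) \in P]|.
Proof.
rewrite -card_conv card_fst; apply: eq_bigr => y _; apply: eq_card => x.
by rewrite !inE.
Qed.

Definition out3 E : {set T} := [set x in VE E | #|outs E x| == 3].
Definition in3 E : {set T} := [set x in VE E | #|ins E x| == 3].

(** Let every vertex of out-degree k at least 4 send 1 along each of its arcs to a
    vertex of in-degree 3. It sends at most k, which is at most 6k - 20, and every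
    vertex of in-degree 3 receives at least 2. *)
Lemma discharge E : critical E ->
    (forall y, #|ins E y| = 3 -> #|[set x in ins E y | #|outs E x| == 3]| <= 1) ->
  10 * #|VE E| + #|in3 E| <= 3 * #|E| + #|out3 E|.
Proof.
move=> cE bad.
pose P := [set a in E | (#|outs E a.1| != 3) && (#|ins E a.2| == 3)].
pose B := VE E :\: out3 E.
pose s := \sum_(x in B) #|outs E x|.
have outs0 x : x \notin VE E -> #|outs E x| = 0.
  move=> xV; apply/eqP; rewrite cards_eq0; apply/eqP/setP => w; rewrite !inE.
  by apply: contraNF xV => /VEl.
have lower : 2 * #|in3 E| <= #|P|.
  rewrite card_snd (bigID (mem (in3 E))) /=; apply: leq_trans (leq_addr _ _).
  rewrite mulnC -sum_nat_const; apply: leq_sum => y.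
  rewrite in_set => /andP[yV /eqP c3].
  have -> : [set x | (x, y) \in P] = ins E y :\: [set x in ins E y | #|outs E x| == 3].
    apply/setP => x; rewrite in_setD !in_set /= c3 eqxx andbT.
    by case: ((x, y) \in E); rewrite ?andbF ?andbT.
  rewrite cardsD (setIidPr _); last by apply/subsetP => x; rewrite in_set => /andP[].
  by have := bad _ c3; rewrite c3; move: #|_|; clear; lia.
have upper : #|P| <= s.
  rewrite card_fst /s [X in _ <= X]big_mkcond /=; apply: leq_sum => x _.
  case: (boolP (x \in B)) => xB.
    by apply: subset_leq_card; apply/subsetP => y; rewrite !in_set => /andP[].
  rewrite leqn0 cards_eq0; apply/eqP/setP => y; rewrite !in_set /=.
  apply: contraNF xB => /andP[e /andP[n _]].
  by rewrite in_setD in_set (VEl e) (negPf n).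
have total : #|E| = s + 3 * #|out3 E|.
  rewrite card_fst (bigID (mem B)) /=; congr (_ + _).
  rewrite mulnC -sum_nat_const [LHS]big_mkcond [RHS]big_mkcond /=.
  apply: eq_bigr => x _; rewrite in_setD in_set /=.
  case: (boolP (x \in VE E)) => xV; rewrite ?andbF ?andbT /=; last exact: outs0.
  by case: eqP.
have deg4 : 4 * #|B| <= s.
  rewrite mulnC -sum_nat_const; apply: leq_sum => x.
  rewrite in_setD in_set => /andP[+ xV]; rewrite xV /= => n.
  have := critical_outs cE xV; move: n; move: #|_|; clear; lia.
have cV : #|B| + #|out3 E| = #|VE E|.
  rewrite -(cardsID (out3 E) (VE E)) addnC (setIidPr _) //.
  by apply/subsetP => x; rewrite in_set => /andP[].
move: lower upper total deg4 cV; clear; lia.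
Qed.

(** Discharging in both directions cancels the vertices of degree 3, leaving
    3m at least 10n. *)
Lemma no_minimal_counterexample E : ~ minimal_counterexample E.
Proof.
move=> M; have cE := mc_crit M.
have sp : sparse E by move=> S; apply: pot12.
have bd : bounded_below T #|VE E| by move=> F cF lt; case: (mc_IH M cF lt).
have np : no_full_path E by move=> x y z; apply: no_path.
have h1 : 10 * #|VE E| + #|in3 E| <= 3 * #|E| + #|out3 E|.
  by apply: discharge => // y; apply: card_in_neighbours_out3.
have h2 : 10 * #|VE (converse E)| + #|in3 (converse E)| <= 3 * #|converse E| + #|out3 (converse E)|.
  apply: discharge; first exact: critical_conv.
  move=> y; apply: card_in_neighbours_out3.
  - exact: critical_conv.
  - exact: sparse_conv.
  - by rewrite VE_conv.
  - exact: no_full_path_conv.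
have e1 : in3 (converse E) = out3 E.
  by rewrite /in3 VE_conv; apply/setP => x; rewrite !in_set ins_conv.
have e2 : out3 (converse E) = in3 E.
  by rewrite /out3 VE_conv; apply/setP => x; rewrite !in_set outs_conv.
rewrite VE_conv card_conv e1 e2 in h2; have := mc_pot M; arith.
Qed.

Theorem critical_potential E : critical E ->
  10 * #|VE E| <= 3 * #|E| + 4 /\ (10 * #|VE E| = 3 * #|E| + 4 -> ore E).
Proof.
have [n] := ubnP #|VE E|; elim: n E => // n IHn E hn cE.
case: (pselect (ore E)) => [o|no].
  by have [_ _ c _] := ore_basicP o; split=> //; rewrite c.
have lt : 10 * #|VE E| < 3 * #|E| + 4.
  rewrite ltnNge; apply/negP => hp; apply: (@no_minimal_counterexample E).
  by split => // F cF lF; apply: IHn => //; apply: leq_trans lF _.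
by split; [apply: ltnW|move=> e; move: lt; rewrite e ltnn].
Qed.

End Count.

(** * Digraphs and arc sets *)

Section Translation.

Implicit Types D : digraph.
Local Notation arc := Defs.arc.

Lemma arcsP D (u v : D) : ((u, v) \in arcs D) = arc u v.
Proof. by rewrite inE. Qed.

Lemma loopless_arcs D : loopless (arcs D).
Proof. by move=> u; rewrite arcsP arc_irr. Qed.

Lemma col3_dicolouring D (phi : D -> 'I_3) f : col3 (arcs D) phi f -> dicolouring phi.
Proof.
move=> c [|u p] [] //= p1 /andP[cyc _] mono.
have inc v q : path (@Defs.arc D) v q -> {in v :: q, forall w, phi w = phi u} ->
    (f v <= f (last v q)) && ((q != [::]) ==> (f v < f (last v q))).
  elim: q v => [|w q IHq] v /=; first by rewrite leqnn.
  move=> /andP[vw pq] hm; have lt : f v < f w.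
    by apply: c; rewrite ?arcsP // !hm ?inE ?eqxx ?orbT.
  have /andP[le _] := IHq w pq (fun x hx => hm x (mem_behead (s := v :: w :: q) hx)).
  by rewrite ltnW (leq_trans lt le).
have mono' : {in u :: rcons p u, forall w, phi w = phi u}.
  move=> w; rewrite in_cons mem_rcons => hw; apply: mono => //; last by rewrite inE eqxx.
  by move: hw; rewrite !in_cons orbA orbb.
have := inc _ _ cyc mono'; rewrite last_rcons leqnn ltnn implybF negbK /=.
by move=> /eqP/(congr1 size); rewrite size_rcons.
Qed.

(** Without monochromatic cycles, the number of vertices from which a vertex is
    reached by monochromatic paths is a rank. *)
Lemma dicolouring_col3 D (phi : D -> 'I_3) : dicolouring phi ->
  exists f, col3 (arcs D) phi f.
Proof.
move=> dic; pose m := [rel u v : D | arc u v && (phi u == phi v)].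
exists (fun v => #|[set w | connect m w v]|) => u v; rewrite arcsP => uv hp.
have muv : m u v by rewrite /= uv hp eqxx.
apply: proper_card; rewrite properE; apply/andP; split.
  apply/subsetP => w; rewrite !inE => h; apply: connect_trans h _.
  exact: connect1.
apply/subsetPn; exists v; rewrite !inE ?connect0 //.
apply/negP => /connectP[q0 hq0 lq0].
case/shortenP: hq0 lq0 => q hq uq _ lq {q0}.
have q0 : q != [::] by apply: contraTneq uv => q0; rewrite q0 in lq; rewrite lq arc_irr.
apply: (dic (v :: q)); first split.
- by case: q q0 {hq uq lq}.
- apply/andP; split => //=; rewrite rcons_path -lq uv andbT.
  by apply: sub_path hq => a b /andP[].
suff mono w : w \in v :: q -> phi w = phi v by move=> a b /mono-> /mono->.
elim: q v hq {uq lq q0 uv hp muv} => [|a q IHq] v /=; first by rewrite inE => _ /eqP->.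
move=> /andP[/andP[_ /eqP va] /IHq h]; rewrite in_cons => /orP[/eqP->//|/h->].
by rewrite va.
Qed.

Lemma dicolourable3 D : dicolourable D 3 <-> colourable (arcs D).
Proof.
split=> [[phi /dicolouring_col3[f c]]|[phi [f c]]]; first by exists phi, f.
by exists phi; apply: col3_dicolouring c.
Qed.

Lemma dichromatic_min D k : dicolourable D k -> dichromatic_number D <= k.
Proof.
move=> h; rewrite /dichromatic_number; case: ex_minnP => n _; apply.
exact/asboolP.
Qed.

Lemma dichromatic_lt4 D : dichromatic_number D < 4 -> dicolourable D 3.
Proof.
rewrite /dichromatic_number; case: ex_minnP => n /asboolP[phi dic] _ lt.
exists (fun v => widen_ord (lt : n <= 3) (phi v)) => c cyc mono.
apply: (dic c cyc) => u v uc vc; apply: val_inj.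
by have /(congr1 val) := mono _ _ uc vc.
Qed.

Lemma sub_colourable D (H : subdigraph D) : dicolourable H 3 -> colourable (sub_arcs H).
Proof.
move=> /dicolourable3[phi [f c]].
exists (fun v => if insub v is Some w then phi w else ord0).
exists (fun v => if insub v is Some w then f w else 0).
move=> u v e; have /and3P[_ /= uH vH] := sub_arcsP e.
rewrite (insubT (fun w => w \in sub_verts H) uH).
rewrite (insubT (fun w => w \in sub_verts H) vH).
by apply: c; rewrite arcsP.
Qed.

Lemma dicritical_arcs D : dicritical 4 D ->
  critical (arcs D) /\ VE (arcs D) = [set: D].
Proof.
move=> [chi crit].
have nc : ~ colourable (arcs D).
  by move=> /dicolourable3/dichromatic_min; rewrite chi.
have del (H : subdigraph D) : proper_subdigraph H -> colourable (sub_arcs H).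
  by move=> p; exact: (sub_colourable (dichromatic_lt4 (crit H p))).
split; [split => //; first exact: loopless_arcs|].
  move=> a aD.
  have P b : b \in arcs D :\ a -> [&& b \in arcs D, b.1 \in [set: D] & b.2 \in [set: D]].
    by rewrite !in_setT andbT in_setD1 => /andP[_ ->].
  apply: (del (Subdigraph P)) => -[_ /= /setP/(_ a)].
  by rewrite in_setD1 eqxx aD.
apply/eqP; rewrite eqEsubset subsetT; apply/subsetP => v _.
apply: contraT => nv; exfalso; apply: nc.
have P b : b \in arcs D -> [&& b \in arcs D, b.1 \in [set~ v] & b.2 \in [set~ v]].
  case: b => p q e; rewrite e /= !in_setC1; apply/andP; split.
    by apply: contraNneq nv => <-; apply: VEl e.
  by apply: contraNneq nv => <-; apply: VEr e.
apply: (del (Subdigraph P)) => -[/= /setP/(_ v)].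
by rewrite in_setC1 in_setT eqxx.
Qed.

(** ** Ore arc sets are the arc sets of Ore digraphs *)

(** Ore digraphs are closed under isomorphism, so it is enough to know a digraph
    up to an injection that carries its arcs onto an arc set. *)
Definition realizes D (T : finType) (E : {set T * T}) (f : D -> T) : Prop :=
  [/\ injective f, forall v, v \in VE E <-> exists u, f u = v &
      forall u v, arc u v = ((f u, f v) \in E)].

Lemma realizes_diso D D' (T : finType) (E : {set T * T}) f f' :
  @realizes D T E f -> @realizes D' T E f' -> diso D D'.
Proof.
move=> [injf imf af] [injf' imf' af'].
have ex u : exists v, f' v == f u.
  have /imf'[v h] : f u \in VE E by apply/imf; exists u.
  by exists v; apply/eqP.
have ex' u : exists v, f v == f' u.
  have /imf[v h] : f' u \in VE E by apply/imf'; exists u.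
  by exists v; apply/eqP.
pose g u := xchoose (ex u); pose g' u := xchoose (ex' u).
have hg u : f' (g u) = f u by apply/eqP; exact: (xchooseP (ex u)).
have hg' u : f (g' u) = f' u by apply/eqP; exact: (xchooseP (ex' u)).
exists g; first exists g' => [u|u].
- by apply: (injf (g' (g u)) u); rewrite hg' hg.
- by apply: (injf' (g (g' u)) u); rewrite hg hg'.
- by move=> u v; rewrite af' af !hg.
Qed.

Lemma realizes_K4 (T : finType) (S : {set T}) : #|S| = 4 ->
  exists f, @realizes (bidirected_complete 4) T (complete S) f.
Proof.
move=> c4; exists (fun i => enum_val (cast_ord (esym c4) i)); split.
- by move=> i j /enum_val_inj/cast_ord_inj.
- move=> v; rewrite VE_complete ?c4 //; split=> [vS|[i <-]]; last exact: enum_valP.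
  by exists (cast_ord c4 (enum_rank_in vS v)); rewrite cast_ordK enum_rankK_in.
move=> i j; rewrite completeP !enum_valP /=.
by rewrite (inj_eq enum_val_inj) (inj_eq (@cast_ord_inj _ _ _)).
Qed.

Section OfArcs.
Variables (T : finType) (E : {set T * T}).
Hypothesis lE : loopless E.

Definition arcs_rel : rel {v : T | v \in VE E} := fun u v => (val u, val v) \in E.

Lemma arcs_rel_irr : irreflexive arcs_rel.
Proof. by move=> u; apply/negbTE; apply: lE. Qed.

Definition digraph_of_arcs : digraph := Digraph arcs_rel_irr.

Lemma realizes_arcs : @realizes digraph_of_arcs T E val.
Proof.
split=> //; first exact: val_inj.
move=> v; split=> [vE|[u <-]]; last exact: valP.
by exists (exist _ v vE).
Qed.
End OfArcs.

Lemma realizes_bidirected D (T : finType) (E : {set T * T}) f :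
  @realizes D T E f -> symm E -> bidirected D.
Proof.
move=> [_ _ af] s u v; rewrite /adjacent /digon !af.
by case/orP => h; rewrite h s.
Qed.

Lemma ore_four_Ore (T : finType) (E : {set T * T}) : ore E ->
  forall D f, @realizes D T E f -> four_Ore D.
Proof.
elim=> [S c4|E1 E2 F x y o1 IH1 o2 IH2 g] D f rD.
  have [h rK] := realizes_K4 c4; apply: four_Ore_K4; exact: realizes_diso rD rK.
have b1 := ore_basicP o1; have b2 := ore_basicP o2.
have [l1 s1 _ _] := b1; have [l2 s2 _ _] := b2.
have r1 := realizes_arcs l1; have r2 := realizes_arcs l2.
set D1 := digraph_of_arcs l1 in r1; set D2 := digraph_of_arcs l2 in r2.
apply: (four_Ore_comp (IH1 _ _ r1) (IH2 _ _ r2)).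
split; [exact: realizes_bidirected r1 s1|exact: realizes_bidirected r2 s2|].
have xA := glue_xV1 g; have yA := glue_yV1 g; have xB := glue_xV2 g.
pose x1 : D1 := exist _ x xA; pose y1 : D1 := exist _ y yA.
pose z : D2 := exist _ x xB.
pose Z1 : {set D2} := [set w : D2 | (x, val w) \in F].
pose Z2 : {set D2} := [set w : D2 | (y, val w) \in F].
have symF := glue_symm g.
have ny (w : D2) : val w != y.
  by apply: contraNneq (glue_yV2 b1 g) => <-; apply: valP w.
have nb (w : D2) : (w \in neighbourhood z) = ((x, val w) \in E2).
  rewrite inE /adjacent /= /arcs_rel /=; apply/orP/idP => [[//|/s2//]|e]; by left.
have Z1E w : w \in Z1 -> (x, val w) \in E2.
  by rewrite inE => /(glueF g); rewrite fuse_x fuse_id.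
have Z2E w : w \in Z2 -> (x, val w) \in E2.
  by rewrite inE => /(glueF g); rewrite fuse_y fuse_id.
have noxy u v : (u, v) \in F -> u \in [:: x; y] -> v \in VE E2.
  move=> f1 uxy; have uA : u \in VE E1.
    have [->//|->//] : u = x \/ u = y.
    by move: uxy; rewrite !inE => /orP[] /eqP; [left|right].
  have : v \in VE F by apply: VEr f1.
  rewrite (glue_VF g) in_setU1 => /orP[/eqP h|//].
  by case: (glue_noF b2 g f1 uA); rewrite h.
have nonempty u : u \in VE F -> u \in [:: x; y] -> exists w : D2, (u, val w) \in F.
  move=> /VEP[w h] uxy; have f1 : (u, w) \in F by case: h => // /symF.
  by exists (exist _ w (noxy _ _ f1 uxy)).
exists x1, y1, z, Z1, Z2; split.
- rewrite /digon /= /arcs_rel /= (glue_arc g); apply: s1; exact: glue_arc g.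
- apply/setP => w; rewrite nb in_setU; apply/orP/idP => [[/Z1E|/Z2E]//|e].
  have [p [q [h hp hq]]] := glueE2 g e.
  have eq' : q = val w.
    move: hq; rewrite /fuse; case: eqP => // _ hx.
    by move: e; rewrite -hx (negPf (l2 x)).
  move: hp; rewrite /fuse; case: eqP => [py _|_ px].
    by right; rewrite inE -eq' -py.
  by left; rewrite inE -eq' -px.
- apply/pred0P => w /=; apply/negP => /andP[]; rewrite !inE => h1 h2.
  have := glue_inj g h1 h2; rewrite /map_arc /= fuse_x fuse_y => /(_ erefl)[].
  by apply/eqP; apply: glue_neq b1 g.
- split; apply/set0Pn.
    have [w h] := nonempty _ (glue_x g) (mem_head _ _).
    by exists w; rewrite inE.
  have [w h] := nonempty _ (glue_y g) (mem_last x [:: y]).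
  by exists w; rewrite inE.
pose h (a : ore_digraph x1 y1 z Z1 Z2) : T :=
  match a with inl u => val u | inr w => val (val w) end.
apply: (realizes_diso rD (f' := h)); split.
- have nz (w : {w : D2 | w != z}) : val (val w) \notin VE E1.
    apply/negP => hw; have e := glue_V12 g hw (valP (val w)).
    by have := valP w; rewrite -(inj_eq val_inj) /= e eqxx.
  move=> [u|w] [u'|w'] /= e.
  + by congr inl; apply: val_inj.
  + by case/negP: (nz w'); apply: (eq_ind (val u) (fun t => t \in VE E1) (valP u) _ e).
  + by case/negP: (nz w); apply: (eq_ind _ (fun t => t \in VE E1) (valP u') _ (esym e)).
  + by congr inr; apply: val_inj; apply: val_inj.
- move=> v; rewrite (glue_VH g) in_setU; split.
    case: (boolP (v \in VE E1)) => [v1 _|v1 /= v2]; first by exists (inl (exist _ v v1)).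
    have nz : (exist _ v v2 : D2) != z.
      by rewrite -(inj_eq val_inj) /=; apply: contraNneq v1 => ->.
    by exists (inr (exist _ (exist _ v v2 : D2) nz)).
  case=> -[u|w] <- /=; first by rewrite (valP u).
  by rewrite (valP (val w)) orbT.
have nz (w : {w : D2 | w != z}) : val (val w) \notin VE E1 /\ val (val w) != x.
  have n : val (val w) != x by have := valP w; rewrite -(inj_eq val_inj).
  split=> //; apply: contraNN n => hw.
  by rewrite (glue_V12 g hw (valP (val w))).
have cross u (w : {w : D2 | w != z}) :
    ore_cross x1 y1 Z1 Z2 u (val w) = ((val u, val (val w)) \in (E1 :\: digon_set x y) :|: F).
  have [n1 n2] := nz w; rewrite glue_in in_setD.
  have -> : ((val u, val (val w)) \in E1) = false.
    by apply: contraNF n1 => /VEr.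
  rewrite andbF /= /ore_cross !inE -!(inj_eq val_inj) /=.
  apply/orP/idP => [[] /andP[/eqP-> //]|f1].
  case: (glue_V1F g (valP u) (VEl f1)) => e; rewrite e in f1 *.
    by left; rewrite eqxx.
  by right; rewrite eqxx.
have symH := symm_H b1 g.
move=> [u|w] [u'|w'] /=.
- rewrite glue_in in_setD in_digon_set /arcs_rel.
  have -> : ((val u, val u') \in F) = false.
    by apply/negP => /(glue_noF b2 g)/(_ (valP u) (valP u')).
  rewrite orbF andbC; congr (~~ _ && _).
  by rewrite !inE !xpair_eqE -!(inj_eq val_inj).
- exact: cross.
- rewrite cross; apply/idP/idP; exact: symH.
have [n1 n2] := nz w; have [n1' n2'] := nz w'.
rewrite glue_in in_setD /arcs_rel.
have -> : ((val (val w), val (val w')) \in E1) = false.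
  by apply: contraNF n1 => /VEl.
rewrite andbF /=; apply/idP/idP => [e|f1]; first exact: glue_E2F g e n2 n2'.
have := glueF g f1; rewrite !fuse_id //; exact: ny.
Qed.

Lemma arcs_four_Ore D : ore (arcs D) -> VE (arcs D) = [set: D] -> four_Ore D.
Proof.
move=> o hV; apply: (ore_four_Ore o (f := id)); split=> //.
- by move=> v; rewrite hV in_setT; split=> // _; exists v.
by move=> u v; rewrite arcsP.
Qed.

End Translation.

(** * The arcs of Ore digraphs *)

Section Count4Ore.

Implicit Types D : digraph.
Local Notation arc := Defs.arc.

Lemma num_arcsE D : num_arcs D = \sum_(u : D) \sum_(v : D) arc u v.
Proof.
rewrite /num_arcs card_fst; apply: eq_bigr => u _; rewrite -sum1_card [LHS]big_mkcond.
by apply: eq_bigr => v _; rewrite inE arcsP; case: (arc u v).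
Qed.

Lemma diso_card D D' : diso D D' ->
  num_vertices D = num_vertices D' /\ num_arcs D = num_arcs D'.
Proof.
move=> [f bf mf]; split; first exact: bij_eq_card bf.
rewrite !num_arcsE (reindex f) /=; last exact: onW_bij.
apply: eq_bigr => u _; rewrite [RHS](reindex f) /=; last exact: onW_bij.
by apply: eq_bigr => v _; rewrite mf.
Qed.

Lemma num_K4 : num_vertices (bidirected_complete 4) = 4 /\
  num_arcs (bidirected_complete 4) = 12.
Proof.
split; first exact: card_ord.
have -> : 12 = #|complete [set: 'I_4]| by rewrite card_complete cardsT card_ord.
by apply: eq_card => -[u v]; rewrite arcsP completeP !in_setT.
Qed.

Section Composition.
Variables (D1 D2 : digraph) (x y : D1) (z : D2) (Z1 Z2 : {set D2}).
Hypothesis (bi2 : bidirected D2) (dxy : digon x y).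
Hypothesis (ZU : Z1 :|: Z2 = neighbourhood z) (Zd : [disjoint Z1 & Z2]).
Let D := ore_digraph x y z Z1 Z2.

Lemma num_vertices_ore : num_vertices D + 1 = num_vertices D1 + num_vertices D2.
Proof.
rewrite /num_vertices card_sum card_sig -addnA; congr (_ + _).
rewrite (eq_card (B := predC1 z)) // cardC1 addn1 prednK //.
by apply/card_gt0P; exists z.
Qed.

Lemma sum_neq (G : D2 -> nat) :
  \sum_(w : {w : D2 | w != z}) G (val w) + G z = \sum_w G w.
Proof.
rewrite [RHS](bigD1 z) //= addnC; congr (_ + _).
exact/esym/(big_sub [pred w | w != z]).
Qed.

Lemma out_neighbours (w : D2) : (w \in neighbourhood z) = arc z w.
Proof.
rewrite inE; apply/idP/idP => [/bi2/andP[]//|h].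
by rewrite /adjacent h.
Qed.

Lemma in_neighbours (w : D2) : (w \in neighbourhood z) = arc w z.
Proof.
rewrite inE; apply/idP/idP => [/bi2/andP[]//|h].
by rewrite /adjacent h orbT.
Qed.

Lemma sum_cross : \sum_(u : D1) \sum_(w : {w : D2 | w != z})
  ore_cross x y Z1 Z2 u (val w) = #|neighbourhood z|.
Proof.
have xny : x != y.
  by apply: contraTneq dxy => ->; rewrite /digon arc_irr.
rewrite exchange_big /=.
transitivity (\sum_(w : {w : D2 | w != z}) ((val w \in neighbourhood z) : nat)).
  apply: eq_bigr => w _; rewrite -ZU in_setU.
  rewrite (bigD1 x) //= (bigD1 y) /=; last by rewrite eq_sym.
  rewrite big1 => [|u /andP[/negPf ux /negPf uy]]; last by rewrite /ore_cross ux uy.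
  rewrite /ore_cross !eqxx (negPf xny) eq_sym (negPf xny) /= orbF addn0.
  by case: (boolP (_ \in Z1)) => // /(disjointFr Zd)->.
have := sum_neq (fun w => (w \in neighbourhood z) : nat).
rewrite out_neighbours arc_irr addn0 => ->.
by rewrite -sum1_card [RHS]big_mkcond; apply: eq_bigr => w _; case: (_ \in _).
Qed.

Lemma num_arcs_ore : num_arcs D + 2 = num_arcs D1 + num_arcs D2.
Proof.
have xny : x != y.
  by apply: contraTneq dxy => ->; rewrite /digon arc_irr.
have e1 : \sum_(u : D1) \sum_(v : D1)
    (arc u v && ((u, v) \notin [set (x, y); (y, x)]) : nat) + 2 = num_arcs D1.
  rewrite /num_arcs -(cardsID [set (x, y); (y, x)] (arcs D1)) addnC; congr (_ + _).
    have /setIidPr-> : [set (x, y); (y, x)] \subset arcs D1.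
      have /andP[h1 h2] := dxy.
      by rewrite subUset !sub1set !arcsP h1.
    by rewrite cards2 xpair_eqE (negPf xny).
  rewrite card_fst; apply: eq_bigr => u _; rewrite -sum1_card [RHS]big_mkcond.
  apply: eq_bigr => v _; rewrite inE in_setD arcsP andbC.
  by case: (_ && _).
have e2 : \sum_(w : {w : D2 | w != z}) \sum_(w' : {w : D2 | w != z})
    (arc (val w) (val w') : nat) + 2 * #|neighbourhood z| = num_arcs D2.
  have rows (G : D2 -> nat) : (forall w, G w = (w \in neighbourhood z) :> nat) ->
      \sum_w G w = #|neighbourhood z|.
    move=> hG; rewrite -sum1_card [RHS]big_mkcond; apply: eq_bigr => w _.
    by rewrite hG; case: (_ \in _).
  rewrite num_arcsE -(sum_neq (fun w => \sum_v arc w v)).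
  rewrite (rows (fun v => arc z v)); last by move=> w; rewrite out_neighbours.
  have inner (w : {w : D2 | w != z}) : \sum_v arc (val w) v =
      \sum_(w' : {w : D2 | w != z}) arc (val w) (val w') + arc (val w) z.
    by rewrite -(sum_neq (fun v => arc (val w) v)).
  rewrite (eq_bigr _ (fun w _ => inner w)) big_split /=.
  have -> : \sum_(w : {w : D2 | w != z}) arc (val w) z = #|neighbourhood z|.
    rewrite -[LHS]addn0 -[X in _ + X](_ : (arc z z : nat) = 0); last by rewrite arc_irr.
    rewrite (sum_neq (fun w => arc w z)); apply: rows => w.
    by rewrite in_neighbours.
  by rewrite mul2n -addnn addnA.
rewrite num_arcsE big_sumType /=.
under eq_bigr => u _ do rewrite big_sumType /=.
under [X in _ + X + _]eq_bigr => u _ do rewrite big_sumType /=.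
rewrite !big_split /= sum_cross [X in _ + (X + _)]exchange_big /= sum_cross.
have total (i j k : nat) : i + k + (k + j) + 2 = i + 2 + (j + 2 * k) by lia.
by rewrite -e1 -e2; apply: total.
Qed.

End Composition.

Lemma four_Ore_card D : four_Ore D -> 10 * num_vertices D = 3 * num_arcs D + 4.
Proof.
elim=> [D0 /diso_card[-> ->]|D1 D2 D0 _ h1 _ h2]; first by have [-> ->] := num_K4.
move=> [b1 b2 [x [y [z [Z1 [Z2 [dxy ZU Zd _ /diso_card[-> ->]]]]]]]].
have := num_vertices_ore x y z Z1 Z2; have := num_arcs_ore b2 dxy ZU Zd; lia.
Qed.

End Count4Ore.

Unset Implicit Arguments.

Import Order.TTheory GRing.Theory Num.Theory.
Local Open Scope ring_scope.

Theorem corollary9 (D : digraph) (hD : dicritical 4 D) :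
  [/\ (num_arcs D)%:R >= 10 / 3 * (num_vertices D)%:R - 4 / 3 :> rat,
      (num_arcs D)%:R = 10 / 3 * (num_vertices D)%:R - 4 / 3 :> rat <-> four_Ore D &
      ~ four_Ore D -> (num_arcs D)%:R >= 10 / 3 * (num_vertices D)%:R - 1 :> rat].
Proof.
have [cD VD] := dicritical_arcs hD.
have [le4 o] := critical_potential cD.
rewrite VD cardsT -[#|D|]/(num_vertices D) -[#|arcs D|]/(num_arcs D) in le4 o.
have iff4 : four_Ore D <-> (10 * num_vertices D = 3 * num_arcs D + 4)%N.
  by split=> [/four_Ore_card|/o h] //; apply: arcs_four_Ore.
clear cD VD o; move: (num_vertices D) (num_arcs D) le4 iff4 => n m le4 iff4.
have toR (p : nat) : (10 * n <= 3 * m + p)%N = (10 * n%:R <= 3 * m%:R + p%:R :> rat).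
  by rewrite -(ler_nat rat) natrD !natrM.
split.
- by move: le4; rewrite toR; lra.
- rewrite iff4; split=> [h|/(congr1 (fun k => k%:R : rat))].
    by apply/eqP; rewrite -(eqr_nat rat) natrD !natrM; apply/eqP; rewrite h; field.
  by rewrite natrD !natrM => h; lra.
move=> no; have : (10 * n <= 3 * m + 3)%N.
  have : (10 * n)%N <> (3 * m + 4)%N by move=> /iff4.
  by lia.
by rewrite toR; lra.
Qed.
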